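(* Let $N$ be any positive integer and let $A_N$ be the finite square matrix over the finite ring $R/(p^N)$ obtained by reducing modulo $p^N$ those entries $m_{uv}=\tau^{-1}(F_{pu-v})$ of $M$ whose row index $u$ and column index $v$ are vectors in $C(\Delta)\cap\mathbb{Z}_{\ge0}^{n+1}$ with $w(u)<(p/(p-1))^2N$ and $w(v)<(p/(p-1))^2N$. Then for every $k\ge1$, \[(q^k-1)^{n+1}\,\mathrm{Tr}\Big(\big(\prod_{i=0}^{a-1}\tau^{-i}(A_N)\big)^k\Big)\equiv q^kN_k^*-(q^k-1)^n \pmod{p^N},\] where $N_k^*$ is the number of solutions of $f=0$ in the affine torus $(\mathbb{F}_{q^k}^* )^n$, $\tau^{-i}$ acts entrywise, and the product is taken in the order $A_N\,\tau^{-1}(A_N)\cdots\tau^{-(a-1)}(A_N)$. Moreover, the size of $A_N$ is $W=\#(t\Delta)$, the number of lattice points of $\mathbb{Z}^{n+1}$ in the dilation $t\Delta$, where $t=\lceil p^2N/(p-1)^2\rceil-1$.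
   Context: $p$ prime, $q=p^a$, $f\in\mathbb{F}_q[X_1,\dots,X_n]$ nonzero of total degree $d$. $\Omega$ is the completion of an algebraic closure of $\mathbb{Q}_p$, with valuation $\mathrm{ord}$, $\mathrm{ord}(p)=1$. Fix $\pi\in\Omega$ with $\pi^{p-1}=-p$; $R_1=\mathbb{Z}_p[\pi]$; $R_0$ the ring of integers of the unramified extension of $\mathbb{Q}_p$ of degree $a$ in $\Omega$ (residue field $\mathbb{F}_q$); $R$ the compositum of $R_0$ and $R_1$. $\tau$ is the automorphism of $R$ that is the identity on $R_1$ and restricts on $R_0$ to the lift of Frobenius (reducing to $x\mapsto x^p$ modulo $p$); it induces an automorphism of $R/(p^N)$. Teichmüller lift: a nonzero $x\in\bar{\mathbb{F}}_q$ lifts to the unique root of unity of order prime to $p$ in the maximal unramified extension of $\mathbb{Q}_p$ congruent to $x$ mod $p$; $0$ lifts to $0$. Let $\theta(z)=\exp(\pi z-\pi z^p)\in R_1[[z]]$. Write $X_0f=\sum_{j\in J}\bar a_jX^j$ in multi-index notation with $X=(X_0,\dots,X_n)$, $\bar a_j\ne0$, and let $a_j$ be the Teichmüller lift of $\bar a_j$. Put $F(X)=\prod_{j\in J}\theta(a_jX^j)=\sum_rF_rX^r\in R[[X]]$, with $F_r:=0$ if $r$ has a negative entry. Let $\delta\subset\mathbb{R}^n$ be any convex polytope with integer vertices with $\delta_1\subseteq\delta\subseteq\delta_2$, where $\delta_1$ is the convex hull of the exponent vectors of the nonzero terms of $f$ and $\delta_2$ is the convex hull of $0,(d,0,\dots,0),\dots,(0,\dots,0,d)$.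 Let $\Delta\subset\mathbb{R}^{n+1}$ be the convex hull of the origin and $\{(1,x):x\in\delta\}$, and $C(\Delta)$ the union of all rays from the origin through $\Delta$. The weight of $r=(r_0,\dots,r_n)\in\mathbb{R}^{n+1}$ is $w(r)=r_0$ if $r\in C(\Delta)$ and $w(r)=\infty$ otherwise. $M$ is the infinite matrix with rows and columns indexed by $C(\Delta)\cap\mathbb{Z}_{\ge0}^{n+1}$ and $(u,v)$ entry $m_{uv}=\tau^{-1}(F_{pu-v})$. Rows and columns of $A_N$ are indexed by the same finite index set (in a common ordering). *)

(* Defs.v *)
From HB Require Import structures.
From mathcomp Require Import all_boot all_order all_algebra ring_quotient.
From mathcomp Require Import all_classical all_reals.
(* The notations of mpoly clash with those of mathcomp-classical. *)
From mathcomp Require Import -(notations) mpoly.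

Set Implicit Arguments.
Unset Strict Implicit.
Unset Printing Implicit Defensive.

Import Order.TTheory GRing.Theory Num.Theory.

Local Open Scope classical_set_scope.
Local Open Scope ring_scope.

Section Subrings.
Variable A : comNzRingType.

Record subring_of (S : subringClosed A) : Type :=
  Subring { subring_val : A; _ : subring_val \in S }.

HB.instance Definition _ (S : subringClosed A) :=
  [isSub of subring_of S for @subring_val S].
HB.instance Definition _ (S : subringClosed A) :=
  [Choice of subring_of S by <:].
HB.instance Definition _ (S : subringClosed A) :=
  [SubChoice_isSubComNzRing of subring_of S by <:].

Definition gen_pred (X : set A) : {pred A} :=
  [pred x | `[< forall S : subringClosed A,
                  (forall y, X y -> y \in S) -> x \in S >]].

Lemma gen_pred_closed (X : set A) : subring_closed (gen_pred X).
Proof.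
split.
- by apply/asboolP => S _; exact: rpred1.
- move=> x y /asboolP hx /asboolP hy; apply/asboolP => S XS.
  by apply: rpredB; [exact: hx|exact: hy].
- move=> x y /asboolP hx /asboolP hy; apply/asboolP => S XS.
  by apply: rpredM; [exact: hx|exact: hy].
Qed.

HB.instance Definition _ (X : set A) :=
  GRing.isSubringClosed.Build A (gen_pred X) (gen_pred_closed X).

Definition gen_subring (X : set A) : subringClosed A := gen_pred X.

Definition principal_pred (x : A) : {pred A} :=
  [pred z | `[< exists y, z = x * y >]].

Lemma principal_closed (x : A) :
  (forall y, x * y != 1) -> idealr_closed (principal_pred x).
Proof.
move=> hx; split.
- by apply/asboolP; exists 0; rewrite mulr0.
- by apply/asboolP => -[y /esym /eqP]; rewrite (negbTE (hx y)).
- move=> a u v /asboolP[y ->] /asboolP[z ->]; apply/asboolP.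
  by exists (a * y + z); rewrite mulrDr mulrCA.
Qed.

(* mathcomp's ring quotients are by proper ideals, hence the side condition *)
Definition principal_idealr (x : A) (hx : forall y, x * y != 1) : idealr A :=
  HB.pack_for (idealr A) (principal_pred x : A -> bool)
    (isIdealr.Build A (principal_pred x) (principal_closed hx)).

(* the map induced on A / I by g; meaningful when g preserves I *)
Definition quot_map (I : idealr A) (g : A -> A)
    (x : {ideal_quot I}) : {ideal_quot I} :=
  (\pi_({ideal_quot I}) (g (repr x)))%qT.

End Subrings.

Record valuedField (R : realType) := ValuedField {
  vf_sort :> fieldType;
  ord : vf_sort -> \bar R;
  ord_gtNy : forall x, (-oo < ord x)%E;
  ord_eqy : forall x, (ord x == +oo%E) = (x == 0);
  ordM : forall x y, ord (x * y) = (ord x + ord y)%E;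
  ordD : forall x y, (mine (ord x) (ord y) <= ord (x + y))%E }.

Section Valued.
Variables (R : realType) (V : valuedField R).
Implicit Types (x y : V) (C : R) (K : {pred V}).

Definition vcauchy (u : nat -> V) := forall C, exists n0, forall m n,
  (n0 <= m)%N -> (n0 <= n)%N -> (C%:E <= ord (u m - u n))%E.

Definition vcvg (u : nat -> V) (l : V) := forall C, exists n0, forall n,
  (n0 <= n)%N -> (C%:E <= ord (u n - l))%E.

Definition vcomplete := forall u, vcauchy u -> exists l, vcvg u l.

(* the closure of Q in V: in a complete V with ord p = 1 it is the field of
   p-adic numbers *)
Definition Qp : {pred V} :=
  [pred x | `[< forall C, exists r : rat, (C%:E <= ord (x - ratr r))%E >]].

Definition Zp : {pred V} := [pred x in Qp | (0 <= ord x)%E].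

Definition algebraic_over K x :=
  exists P : {poly V}, [/\ P != 0, P \is a polyOver K & root P x].

Definition alg_closed_subfield K := forall P : {poly V},
  P \is a polyOver K -> (1 < size P)%N -> exists2 x, x \in K & root P x.

Definition is_alg_closure_Qp (K : divringClosed V) :=
  [/\ {subset Qp <= K}, forall x, x \in K -> algebraic_over Qp x
    & alg_closed_subfield K].

Definition vdense K := forall x C, exists2 y, y \in K & (C%:E <= ord (x - y))%E.

Definition is_completed_alg_closure_Qp (p : nat) :=
  [/\ ord (p%:R : V) = 1%:E, vcomplete
    & exists2 K : divringClosed V, is_alg_closure_Qp K & vdense K].

Definition degree_over_Qp (K : divringClosed V) (a : nat) :=
  exists2 e : 'I_a -> V, (forall i, e i \in K) &
  forall x, x \in K -> exists! c : 'rV[V]_a,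
    (forall i, c 0 i \in Qp) /\ x = \sum_i c 0 i * e i.

(* degree a and ramification index 1; the residue fields being finite, hence
   perfect, no separability condition is needed *)
Definition is_unramified_ext (a : nat) (K : divringClosed V) :=
  [/\ {subset Qp <= K}, degree_over_Qp K a
    & forall x, x \in K -> x != 0 ->
        exists2 y, y \in Qp & ord x = ord y].

Definition in_max_unramified x :=
  exists b (K : divringClosed V), is_unramified_ext b K /\ x \in K.

Lemma ord_fin x : x != 0 -> ord x \is a fin_num.
Proof.
move=> x0; rewrite fin_numE -ltNye ord_gtNy /=.
by rewrite ord_eqy.
Qed.

Lemma ord1 : ord (1 : V) = 0%E.
Proof.
have := ordM (1 : V) 1; rewrite mulr1.
have := ord_fin (oner_neq0 V).
case: (ord 1) => // r _ [] /eqP.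
by rewrite -subr_eq0 opprD addNKr oppr_eq0 => /eqP ->.
Qed.

Lemma ordN x : ord (- x) = ord x.
Proof.
suff h : ord (-1 : V) = 0%E by rewrite -mulN1r ordM h add0e.
have := ordM (-1 : V) (-1); rewrite mulrNN mulr1 ord1.
have : (-1 : V) != 0 by rewrite oppr_eq0 oner_neq0.
move/ord_fin; case: (ord _) => // r _ [] /esym/eqP.
by rewrite -mulr2n mulrn_eq0 /= => /eqP ->.
Qed.

Definition vint : {pred V} := [pred x | (0 <= ord x)%E].

Lemma vint_closed : subring_closed vint.
Proof.
split.
- by rewrite !inE ord1.
- move=> x y; rewrite !inE => hx hy; apply: le_trans (ordD _ _).
  by rewrite le_min hx ordN.
- by move=> x y; rewrite !inE => hx hy; rewrite ordM adde_ge0.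
Qed.

HB.instance Definition _ := GRing.isSubringClosed.Build V vint vint_closed.

Definition integers_pred (K : divringClosed V) : {pred V} := [predI K & vint].

Lemma integers_closed (K : divringClosed V) : subring_closed (integers_pred K).
Proof.
split.
- by apply/andP; split; exact: rpred1.
- by move=> x y /andP[? ?] /andP[? ?]; apply/andP; split; exact: rpredB.
- by move=> x y /andP[? ?] /andP[? ?]; apply/andP; split; exact: rpredM.
Qed.

HB.instance Definition _ (K : divringClosed V) :=
  GRing.isSubringClosed.Build V (integers_pred K) (integers_closed K).

(* R_0, for K the unramified extension of degree a *)
Definition ring_of_integers (K : divringClosed V) : subringClosed V :=
  integers_pred K.

(* R_1 = Z_p[pi] *)
Definition Zp_adjoin (pi : V) : subringClosed V :=
  gen_subring [set x | x \in Zp \/ x = pi].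

Definition compositum (S T : subringClosed V) : subringClosed V :=
  gen_subring [set x | x \in S \/ x \in T].

Definition Rring (K : divringClosed V) (pi : V) : comNzRingType :=
  subring_of (compositum (ring_of_integers K) (Zp_adjoin pi)).

Lemma gen_sub_vint (X : set V) x :
  (forall y, X y -> y \in vint) -> x \in gen_subring X -> x \in vint.
Proof. by move=> h /asboolP; exact. Qed.

Lemma Rring_pN (K : divringClosed V) (pi : V) (p N : nat) :
  prime p -> is_completed_alg_closure_Qp p -> pi ^+ p.-1 = - p%:R ->
  (0 < N)%N ->
  forall y : Rring K pi, (p ^ N)%:R * y != 1.
Proof.
move=> pp [op _ _] hpi N0 y.
have pi_int : pi \in vint.
  rewrite inE leNgt; apply/negP => pi_neg.
  have : (ord (pi ^+ p.-1) <= 0)%E.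
    elim: p.-1 => [|n IH]; first by rewrite expr0 ord1.
    rewrite exprS ordM -(adde0 0%E).
    by apply: leeD => //; exact: ltW.
  by rewrite hpi ordN op lee_fin ler10.
have y_int : val y \in vint.
  apply: gen_sub_vint (valP y) => z [/andP[_ //]|].
  by apply: gen_sub_vint => t [/andP[_ //]|->].
have pN_gt0 : (0 < ord ((p%:R : V) ^+ N))%E.
  case: N N0 => // N _; elim: N => [|N IH]; first by rewrite expr1 op lte_fin.
  by rewrite exprS ordM op adde_gt0 // lte_fin.
apply/eqP => /(congr1 val); rewrite rmorphM rmorph_nat rmorph1 natrX.
move/(congr1 (@ord R V)); rewrite ordM ord1 => h.
have := lt_le_trans pN_gt0 (leeDl _ y_int).
by rewrite h ltxx.
Qed.

(* R / (p^N) *)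
Definition RpN_ideal (K : divringClosed V) (pi : V) (p N : nat)
    (pp : prime p) (hV : is_completed_alg_closure_Qp p)
    (hpi : pi ^+ p.-1 = - p%:R) (hN : (0 < N)%N) : idealr (Rring K pi) :=
  principal_idealr (Rring_pN pp hV hpi hN).

(* the lift of Frobenius on R_0, x |-> x^p mod p *)
Definition is_frobenius_lift (p : nat) (K : divringClosed V) (pi : V)
    (tau : Rring K pi -> Rring K pi) :=
  forall x : Rring K pi, val x \in ring_of_integers K ->
    exists2 c, c \in ring_of_integers K & val (tau x) = val x ^+ p + p%:R * c.

(* F, with reduction map red, is the residue field of R_0 *)
Definition is_residue_map (K : divringClosed V) (F : fieldType)
    (red : subring_of (ring_of_integers K) -> F) :=
  (forall z, exists y : subring_of (ring_of_integers K), red y = z) /\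
  (forall y : subring_of (ring_of_integers K), red y = 0 <-> (0 < ord (val y))%E).

Definition is_teichmuller (p : nat) (K : divringClosed V) (F : fieldType)
    (red : subring_of (ring_of_integers K) -> F) (x : F) (t : V) :=
  [/\ in_max_unramified t,
      exists m, [/\ (0 < m)%N, coprime m p & t ^+ m = 1]
    & exists2 y : subring_of (ring_of_integers K), red y = x & (1%:E <= ord (t - val y))%E].

Definition teichmuller (p : nat) (K : divringClosed V) (F : fieldType)
    (red : subring_of (ring_of_integers K) -> F) (x : F) : V :=
  if x == 0 then 0 else xget 0 [set t | is_teichmuller p red x t].

(* the coefficient of z^m in exp(g) = sum_l g^l / l!, g = pi z - pi z^p; the
   terms with l > m do not contribute since z divides g *)
Definition theta (p : nat) (pi : V) (m : nat) : V :=
  \sum_(l < m.+1) ((l`!)%:R)^-1 * ((pi *: 'X - pi *: 'X^p) ^+ l)`_m.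

End Valued.

Section Dwork.

(* X_0 f, the variables X_1, ..., X_n of f becoming the last n ones *)
Definition X0_mul (F : fieldType) (n : nat) (f : mpoly.mpoly n F) :
    mpoly.mpoly n.+1 F :=
  mpolyX F (mnm1 ord0) *
  comp_mpoly [tuple mpolyX F (mnm1 (lift ord0 i)) | i < n] f.

Variables (R : realType) (V : valuedField R).

(* F_r, with the series theta(a_j X^j) truncated after (a_j X^j)^(r_0): every j
   has j_0 = 1, so that the dropped terms are divisible by X_0^(r_0 + 1) *)
Definition Fcoef (p : nat) (pi : V) (F : fieldType) (n : nat)
    (f : mpoly.mpoly n F) (lft : F -> V) (r : 'rV[int]_(1 + n)) : V :=
  if [forall i, 0 <= r 0 i] then
    mcoeff (Multinom [tuple absz (r 0 i) | i < n.+1])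
      (\prod_(j <- msupp (X0_mul f))
         \sum_(m < (absz (r 0%R ord0)).+1)
            theta p pi m *: (lft (mcoeff j (X0_mul f)) *: mpolyX V j) ^+ m)
  else 0.

(* F_r as an element of R: theta has coefficients in Z_p[pi], so that the
   default value 0 of insubd is never used *)
Definition FcoefR (p : nat) (K : divringClosed V) (pi : V) (F : fieldType)
    (n : nat) (f : mpoly.mpoly n F) (lft : F -> V) (r : 'rV[int]_(1 + n)) :
    Rring K pi :=
  insubd (0 : Rring K pi) (Fcoef p pi f lft r).

End Dwork.

Section Polytopes.
Variable R : realType.

Definition convex_hull (m : nat) (A : set 'rV[R]_m) : set 'rV[R]_m :=
  [set x | exists k (v : 'I_k -> 'rV[R]_m) (c : 'I_k -> R),
     [/\ forall i, A (v i), forall i, 0 <= c i, \sum_i c i = 1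
       & x = \sum_i c i *: v i]].

Definition toR (m : nat) (u : 'rV[int]_m) : 'rV[R]_m := map_mx intr u.

Definition is_lattice_polytope (m : nat) (delta : set 'rV[R]_m) :=
  exists s : seq 'rV[int]_m, delta = convex_hull [set toR u | u in [set` s]].

Definition mnm_toR (n : nat) (j : multinom n) : 'rV[R]_n := \row_i (j i)%:R.

Definition delta1 (F : fieldType) (n : nat) (f : mpoly.mpoly n F) :
    set 'rV[R]_n :=
  convex_hull [set mnm_toR j | j in [set` msupp f]].

(* msize f is the total degree of f plus 1 *)
Definition delta2 (F : fieldType) (n : nat) (f : mpoly.mpoly n F) :
    set 'rV[R]_n :=
  convex_hull
    [set x | x = 0 \/ exists i, x = ((msize f).-1)%:R *: delta_mx 0 i].

Definition Delta (n : nat) (delta : set 'rV[R]_n) : set 'rV[R]_(1 + n) :=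
  convex_hull [set y | y = 0 \/ exists2 x, delta x & y = row_mx 1%:M x].

Definition dilate (m : nat) (t : R) (A : set 'rV[R]_m) : set 'rV[R]_m :=
  [set t *: x | x in A].

Definition cone (m : nat) (A : set 'rV[R]_m) : set 'rV[R]_m :=
  [set y | exists2 t, 0 <= t & dilate t A y].

Definition weight (n : nat) (delta : set 'rV[R]_n) (r : 'rV[R]_(1 + n)) :
    \bar R :=
  if r \in cone (Delta delta) then (r 0 ord0)%:E else +oo%E.

Definition index_set (p N n : nat) (delta : set 'rV[R]_n) :
    set 'rV[int]_(1 + n) :=
  [set u : 'rV[int]_(1 + n) |
    [/\ forall i, 0 <= u 0 i, cone (Delta delta) (toR u)
    & (weight delta (toR u) < ((p%:R / (p%:R - 1)) ^+ 2 * N%:R)%:E)%E]].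

Definition lattice_points (m : nat) (A : set 'rV[R]_m) : set 'rV[int]_m :=
  [set u | A (toR u)].

End Polytopes.

(* the number of zeros of f in the torus (L^* )^n, for iota : F -> L *)
Definition torus_count (F : fieldType) (L : finFieldType)
    (iota : {rmorphism F -> L}) (n : nat) (f : mpoly.mpoly n F) : nat :=
  #|[set x : {ffun 'I_n -> L} |
      [forall i, x i != 0] && (meval x (map_mpoly iota f) == 0)]|.

Definition enumerates (T : Type) (m : nat) (idx : 'I_m -> T) (A : set T) :=
  injective idx /\ range idx = A.

(* Main.v *)
(* Up to the factor prod_(i >= 2) exp(- pi^(p^i) z^(p^i) / p^i), the series theta(z)
   is the Artin-Hasse exponential at pi z, whence ord theta_m >= m kappa with
   kappa = (p - 1) / p^2.  Thus ord m_uv >= (p w(u) - w(v)) kappa, and after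
   conjugation by the weights every row with w(u) >= (p / (p - 1))^2 N is divisible
   by p^N.  Modulo p^N the matrix A_N may therefore be replaced by the matrix of a
   polynomial truncation of F, on a finite index set that is large enough for all
   products to be exact: the (u, v) entry of the product of the matrices of P_0, ...,
   P_(l-1) is the coefficient of X^(p^l u - v) in prod_i P_i(X^(p^(l-1-i))).  The
   trace is then a sum of coefficients over exponents divisible by q^k - 1, that is,
   up to (q^k - 1)^(n+1), the sum of the values at the Teichmuller points of the
   torus.  These values are Psi(x_0 f(x_1, ..., x_n)) for the nontrivial additive
   character Psi(x) = prod_i theta(omega(x)^(p^i)) = theta(1)^(Tr x) of F_(q^k), and
   summing over x_0 counts the zeros of f. *)
Require Import Defs.
From HB Require Import structures.
From mathcomp Require Import all_boot all_order all_algebra ring_quotient.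
From mathcomp Require Import all_classical all_reals.
From mathcomp Require Import -(notations) mpoly.
From mathcomp Require Import zify ring lra.
From mathcomp Require finfield cyclic.

Set Implicit Arguments.
Unset Strict Implicit.
Unset Printing Implicit Defensive.

Import Order.TTheory GRing.Theory Num.Theory.

Local Open Scope classical_set_scope.
Local Open Scope ring_scope.

(** * Valuations *)

(** All estimates take place in Omega, not in R / (p^N): by [Rring_dvd] an element of R of valuation
    at least N is divisible by p^N in R, so a bound on a valuation gives the congruence. The field
    of q^k elements gets no ring of integers of its own; its Teichmuller lift is a bare
    multiplicative map into Omega, additive modulo the maximal ideal, and congruences between its
    values become equalities because both sides are fixed by the q^k-th power. The threshold comes
    from (p w(u) - w(v)) kappa = (w(u) - w(v)) kappa + (p - 1) w(u) kappa: conjugation absorbs the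
    first summand, and the second reaches N exactly when w(u) >= (p / (p - 1))^2 N. No power series
    is formed: exp is handled coefficient by coefficient, and a value at 1 is a limit of partial
    sums. The delicate point is that exp(pi z) diverges at z = 1, so that putting z = 1 in exp(pi z
    - pi z^p) would wrongly give exp(0) = 1 for theta(1). *)

Section Valuation.
Variables (R : realType) (V : valuedField R).
Implicit Types (x y : V) (c d : R).

(** A real bound keeps extended reals out of the estimates; [vge c (x - y)] plays the role of a
    congruence. *)
Definition vge c x : bool := (c%:E <= ord x)%E.

Lemma ord_0 : ord (0 : V) = +oo%E.
Proof. by apply/eqP; rewrite ord_eqy. Qed.

Lemma vge0 c : vge c 0.
Proof. by rewrite /vge ord_0 leey. Qed.

Lemma vge1 : vge 0 1.
Proof. by rewrite /vge Defs.ord1. Qed.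

Lemma vgeN c x : vge c (- x) = vge c x.
Proof. by rewrite /vge ordN. Qed.

Lemma vgeD c x y : vge c x -> vge c y -> vge c (x + y).
Proof. by move=> hx hy; apply: le_trans (ordD _ _); rewrite le_min; apply/andP. Qed.

Lemma vgeB c x y : vge c x -> vge c y -> vge c (x - y).
Proof. by move=> hx hy; rewrite vgeD ?vgeN. Qed.

Lemma vgeBC c x y : vge c (x - y) = vge c (y - x).
Proof. by rewrite -vgeN opprB. Qed.

Lemma vgeDl c x y : vge c x -> vge c (x + y) = vge c y.
Proof.
move=> hx; apply/idP/idP => [h|h]; last exact: vgeD.
by rewrite -(addKr x y) vgeD ?vgeN.
Qed.

Lemma vge_trans c x y z : vge c (x - y) -> vge c (y - z) -> vge c (x - z).
Proof. by move=> h1 h2; rewrite -(subrKA y) vgeD. Qed.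

Lemma vge_le c d x : c <= d -> vge d x -> vge c x.
Proof. by move=> cd; apply: le_trans; rewrite lee_fin. Qed.

Lemma vgeM c d x y : vge c x -> vge d y -> vge (c + d) (x * y).
Proof. by move=> hx hy; rewrite /vge ordM EFinD leeD. Qed.

Lemma vgeMl c x y : vge 0 x -> vge c y -> vge c (x * y).
Proof. by move=> hx hy; rewrite -[c]add0r vgeM. Qed.

Lemma vgeMr c x y : vge c x -> vge 0 y -> vge c (x * y).
Proof. by move=> hx hy; rewrite mulrC vgeMl. Qed.

Lemma vge_sum c (I : Type) (r : seq I) (P : pred I) (F : I -> V) :
  (forall i, P i -> vge c (F i)) -> vge c (\sum_(i <- r | P i) F i).
Proof. by move=> h; apply: (big_ind (fun x => vge c x)) => //; [exact: vge0|move=> ? ?; exact: vgeD]. Qed.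

Lemma vge_prod0 (I : Type) (r : seq I) (P : pred I) (F : I -> V) :
  (forall i, P i -> vge 0 (F i)) -> vge 0 (\prod_(i <- r | P i) F i).
Proof. by move=> h; apply: (big_ind (fun x => vge 0 x)) => //; [exact: vge1|move=> ? ?; exact: vgeMl]. Qed.

Lemma vgeX c x n : vge c x -> vge (n%:R * c) (x ^+ n).
Proof.
move=> hx; elim: n => [|n IH]; first by rewrite mul0r expr0 vge1.
by rewrite exprS -natr1 mulrDl mul1r addrC vgeM.
Qed.

Lemma vgeX0 x n : vge 0 x -> vge 0 (x ^+ n).
Proof. by move=> /(@vgeX 0 x n); rewrite mulr0. Qed.

Lemma vge_nat n : vge 0 n%:R.
Proof.
elim: n => [|n IH]; first by rewrite vge0.
by rewrite -natr1 vgeD // vge1.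
Qed.

Lemma vge_int (n : int) : vge 0 n%:~R.
Proof. by case: n => n; rewrite ?NegzE ?mulrNz ?vgeN vge_nat. Qed.

Lemma vgeMn c x n : vge c x -> vge c (x *+ n).
Proof. by move=> hx; rewrite -mulr_natl vgeMl // vge_nat. Qed.

Lemma vge_eq0 x : (forall c, vge c x) -> x = 0.
Proof.
move=> h; apply/eqP/negPn/negP => x0; have := h (fine (ord x) + 1).
by rewrite /vge -{2}(fineK (ord_fin x0)) lee_fin leNgt ltrDl ltr01.
Qed.

Lemma vge_eq x y : (forall n : nat, vge n%:R (x - y)) -> x = y.
Proof.
move=> h; apply/eqP; rewrite -subr_eq0; apply/eqP/vge_eq0 => c.
apply: vge_le (h (Num.bound `|c|)).
by apply: le_trans (ler_norm _) (ltW _); apply: archi_boundP.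
Qed.

Lemma ordV x : x != 0 -> ord x^-1 = (- ord x)%E.
Proof.
move=> x0; have xf := ord_fin x0.
have xVf : ord x^-1 \is a fin_num by rewrite ord_fin // invr_eq0.
have := ordM x x^-1; rewrite divff // Defs.ord1 -(fineK xf) -(fineK xVf) => -[] /eqP.
by rewrite eq_sym addr_eq0 => /eqP ->; rewrite EFinN oppeK.
Qed.

Lemma vgeV x c : ord x = c%:E -> vge (- c) x^-1.
Proof.
move=> hx; have x0 : x != 0 by rewrite -ord_eqy hx.
by rewrite /vge ordV // hx.
Qed.

Lemma ordX x n c : ord x = c%:E -> ord (x ^+ n) = (n%:R * c)%:E.
Proof.
move=> hx; elim: n => [|n IH]; first by rewrite mul0r expr0 Defs.ord1.
by rewrite exprS ordM IH hx -EFinD -natr1 mulrDl mul1r addrC.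
Qed.

Lemma vge_divr c d x y : ord y = d%:E -> vge c x -> vge (c - d) (x / y).
Proof. by move=> hy hx; rewrite vgeM // vgeV. Qed.

Lemma ord_gt_sum (e : \bar R) (I : Type) (r : seq I) (P : pred I) (F : I -> V) :
  (e < +oo)%E -> (forall i, P i -> (e < ord (F i))%E) ->
  (e < ord (\sum_(i <- r | P i) F i)%R)%E.
Proof.
move=> ey h; apply: (big_ind (fun x => (e < ord x)%E)) => //; first by rewrite ord_0.
by move=> x y hx hy; apply: lt_le_trans (ordD _ _); rewrite lt_min hx.
Qed.

Lemma ord_domin x y : (ord x < ord y)%E -> ord (x + y) = ord x.
Proof.
move=> h; apply/eqP; rewrite eq_le; apply/andP; split; last first.
  by apply: le_trans (ordD _ _); rewrite le_min lexx ltW.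
rewrite leNgt; apply/negP => h2.
have := ordD (x + y) (- y); rewrite addrK ordN.
by rewrite leNgt lt_min h2 h.
Qed.

(** The nonzero term of least valuation strictly dominates all others, so its valuation is that of
    the sum. *)
Lemma ord_sum_distinct (I : finType) (F : I -> V) :
  (forall i j, i != j -> F i != 0 -> ord (F i) != ord (F j)) ->
  forall c, vge c (\sum_i F i) -> forall i, vge c (F i).
Proof.
move=> hd c hc i.
have [Fi0|Fi0] := eqVneq (F i) 0; first by rewrite Fi0 vge0.
have [j Fj0 jmin] :=
  @arg_minP _ _ I i (fun i => F i != 0) (fun i => fine (ord (F i))) Fi0.
have hj k : k != j -> (ord (F j) < ord (F k))%E.
  move=> kj; have [->|Fk0] := eqVneq (F k) 0; first by rewrite ord_0 ltey_eq ord_fin.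
  have jk : j != k by rewrite eq_sym.
  rewrite lt_neqAle (hd _ _ jk Fj0) /=.
  by rewrite -(fineK (ord_fin Fj0)) -(fineK (ord_fin Fk0)) lee_fin jmin.
move: hc; rewrite (bigD1 j) //= /vge ord_domin; last first.
  by apply: ord_gt_sum => //; rewrite ltey_eq ord_fin.
have [->//|ij] := eqVneq i j.
by move=> /le_trans; apply; apply/ltW/hj.
Qed.

Lemma vge_lim (u : nat -> V) l c n0 : vcvg u l ->
  (forall n, (n0 <= n)%N -> vge c (u n)) -> vge c l.
Proof.
move=> /(_ c) [n1 h] hu.
have m1 := h _ (leq_maxr n0 n1); have m2 := hu _ (leq_maxl n0 n1).
by rewrite -(subKr (u (maxn n0 n1)) l) vgeB.
Qed.

Lemma vcauchy_step (u : nat -> V) (c e : R) : 0 < e ->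
  (forall n, vge (c + n%:R * e) (u n.+1 - u n)) ->
  vcauchy u /\ forall n m, (n <= m)%N -> vge (c + n%:R * e) (u m - u n).
Proof.
move=> e0 h.
have hh n m : (n <= m)%N -> vge (c + n%:R * e) (u m - u n).
  move=> /subnK <-; elim: (m - n)%N => [|k IH]; first by rewrite subrr vge0.
  rewrite addSn; apply: vge_trans IH; apply: vge_le (h _).
  by rewrite lerD2l ler_pM2r // ler_nat leq_addl.
split=> // C; pose n0 := Num.bound `|(C - c) / e|; exists n0 => m n hm hn.
have hn0 : C <= c + n0%:R * e.
  rewrite -lerBlDl -ler_pdivrMr //; apply: le_trans (ler_norm _) (ltW _).
  exact: archi_boundP.
apply: (@vge_trans C _ (u n0)); first by apply: vge_le (hh _ _ hm).
by rewrite -vgeN opprB; apply: vge_le (hh _ _ hn).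
Qed.

Lemma vgeBX c x y n : vge 0 x -> vge 0 y -> vge c (x - y) ->
  vge c (x ^+ n - y ^+ n).
Proof.
move=> x0 y0 h; rewrite subrXX vgeMr // vge_sum // => i _.
by rewrite vgeMl // vgeX0.
Qed.

End Valuation.

Arguments vge {R V}.

Section OrdNat.
Variables (R : realType) (V : valuedField R) (p : nat).
Hypothesis (pp : prime p) (op : ord (p%:R : V) = 1%:E).
Implicit Types (x y : V) (c d : R).

Lemma ord_coprime n : coprime n p -> ord (n%:R : V) = 0%E.
Proof.
move=> cnp; apply/eqP; rewrite eq_le; apply/andP; split; last exact: vge_nat.
have p1 := prime_gt1 pp.
have n0 : (0 < n)%N.
  by case: n cnp => //; rewrite /coprime gcd0n => /eqP p_1; rewrite p_1 in p1.
have [u v uv _] := egcdnP p n0.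
rewrite (eqP cnp) in uv.
have u1 : (u%:R * n%:R : V) = v%:R * p%:R + 1 by rewrite -!natrM uv natrD.
have h1 : ord (u%:R * n%:R : V) = 0%E.
  rewrite u1 addrC ord_domin Defs.ord1 // ordM op.
  apply: (@lt_le_trans _ _ (0 + 1)%E); first by rewrite add0e lte_fin.
  by apply: leeD => //; exact: vge_nat.
by rewrite -h1 ordM leeDr //; exact: vge_nat.
Qed.

Lemma ord_nat n : (0 < n)%N -> ord (n%:R : V) = ((logn p n)%:R)%:E.
Proof.
move=> n0; have [m pm nE] := pfactor_coprime pp n0.
rewrite {1}nE natrM ordM natrX (ordX _ op) mulr1 ord_coprime ?add0e //.
by rewrite coprime_sym.
Qed.

Lemma natr_neq0 n : (0 < n)%N -> (n%:R : V) != 0.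
Proof. by move=> n0; rewrite -ord_eqy ord_nat. Qed.

Lemma intr_ord (z : int) : z != 0 -> ord (z%:~R : V) = ((logn p `|z|)%:R)%:E.
Proof.
move=> z0; have : (0 < `|z|)%N by rewrite absz_gt0.
case: z z0 => n z0 n0; first by rewrite -ord_nat.
by rewrite NegzE mulrNz ordN -ord_nat.
Qed.

Lemma intr_V_eq0 (z : int) : ((z%:~R : V) == 0) = (z == 0).
Proof.
apply/idP/idP => [|/eqP -> //]; apply: contraTT => z0.
by rewrite -ord_eqy intr_ord.
Qed.

(** Legendre's formula. The induction keeps the quotient k %/ p ^ L inside the inequality; at L =
    [trunc_log p k] it is at least 1, which turns the bound k into k - 1. *)
Lemma logn_fact_le k : (0 < k)%N -> (p.-1 * logn p k`! <= k.-1)%N.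
Proof.
move=> k0; rewrite logn_fact //; have p1 := prime_gt1 pp.
have h L : (p.-1 * (\sum_(1 <= i < L.+1) k %/ p ^ i) + k %/ p ^ L <= k)%N.
  elim: L => [|L IH]; first by rewrite big_geq // muln0 expn0 divn1.
  rewrite big_nat_recr //= mulnDr -addnA; apply: leq_trans IH.
  rewrite leq_add2l -{2}(mul1n (_ %/ _)%N) -mulnDl addn1 prednK ?prime_gt0 //.
  by rewrite expnSr divnMA mulnC leq_divM.
have := h (trunc_log p k).
have tl : (1 <= k %/ p ^ trunc_log p k)%N.
  by rewrite divn_gt0 ?expn_gt0 ?prime_gt0 // trunc_logP.
rewrite (@big_cat_nat _ _ _ (trunc_log p k).+1 _ k.+1) //=; last first.
  rewrite ltnS; apply: ltnW; apply: leq_trans (ltn_expl _ p1) _.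
  exact: trunc_logP.
rewrite [X in (p.-1 * (_ + X))%N]big1_seq; first by lia.
move=> i /andP[_]; rewrite mem_index_iota => /andP[hi _]; apply: divn_small.
apply: leq_trans (trunc_log_ltn k p1) _.
by rewrite leq_exp2l.
Qed.

Lemma vge_factV k : (0 < k)%N -> vge (- (k.-1%:R / p.-1%:R)) ((k`!)%:R^-1 : V).
Proof.
move=> k0; have p1 := prime_gt1 pp.
apply: (@vge_le _ _ _ (- (logn p k`!)%:R)); last first.
  by apply: vgeV; rewrite ord_nat // fact_gt0.
rewrite lerN2 ler_pdivlMr; last by rewrite ltr0n -subn1 subn_gt0.
by rewrite -natrM ler_nat mulnC logn_fact_le.
Qed.

Lemma intr_Fermat (n : nat) : vge 1 (n%:R ^+ p - n%:R : V).
Proof.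
have : (n ^ p = n %[mod p])%N by exact: fermat_little.
wlog : / (n <= n ^ p)%N.
  by apply; case: n => // n; rewrite -{1}(expn1 n.+1) leq_pexp2l // prime_gt0.
move=> h /eqP; rewrite eqn_mod_dvd // => /dvdnP [k hk].
by rewrite -natrX -natrB // hk natrM mulrC vgeMr // ?vge_nat // /vge op.
Qed.

(** A rational number closer to x than the valuation of x has that same valuation. *)
Lemma Qp_ord_int x : x \in @Qp R V -> x != 0 ->
  exists z : int, ord x = (z%:~R)%:E.
Proof.
move=> /asboolP h x0; have [r hr] := h (fine (ord x) + 1).
have ordr : ord (ratr r : V) = ord x.
  have -> : ratr r = x + - (x - ratr r) by rewrite opprB addrC subrK.
  apply: ord_domin; rewrite ordN; apply: lt_le_trans hr.
  by rewrite -{1}(fineK (ord_fin x0)) lte_fin ltrDl ltr01.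
have r0 : ratr r != 0 :> V by rewrite -ord_eqy ordr ord_eqy.
have nr0 : numq r != 0.
  by apply: contra_neq r0 => r0; rewrite /ratr r0 mul0r.
exists ((logn p `|numq r|)%:Z - (logn p `|denq r|)%:Z).
rewrite -ordr /ratr ordM ordV ?intr_V_eq0 ?denq_eq0 // !intr_ord ?denq_eq0 //.
by rewrite intrD mulrNz.
Qed.

End OrdNat.

(** * The ring R *)

Lemma gen_subring_mem (A : comNzRingType) (X : set A) x :
  X x -> x \in gen_subring X.
Proof. by move=> Xx; apply/asboolP => S; apply. Qed.

Lemma gen_subring_sub (A : comNzRingType) (X : set A) (S : {pred A}) :
  subring_closed S -> (forall y, X y -> y \in S) ->
  {subset gen_subring X <= S}.
Proof.
move=> Sc XS x /asboolP h.
pose T : subringClosed A := HB.pack_for (subringClosed A) (S : A -> bool)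
  (GRing.isSubringClosed.Build A S Sc).
exact: (h T).
Qed.

Section Ramified.
Variables (R : realType) (p : nat) (V : valuedField R) (pi : V).
Hypotheses (pp : prime p) (op : ord (p%:R : V) = 1%:E).
Hypothesis hpi : pi ^+ p.-1 = - p%:R.
Implicit Types (x y : V) (c d C : R).

Let p1_gt0 : (0 < p.-1)%N.
Proof. by rewrite -subn1 subn_gt0 prime_gt1. Qed.

Lemma ord_pi : ord pi = (p.-1%:R^-1)%:E.
Proof.
have pi0 : pi != 0.
  apply/eqP => pi0; move: hpi; rewrite pi0 expr0n gtn_eqF // => /eqP.
  by rewrite eq_sym oppr_eq0 (negbTE (natr_neq0 pp op (prime_gt0 pp))).
have := ordX p.-1 (esym (fineK (ord_fin pi0))).
rewrite hpi ordN op => -[] h; rewrite -(fineK (ord_fin pi0)); congr (_%:E).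
apply: (mulfI (_ : p.-1%:R != 0 :> R)); first by rewrite pnatr_eq0 -lt0n.
by rewrite -h divff // pnatr_eq0 -lt0n.
Qed.

Lemma pi_neq0 : pi != 0.
Proof. by rewrite -ord_eqy ord_pi. Qed.

Lemma ord_piX n : ord (pi ^+ n) = (n%:R / p.-1%:R)%:E.
Proof. exact: (ordX n ord_pi). Qed.

Lemma vge_piX n : vge (n%:R / p.-1%:R) (pi ^+ n).
Proof. by rewrite /vge ord_piX. Qed.

(** The valuation of the i-th term lies in i / (p - 1) + Z, so two nonzero terms never have equal
    valuations and [ord_sum_distinct] applies. *)
Lemma pi_indep (x : 'I_p.-1 -> V) C :
  (forall i, x i != 0 -> exists z : int, ord (x i) = (z%:~R)%:E) ->
  vge C (\sum_i x i * pi ^+ i) -> forall i, vge C (x i * pi ^+ i).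
Proof.
move=> hx; apply: ord_sum_distinct => i j ij.
rewrite !ordM !ord_piX mulf_eq0 negb_or => /andP[xi0 _].
have [xj0|xj0] := eqVneq (x j) 0.
  by have [z ->] := hx i xi0; rewrite xj0 ord_0.
have [z ->] := hx i xi0; have [z' ->] := hx j xj0.
apply: contra_neq ij; rewrite -!EFinD => -[] h.
have h1 : (z - z') * p.-1%:Z = j%:Z - i%:Z.
  apply: (@intr_inj R); rewrite rmorphM !rmorphB /= -!pmulrn.
  have p0 : (p.-1%:R : R) != 0 by rewrite pnatr_eq0 -lt0n.
  have -> : (z%:~R : R) = z'%:~R + j%:R / p.-1%:R - i%:R / p.-1%:R.
    by rewrite -h addrK.
  by field.
have := ltn_ord i; have := ltn_ord j => lj li.
apply: val_inj => /=; have [zz|zz] := eqVneq z z'; first by move: h1; rewrite zz; lia.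
exfalso; move: p1_gt0 lj li h1 zz; set m := p.-1; set a := nat_of_ord i.
by set b := nat_of_ord j; nia.
Qed.

(** The coefficient of pi^i once exponents are reduced below p - 1 by means of pi^(p-1) = -p. *)
Definition pi_red (c : nat -> V) (n : nat) (i : 'I_p.-1) : V :=
  \sum_(l < n | (l %% p.-1 == i)%N) c l * (- p%:R) ^+ (l %/ p.-1).

Lemma pi_redE (c : nat -> V) (n : nat) :
  \sum_(l < n) c l * pi ^+ l = \sum_i pi_red c n i * pi ^+ i.
Proof.
rewrite (partition_big (fun l : 'I_n => Ordinal (ltn_pmod l p1_gt0)) xpredT) //=.
apply: eq_bigr => i _; rewrite /pi_red mulr_suml; apply: eq_big => // l.
move=> /eqP <- /=.
by rewrite -mulrA -hpi -exprM -exprD mulnC -divn_eq.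
Qed.

End Ramified.

(** * Rational numbers inside V *)

Section Fractions.
Variables (R : realType) (p : nat) (V : valuedField R).
Hypotheses (pp : prime p) (op : ord (p%:R : V) = 1%:E).
Implicit Types (x y : V).

Definition isfrac x :=
  exists (a : int) (b : nat), (0 < b)%N /\ x = a%:~R / b%:R.

Lemma isfrac_int (z : int) : isfrac z%:~R.
Proof. by exists z, 1%N; rewrite divr1. Qed.

Lemma isfrac_nat n : isfrac n%:R.
Proof. exact: (isfrac_int n%:Z). Qed.

Lemma isfracD x y : isfrac x -> isfrac y -> isfrac (x + y).
Proof.
move=> [a [b [b0 ->]]] [a' [b' [b0' ->]]].
exists (a * b'%:Z + a' * b%:Z), (b * b')%N; split; first by rewrite muln_gt0 b0.
have h := natr_neq0 pp op b0; have h' := natr_neq0 pp op b0'.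
by rewrite rmorphD !rmorphM /= -!pmulrn; field; apply/andP.
Qed.

Lemma isfracM x y : isfrac x -> isfrac y -> isfrac (x * y).
Proof.
move=> [a [b [b0 ->]]] [a' [b' [b0' ->]]].
exists (a * a'), (b * b')%N; split; first by rewrite muln_gt0 b0.
have h := natr_neq0 pp op b0; have h' := natr_neq0 pp op b0'.
by rewrite !rmorphM /=; field; apply/andP.
Qed.

Lemma isfracN x : isfrac x -> isfrac (- x).
Proof. by rewrite -mulN1r; apply: isfracM; exact: (isfrac_int (-1)). Qed.

Lemma isfracVn n : isfrac n%:R^-1.
Proof.
case: n => [|n]; first by rewrite invr0; exact: (isfrac_nat 0).
by exists 1, n.+1; rewrite mul1r.
Qed.

Lemma isfracX x n : isfrac x -> isfrac (x ^+ n).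
Proof.
move=> hx; elim: n => [|n IH]; first exact: (isfrac_nat 1).
by rewrite exprS; apply: isfracM.
Qed.

Lemma isfrac_sum (I : Type) (r : seq I) (P : pred I) (F : I -> V) :
  (forall i, P i -> isfrac (F i)) -> isfrac (\sum_(i <- r | P i) F i).
Proof.
move=> h; apply: (big_ind isfrac) => //; first exact: (isfrac_nat 0).
exact: isfracD.
Qed.

Lemma isfrac_Qp x : isfrac x -> x \in @Qp R V.
Proof.
move=> [a [b [b0 ->]]]; apply/asboolP => C.
exists (a%:~R / b%:R); suff -> : ratr (a%:~R / b%:R) = a%:~R / b%:R :> V.
  by rewrite subrr; exact: vge0.
set r : rat := _ / _.
have h : numq r * b%:Z = a * denq r.
  apply: (@intr_inj rat); rewrite !rmorphM /=.
  have e : (numq r)%:~R = r * (denq r)%:~R by rewrite -{2}(divq_num_den r) mulfVK ?intr_eq0 ?denq_eq0.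
  by rewrite e /r -pmulrn; field; rewrite pnatr_eq0 -lt0n.
have d0 : ((denq r)%:~R : V) != 0 by rewrite (intr_V_eq0 pp op) denq_eq0.
have b0' := natr_neq0 pp op b0.
rewrite /ratr; apply: (mulIf d0); rewrite mulfVK //.
apply: (mulIf b0'); rewrite mulrAC mulfVK //.
have /(congr1 (fun z : int => (z%:~R : V))) := h.
by rewrite !rmorphM /=.
Qed.

(** A p-integral fraction is congruent modulo p to a natural number s, to which Fermat's little
    theorem applies. *)
Lemma isfrac_Fermat x : isfrac x -> vge 0 x -> vge 1 (x ^+ p - x).
Proof.
move=> hx x0.
have [s hs] : exists s : nat, vge 1 (x - s%:R).
  move: hx => [a [b [b0 xE]]].
  have hb := natr_neq0 pp op b0.
  have [m pm bE] := pfactor_coprime pp b0.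
  have m0 : (0 < m)%N.
    by case: m pm bE => // _ bE; move: b0; rewrite bE mul0n.
  have hm := natr_neq0 pp op m0.
  have [u v uv _] := egcdnP p m0.
  have cmp : gcdn m p = 1%N by apply/eqP; rewrite gcdnC.
  rewrite cmp in uv.
  (* Here m is the prime-to-p part of the denominator; its p-part divides the numerator because x is
     integral. *)
  have [z hz] : exists z : int, x * m%:R = z%:~R.
    have [x00|xn0] := eqVneq x 0; first by exists 0; rewrite x00 mul0r.
    have a0 : a != 0.
      by apply: contra_neq xn0; rewrite xE => ->; rewrite mul0r.
    have : (logn p b <= logn p `|a|)%N.
      move: x0; rewrite /vge xE ordM ordV // (ord_nat pp op b0) (intr_ord pp op a0).
      by rewrite -EFinN -EFinD lee_fin subr_ge0 ler_nat.
    rewrite -pfactor_dvdn ?absz_gt0 // => /dvdnP [k hk].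
    exists (sgz a * k%:Z); move: bE hk; set l := logn p b => bE hk.
    have pn0 : (p%:R : V) ^+ l != 0.
      by rewrite expf_neq0 // (natr_neq0 pp op) ?prime_gt0.
    have aE : (a%:~R : V) = (sgz a * k%:Z)%:~R * p%:R ^+ l.
      by rewrite {1}[a]intEsg hk PoszM mulrA rmorphM /= -pmulrn natrX.
    by rewrite xE aE bE natrM natrX; field; apply/andP.
  (* s := z * u mod p, as m u = 1 mod p *)
  have [s hs] : exists s : nat, exists t : int, (s%:Z = z * u%:Z + t * p%:Z).
    exists (absz ((z * u%:Z) %% p%:Z)%Z), (- ((z * u%:Z) %/ p%:Z)%Z).
    rewrite gez0_abs ?modz_ge0 ?lt0r_neq0 ?ltz_nat ?prime_gt0 //.
    by rewrite {2}(divz_eq (z * u%:Z) p%:Z); ring.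
  exists s; case: hs => t hs.
  have -> : (s%:R : V) = z%:~R * u%:R + t%:~R * p%:R.
    have /(congr1 (fun z : int => (z%:~R : V))) := hs.
    by rewrite rmorphD !rmorphM /= -!pmulrn.
  have -> : x - (z%:~R * u%:R + t%:~R * p%:R) = - p%:R * (x * v%:R + t%:~R).
    rewrite -hz; have : (u%:R * m%:R : V) = v%:R * p%:R + 1.
      by rewrite -!natrM uv natrD.
    by move=> e; rewrite -[x * m%:R * u%:R]mulrA [m%:R * _]mulrC e; ring.
  rewrite vgeMr ?vgeN //; first by rewrite /vge op.
  by rewrite vgeD ?vge_int // vgeMr ?vge_nat.
have s0 : vge 0 (s%:R : V) by exact: vge_nat.
apply: (vge_trans (y := s%:R ^+ p)); first exact: vgeBX.
apply: (vge_trans (y := s%:R)); first exact: intr_Fermat.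
by rewrite vgeBC.
Qed.

End Fractions.

Section Integers.
Variables (R : realType) (p : nat) (V : valuedField R) (pi : V).
Variables (a : nat) (K : divringClosed V).
Hypotheses (pp : prime p) (op : ord (p%:R : V) = 1%:E).
Hypothesis hpi : pi ^+ p.-1 = - p%:R.
Hypothesis hK : is_unramified_ext a K.
Implicit Types (x y : V) (c d C : R).

Local Notation R0 := (ring_of_integers K).

Lemma K_Qp x : x \in @Qp R V -> x \in K.
Proof. by case: hK => h _ _ /h. Qed.

Lemma K_ord_int x : x \in K -> x != 0 -> exists z : int, ord x = (z%:~R)%:E.
Proof.
case: hK => _ _ h xK x0; have [y yQ e] := h x xK x0.
by rewrite e; apply: (Qp_ord_int pp op yQ); rewrite -ord_eqy -e ord_eqy.
Qed.

Lemma R0P x : reflect (x \in K /\ vge 0 x) (x \in R0).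
Proof. exact: (iffP andP). Qed.

(** K is unramified, so valuations are integers and a lower bound above z - 1 rounds up to z. *)
Lemma K_vge_int x (z : int) C : x \in K -> z%:~R - 1 < C -> vge C x -> vge z%:~R x.
Proof.
move=> xK zC hx; have [->|x0] := eqVneq x 0; first exact: vge0.
have [w hw] := K_ord_int xK x0; move: hx; rewrite /vge hw !lee_fin => hx.
rewrite ler_int; have : z - 1 < w by rewrite -(ltr_int R) rmorphB /= (lt_le_trans zC).
by lia.
Qed.

Lemma Rring_poly (x : Rring K pi) :
  exists P : {poly V}, P \is a polyOver R0 /\ val x = P.[pi].
Proof.
pose S : {pred V} := [pred z | `[< exists P : {poly V}, P \is a polyOver R0 /\ z = P.[pi] >]].
have Sc : subring_closed S.
  split.
  - apply/asboolP; exists 1; split; first exact: rpred1.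
    by rewrite hornerE.
  - move=> u v /asboolP[P [hP ->]] /asboolP[Q [hQ ->]]; apply/asboolP.
    by exists (P - Q); rewrite rpredB // !hornerE.
  - move=> u v /asboolP[P [hP ->]] /asboolP[Q [hQ ->]]; apply/asboolP.
    by exists (P * Q); rewrite rpredM // hornerM.
have R0S z : z \in R0 -> z \in S.
  move=> hz; apply/asboolP; exists z%:P; rewrite hornerC; split=> //.
  by rewrite polyOverC.
apply/asboolP; apply: (gen_subring_sub Sc) (valP x) => y [/R0S //|].
apply: (gen_subring_sub Sc) => z [/andP[zQ z0]|->].
  by apply/R0S/R0P; split => //; exact: K_Qp.
by apply/asboolP; exists 'X; rewrite hornerX polyOverX.
Qed.

Lemma R0_Rring x : x \in R0 -> x \in compositum R0 (Zp_adjoin pi).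
Proof. by move=> h; apply: gen_subring_mem; left. Qed.

Lemma Zpi_Rring x : x \in Zp_adjoin pi -> x \in compositum R0 (Zp_adjoin pi).
Proof. by move=> h; apply: gen_subring_mem; right. Qed.

Lemma pi_Zpi : pi \in Zp_adjoin pi.
Proof. by apply: gen_subring_mem; right. Qed.

Lemma Zp_Zpi x : x \in @Defs.Zp R V -> x \in Zp_adjoin pi.
Proof. by move=> h; apply: gen_subring_mem; left. Qed.

(** An element of R is a sum of y_i pi^i with i < p - 1 and y_i in K. By [pi_indep] every term has
    valuation at least N, so ord y_i >= N - i / (p - 1) > N - 1; integrality of valuations on K
    gives ord y_i >= N, and p^N divides each coefficient. *)
Lemma Rring_dvd (N : nat) (x : Rring K pi) : vge N%:R (val x) ->
  exists z, x = (p ^ N)%:R * z.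
Proof.
have p1_gt0 : (0 < p.-1)%N by rewrite -subn1 subn_gt0 prime_gt1.
have [P [hP xE]] := Rring_poly x.
rewrite xE horner_coef (pi_redE pp hpi) => hN.
set y := pi_red _ _ in hN xE.
have yK i : y i \in K.
  apply: rpred_sum => l _; rewrite rpredM ?rpredX ?rpredN ?rpred_nat //.
  by have /R0P[] := polyOverP hP l.
have pn0 : ((p ^ N)%:R : V) != 0 by rewrite (natr_neq0 pp op) // expn_gt0 prime_gt0.
have opN : ord ((p ^ N)%:R : V) = (N%:R)%:E.
  by rewrite natrX (ordX N op) mulr1.
have yN i : y i / (p ^ N)%:R \in R0.
  apply/R0P; split; first by rewrite rpredM ?rpredV ?rpred_nat.
  rewrite -(subrr (N%:R : R)); apply: vge_divr opN _.
  have := pi_indep pp op hpi (fun i => K_ord_int (yK i)) hN i.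
  move=> /(vge_divr (ord_piX pp op hpi i)); rewrite mulfK; last first.
    by rewrite expf_neq0 // (pi_neq0 pp op hpi).
  apply: (K_vge_int (z := N%:Z)) => //.
  rewrite ltrD2l ltrN2 ltr_pdivrMr ?ltr0n // mul1r ltr_nat.
  exact: ltn_ord.
have zR : \sum_i (y i / (p ^ N)%:R) * pi ^+ i \in compositum R0 (Zp_adjoin pi).
  apply: rpred_sum => i _; rewrite rpredM ?rpredX //; first exact: R0_Rring.
  exact/Zpi_Rring/pi_Zpi.
exists (Subring zR); apply: val_inj; rewrite rmorphM rmorph_nat /= xE.
rewrite horner_coef (pi_redE pp hpi) mulr_sumr; apply: eq_bigr => i _.
by rewrite mulrA; congr (_ * _); rewrite mulrC mulfVK.
Qed.

End Integers.

(** * Teichmuller representatives *)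

Lemma finField_primitive_root (L : finFieldType) :
  exists g : L, #|L|.-1.-primitive_root g.
Proof.
have L1 := card_finNzRing_gt1 L.
have Q1 : (0 < #|L|.-1)%N by rewrite -subn1 subn_gt0.
pose rs := [seq x <- enum L | x != 0].
have rsu : all #|L|.-1.-unity_root rs.
  apply/allP => x; rewrite mem_filter => /andP[x0 _]; apply/unity_rootP.
  by apply: (mulfI x0); rewrite -exprS (prednK (ltnW L1)) mulr1 finfield.expf_card.
have srs : size rs = #|L|.-1.
  rewrite size_filter cardE.
  have := count_predC (pred1 (0 : L)) (enum L); rewrite count_uniq_mem ?enum_uniq //.
  by rewrite mem_enum inE /= => <-; rewrite add1n.
have /hasP[g _ gP] := cyclic.has_prim_root Q1 rsu (filter_uniq _ (enum_uniq _)) (eq_leq (esym srs)).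
by exists g.
Qed.

(** * Congruences modulo the maximal ideal *)

Section Positive.
Variables (R : realType) (V : valuedField R).
Implicit Types (x y z : V) (c d C : R).

(** Membership in the maximal ideal. The valuation need not be discrete, so no single positive
    constant in [vge] can replace the strict inequality. *)
Definition vpos x : bool := (0%E < ord x)%E.

Lemma vposP x : reflect (exists2 c : R, 0 < c & vge c x) (vpos x).
Proof.
apply: (iffP idP) => [h|[c c0 h]]; last by apply: lt_le_trans h; rewrite lte_fin.
have [->|x0] := eqVneq x 0; first by exists 1; rewrite ?vge0.
exists (fine (ord x)); last by rewrite /vge fineK // ord_fin.
by move: h; rewrite /vpos -{1}(fineK (ord_fin x0)) lte_fin.
Qed.

Lemma vge_vpos c x : 0 < c -> vge c x -> vpos x.
Proof. by move=> c0 h; apply/vposP; exists c. Qed.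

Lemma vpos0 : vpos 0.
Proof. by rewrite /vpos ord_0 ltry. Qed.

Lemma vposN x : vpos (- x) = vpos x.
Proof. by rewrite /vpos ordN. Qed.

Lemma vposD x y : vpos x -> vpos y -> vpos (x + y).
Proof. by move=> hx hy; apply: lt_le_trans (ordD _ _); rewrite lt_min; apply/andP. Qed.

Lemma vposBC x y : vpos (x - y) = vpos (y - x).
Proof. by rewrite -vposN opprB. Qed.

Lemma vpos_trans x y z : vpos (x - y) -> vpos (y - z) -> vpos (x - z).
Proof. by move=> h1 h2; rewrite -(subrKA y) vposD. Qed.

Lemma vposMl x y : vge 0 x -> vpos y -> vpos (x * y).
Proof. by move=> hx /vposP[c c0 hy]; apply/vposP; exists c => //; rewrite vgeMl. Qed.

Lemma vposMr x y : vpos x -> vge 0 y -> vpos (x * y).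
Proof. by move=> hx hy; rewrite mulrC vposMl. Qed.

Lemma vpos_sum (I : Type) (r : seq I) (P : pred I) (F : I -> V) :
  (forall i, P i -> vpos (F i)) -> vpos (\sum_(i <- r | P i) F i).
Proof. by move=> h; apply: ord_gt_sum => //; exact: ltry. Qed.

Lemma vposBM x x' y y' : vge 0 x -> vge 0 y' -> vpos (x - x') -> vpos (y - y') ->
  vpos (x * y - x' * y').
Proof.
move=> x0 y0 hx hy; have -> : x * y - x' * y' = x * (y - y') + (x - x') * y' by ring.
by apply: vposD; [exact: vposMl|exact: vposMr].
Qed.

Lemma ord_unity M x : (0 < M)%N -> x ^+ M = 1 -> ord x = 0%E.
Proof.
move=> M0 hx; have x0 : x != 0.
  by apply: contra_eq_neq hx => ->; rewrite expr0n gtn_eqF // eq_sym oner_neq0.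
have := ordX M (esym (fineK (ord_fin x0))).
rewrite hx Defs.ord1 -{2}(fineK (ord_fin x0)) => -[] /esym/eqP.
by rewrite mulf_eq0 pnatr_eq0 eqn0Ngt M0 /= => /eqP ->.
Qed.

(** If ord z were negative, the leading term would have strictly smaller valuation than every other
    term and could not cancel. *)
Lemma monic_root_integral (M : {poly V}) z : M \is monic ->
  (forall i, vge 0 M`_i) -> M.[z] = 0 -> vge 0 z.
Proof.
move=> Mm hM hz; rewrite /vge leNgt; apply/negP => oz.
have z0 : z != 0 by apply: contraTneq oz => ->; rewrite ord_0.
set o := fine (ord z); have zo : ord z = o%:E by rewrite fineK // ord_fin.
have o0 : o < 0 by move: oz; rewrite zo lte_fin.
move: hz; rewrite horner_coef; have := size_poly_gt0 M.
rewrite (monic_neq0 Mm); case sM : (size M) => [//|n] _.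
have Mn : M`_n = 1 by move/monicP: Mm; rewrite lead_coefE sM.
rewrite big_ord_recr /= Mn mul1r => /eqP; rewrite addr_eq0 => /eqP hs.
have := @ord_gt_sum _ V (n%:R * o)%:E 'I_n (index_enum 'I_n) xpredT (fun i => M`_i * z ^+ i) (ltry _).
rewrite hs ordN (ordX _ zo) ltxx; suff h i : true ->
  ((n%:R * o)%:E < ord (M`_(nat_of_ord (i : 'I_n)) * z ^+ (nat_of_ord i)))%E by move/(_ h).
move=> _; apply: (@lt_le_trans _ _ (i%:R * o)%:E).
  by rewrite lte_fin ltr_nM2r // ltr_nat.
by rewrite -[leLHS]add0e ordM leeD //; [exact: hM|rewrite (ordX _ zo)].
Qed.

End Positive.

Section TeichLimit.
Variables (R : realType) (p : nat) (V : valuedField R).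
Hypotheses (pp : prime p) (op : ord (p%:R : V) = 1%:E).
Implicit Types (x y z : V) (c d C : R).

(** Expand (y + h)^p with ord h >= c. The middle binomial coefficients are divisible by p and gain 1
    >= e; the last term h^p has valuation at least 2 c >= c + e. *)
Lemma vgeBXp c e x y : 0 < e -> e <= 1 -> e <= c -> vge 0 y ->
  vge c (x - y) -> vge (c + e) (x ^+ p - y ^+ p).
Proof.
move=> e0 e1 ec y0 h; have p1 := prime_gt1 pp.
have c0 : 0 < c by exact: lt_le_trans ec.
have -> : x = y + (x - y) by rewrite addrC subrK.
move: (x - y) h => {}x h.
rewrite exprDn big_ord_recl /= subn0 expr0 mulr1 bin0 mulr1n addrAC subrr add0r.
apply: vge_sum => i _; rewrite /bump leq0n add1n.
have [ip|ip] := eqVneq i.+1 p.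
  rewrite ip subnn expr0 mul1r binn mulr1n; apply: vge_le (vgeX p h).
  have : 2 <= p%:R :> R by rewrite ler_nat.
  by move=> p2; nra.
have /dvdnP[k ->] : (p %| 'C(p, i.+1))%N.
  apply: prime_dvd_bin => //=; rewrite ltn_neqAle ip /=; exact: ltn_ord.
rewrite mulrnA -mulr_natr; apply: vgeM; last first.
  by apply: vge_le e1 _; rewrite /vge op.
rewrite vgeMn // vgeMl ?vgeX0 // exprS vgeMr // vgeX0 //.
by apply: vge_le h; rewrite ltW.
Qed.

Lemma vgeBXpn c e x y b : 0 < e -> e <= 1 -> e <= c -> vge 0 y -> vge 0 x ->
  vge c (x - y) -> (0 < b)%N -> vge (c + e) (x ^+ (p ^ b) - y ^+ (p ^ b)).
Proof.
move=> e0 e1 ec y0 x0 h; case: b => // b _.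
by rewrite expnS !exprM; apply: vgeBX; rewrite ?vgeX0 //; exact: vgeBXp.
Qed.

(** Raising to the power p^b is contracting on the residue class of z, so the iterates form a Cauchy
    sequence. The last clause, approximation by powers of z, is what later places t in K. *)
Lemma teich_lim b z c : vcomplete V -> vge 0 z -> (0 < b)%N -> 0 < c ->
  vge c (z ^+ (p ^ b) - z) ->
  exists t, [/\ t ^+ (p ^ b) = t, vge 0 t, vge c (t - z)
    & forall C, exists i, vge C (t - z ^+ ((p ^ b) ^ i))].
Proof.
move=> cV z0 b0 c0 hz; pose e := Num.min 1 c.
have e0 : 0 < e by rewrite lt_min ltr01.
have e1 : e <= 1 by rewrite ge_min lexx.
have ec : e <= c by rewrite ge_min lexx orbT.
pose u i := z ^+ ((p ^ b) ^ i).
have uS i : u i.+1 = u i ^+ (p ^ b) by rewrite /u expnSr exprM.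
have u0 i : vge 0 (u i) by exact: vgeX0.
have hu i : vge (c + i%:R * e) (u i.+1 - u i).
  elim: i => [|i IH]; first by rewrite mul0r addr0 uS /u expn0 expr1.
  rewrite [X in X - _]uS [X in _ - X]uS -natr1 mulrDl mul1r addrA; apply: vgeBXpn => //.
  by apply: le_trans ec _; rewrite lerDl mulr_ge0 // ltW.
have [cu hu2] := vcauchy_step e0 hu.
have [t ht] := cV _ cu.
have t0 : vge 0 t by exact: (vge_lim (n0 := 0%N) ht).
have apx C : exists n0, forall i, (n0 <= i)%N -> vge C (t - u i).
  by have [n0 h] := ht C; exists n0 => i /h; rewrite -/(vge _ _) vgeBC.
exists t; split => //.
- apply: vge_eq => n; have [n0 h] := apx n%:R.
  apply: (vge_trans (y := u n0.+1)); last by rewrite vgeBC h.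
  by rewrite uS; apply: vgeBX => //; exact: h.
- have [n0 h] := apx c; apply: (vge_trans (h _ (leqnn _))).
  have := hu2 0%N n0 (leq0n _); rewrite mul0r addr0.
  by rewrite {2}/u expn0 expr1.
- by move=> C; have [n0 h] := apx C; exists n0; exact: h.
Qed.

(** If x and y differed, (x^M - y^M) / (x - y) would vanish, yet it is congruent to M y^(M-1), a
    unit since p does not divide M. *)
Lemma unity_eq M x y : (0 < M)%N -> coprime M p -> x ^+ M = 1 -> y ^+ M = 1 ->
  vpos (x - y) -> x = y.
Proof.
move=> M0 cM hx hy h; apply/eqP; rewrite -subr_eq0; apply/negPn/negP => xy0.
have x0 := ord_unity M0 hx; have y0 := ord_unity M0 hy.
have vx : vge 0 x by rewrite /vge x0.
have vy : vge 0 y by rewrite /vge y0.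
have := subrXX x y M; rewrite hx hy subrr => /esym/eqP.
rewrite mulf_eq0 (negbTE xy0) /= => /eqP s0.
have : vpos (\sum_(i < M) x ^+ (M.-1 - i) * y ^+ i - \sum_(i < M) y ^+ M.-1).
  rewrite -sumrB; apply: vpos_sum => i _.
  have {2}-> : (M.-1 = (M.-1 - i) + i)%N by have := ltn_ord i; lia.
  rewrite exprD; apply: vposBM; rewrite ?vgeX0 ?subrr ?vpos0 //.
  rewrite subrXX; apply: vposMr => //; apply: vge_sum => j _.
  by rewrite vgeMl ?vgeX0.
have -> : \sum_(i < M) x ^+ (M.-1 - i) * y ^+ i = 0.
  by rewrite -[RHS]s0; apply: eq_bigr => i _; congr (_ ^+ _ * _); lia.
rewrite sub0r vposN sumr_const card_ord -mulr_natl /vpos ordM.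
rewrite (ord_coprime pp op cM) (ordX _ y0) mulr0 adde0.
by rewrite ltxx.
Qed.

Lemma fixed_unity b x : x != 0 -> x ^+ (p ^ b) = x -> x ^+ (p ^ b).-1 = 1.
Proof.
move=> x0 h; apply: (mulfI x0); rewrite -exprS prednK ?h ?mulr1 //.
by rewrite expn_gt0 prime_gt0.
Qed.

Lemma coprime_pred b : (0 < b)%N -> coprime (p ^ b).-1 p.
Proof.
move=> b0; apply: (@coprime_dvdr _ (p ^ b)).
  by case: b b0 => // b _; rewrite expnS dvdn_mulr.
by rewrite coprime_sym coprimenP ?expn_gt0 ?prime_gt0.
Qed.

Lemma pred_gt0 b : (0 < b)%N -> (0 < (p ^ b).-1)%N.
Proof.
move=> b0; rewrite -ltnS prednK ?expn_gt0 ?prime_gt0 //.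
by rewrite -(expn0 p) ltn_exp2l // prime_gt1.
Qed.

Lemma fixed_vge0 b x : (0 < b)%N -> x ^+ (p ^ b) = x -> vge 0 x.
Proof.
move=> b0 h; have [->|x0] := eqVneq x 0; first exact: vge0.
by rewrite /vge (ord_unity (pred_gt0 b0) (fixed_unity x0 h)).
Qed.

Lemma fixed_vpos b x : (0 < b)%N -> x ^+ (p ^ b) = x -> vpos x -> x = 0.
Proof.
move=> b0 h; apply: contraTeq => x0.
by rewrite /vpos (ord_unity (pred_gt0 b0) (fixed_unity x0 h)) ltxx.
Qed.

Lemma fixed_eq b x y : (0 < b)%N -> x ^+ (p ^ b) = x -> y ^+ (p ^ b) = y ->
  vpos (x - y) -> x = y.
Proof.
move=> b0 hx hy h; have [x0|x0] := eqVneq x 0.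
  by rewrite x0; move: h; rewrite x0 sub0r vposN => /(fixed_vpos b0 hy) ->.
have [y0|y0] := eqVneq y 0.
  by rewrite y0; move: h; rewrite y0 subr0; exact: (fixed_vpos b0 hx).
exact: (unity_eq (pred_gt0 b0) (coprime_pred b0) (fixed_unity x0 hx) (fixed_unity y0 hy)).
Qed.

Lemma fixed_mul b k x : x ^+ (p ^ b) = x -> x ^+ (p ^ (b * k)) = x.
Proof.
move=> h; elim: k => [|k IH]; first by rewrite muln0 expn0 expr1.
by rewrite mulnS expnD exprM h IH.
Qed.

End TeichLimit.

Section Teich.
Variables (R : realType) (p a : nat) (V : valuedField R).
Hypotheses (pp : prime p) (a0 : (0 < a)%N).
Hypotheses (op : ord (p%:R : V) = 1%:E) (cV : vcomplete V).
Variable K : divringClosed V.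
Hypothesis hK : is_unramified_ext a K.
Variables (F : finFieldType) (red : {rmorphism subring_of (ring_of_integers K) -> F}).
Hypotheses (hF : #|F| = (p ^ a)%N) (hred : is_residue_map red).
Implicit Types (x : F) (C : R).

Local Notation R0 := (ring_of_integers K).
Local Notation q := (p ^ a)%N.

Lemma K_vpos (x : V) : x \in K -> vpos x -> vge 1 x.
Proof.
move=> xK /vposP[c c0]; apply: (K_vge_int pp op hK (z := 1) xK).
by rewrite subrr.
Qed.

Lemma red_eq (y y' : subring_of R0) : red y = red y' -> vge 1 (val y - val y').
Proof.
move=> h; have : red (y - y') = 0 by rewrite rmorphB h subrr.
case: hred => _ /(_ (y - y')) [h1 _] /h1 /K_vpos; rewrite rmorphB; apply.
by rewrite rpredB //; [have /R0P[] := valP y|have /R0P[] := valP y'].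
Qed.

Lemma red_lift (c : F) : {y : subring_of R0 | red y = c}.
Proof. by apply: cid; case: hred => h _; exact: h. Qed.

Lemma Qp_lim (u : nat -> V) l : (forall n, isfrac (u n)) -> vcvg u l ->
  l \in @Qp R V.
Proof.
move=> hu hl; apply/asboolP => C; have [n0 h] := hl C.
have := isfrac_Qp pp op (hu n0) => /asboolP /(_ C) [r hr].
exists r; apply: (vge_trans (y := u n0)) hr.
by rewrite vgeBC; exact: h.
Qed.

(* Grouping the p-adic digits of t, taken in representatives e c of the residue
   field, according to c gives t = sum_c e c * Z_c with Z_c in Q_p. *)
Lemma K_closed t : vge 0 t -> (forall C, exists2 y, y \in K & vge C (t - y)) ->
  t \in K.
Proof.
(* The remainders of the digit expansion are only known to be limits of elements of K, so this
   weaker property is the invariant. *)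
pose apx t := vge 0 t /\ forall C, exists2 y, y \in K & vge C (t - y).
move=> t0 tK; have {tK t0} ht : apx t by split.
pose e (c : F) := val (sval (red_lift c)).
have eR c : e c \in R0 by exact: valP.
have /choice[dig hdig] : forall r, exists c, apx r -> vge 1 (r - e c).
  move=> r; have [[r0 rK]|nr] := pselect (apx r); last by exists 0 => /nr.
  have [y yK hy] := rK 1.
  have y0 : vge 0 y.
    by rewrite -(subKr r y) vgeB //; apply: vge_le hy; exact: ler01.
  have yR : y \in R0 by apply/R0P.
  exists (red (Subring yR)) => _; apply: (vge_trans hy).
  by apply: (@red_eq (Subring yR)); rewrite (svalP (red_lift _)).
have p0 : (p%:R : V) != 0 by rewrite (natr_neq0 pp op) // prime_gt0.
pose nxt t := (t - e (dig t)) / p%:R.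
pose s i := iter i nxt t.
have hs i : apx (s i).
  elim: i => // i IH; have hd := hdig _ IH; have {IH} [s0 sK] := IH.
  split; rewrite /s iterS -/(s i) /nxt.
    by rewrite -(subrr (1 : R)); apply: vge_divr.
  move=> C; have [y yK hy] := sK (C + 1).
  have /R0P[eK _] := eR (dig (s i)).
  exists ((y - e (dig (s i))) / p%:R); first by rewrite rpred_div ?rpredB ?rpred_nat.
  have -> : (s i - e (dig (s i))) / p%:R - (y - e (dig (s i))) / p%:R =
            (s i - y) / p%:R by rewrite -mulrBl opprB addrA subrK.
  by rewrite -(addrK 1 C); apply: vge_divr.
pose u c D : V := \sum_(i < D) (dig (s i) == c)%:R * p%:R ^+ i.
have tE D : t = \sum_c e c * u c D + p%:R ^+ D * s D.
  elim: D => [|D IH].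
    rewrite expr0 mul1r big1 ?add0r // => c _.
    by rewrite /u big_ord0 mulr0.
  rewrite {1}IH /u; under [in RHS]eq_bigr => c _ do rewrite big_ord_recr /= mulrDr.
  rewrite big_split /= -addrA; congr (_ + _).
  rewrite (bigD1 (dig (s D))) //= eqxx mul1r big1 ?addr0; last first.
    by move=> c; rewrite eq_sym => /negbTE ->; rewrite mul0r mulr0.
  by rewrite exprS /nxt; field.
have upD c D : vge (0 + D%:R * 1) (u c D.+1 - u c D).
  rewrite /u big_ord_recr /= addrAC subrr !add0r vgeMl ?vge_nat //.
  by apply: vgeX; rewrite /vge op.
have hlim c : {Z | vcvg (u c) Z}.
  by apply: cid; apply: cV; have [] := vcauchy_step ltr01 (upD c).
pose Z c := sval (hlim c).
suff -> : t = \sum_c e c * Z c.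
  apply: rpred_sum => c _; rewrite rpredM //; first by have /R0P[] := eR c.
  apply: (K_Qp hK); apply: Qp_lim (svalP (hlim c)) => D.
  apply: (isfrac_sum pp op) => i _.
  by apply: (isfracM pp op); [exact: isfrac_nat|apply: (isfracX pp op); exact: isfrac_nat].
apply: vge_eq => D; rewrite (tE D) addrAC -sumrB vgeD //; last first.
  by rewrite -[D%:R]addr0 vgeM //; [rewrite -[D%:R]mulr1; apply: vgeX; rewrite /vge op|have [] := hs D].
apply: vge_sum => c _; rewrite -mulrBr vgeMl //; first by have /R0P[] := eR c.
have hv : vcvg (fun n => u c D - u c n) (u c D - Z c).
  move=> C; have [n0 h] := svalP (hlim c) C; exists n0 => n hn.
  rewrite -/(vge _ _).
  have -> : u c D - u c n - (u c D - Z c) = Z c - u c n by ring.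
  by rewrite vgeBC; exact: h.
apply: (vge_lim (n0 := D) hv) => n hn.
have [_ h] := vcauchy_step ltr01 (upD c).
by rewrite vgeBC; have := h _ _ hn; rewrite add0r mulr1.
Qed.

Local Notation T := (teichmuller p red).

(** The limit of the powers y^(q^i); these lie in K, hence so does the limit by [K_closed], and K
    itself witnesses that t is in the maximal unramified extension. *)
Lemma teichmuller_exists (x : F) (y : subring_of R0) : x != 0 -> red y = x ->
  exists t, [/\ is_teichmuller p red x t, t \in K, t ^+ q = t & vge 1 (t - val y)].
Proof.
move=> x0 hy; have [yK y0] := R0P _ _ (valP y).
have [] := @teich_lim R p V pp op a (val y) 1 cV y0 a0 ltr01.
  rewrite -rmorphXn; apply: red_eq.
  by rewrite rmorphXn hy -hF finfield.expf_card.
move=> t [tq t0 ty tap]; exists t.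
have tK : t \in K.
  apply: K_closed => // C; have [i hi] := tap C.
  by exists (val y ^+ (q ^ i)) => //; exact: rpredX.
split => //; split.
- by exists a, K.
- exists q.-1; split; [exact: pred_gt0|exact: coprime_pred|].
  apply: (fixed_unity pp) => //; apply: contra_neqN x0 => t00.
  rewrite -hy; apply/(hred.2 y); rewrite -/(vpos _).
  by move: ty; rewrite (eqP t00) sub0r vgeN; apply: vge_vpos.
- by exists y.
Qed.

(** [teichmuller] picks an arbitrary witness. It equals the limit just built because both are roots
    of unity of the common order m (q - 1), prime to p, and are congruent. *)
Lemma teichmullerP (x : F) (y : subring_of R0) : red y = x ->
  [/\ T x \in R0, T x ^+ q = T x & vge 1 (T x - val y)].
Proof.
move=> hy; rewrite /teichmuller; case: eqVneq => [x0|x0].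
  split; first exact: rpred0.
    by rewrite expr0n expn_eq0 eqn0Ngt prime_gt0.
  rewrite sub0r vgeN -(subr0 (val y)) -(rmorph0 (val : subring_of R0 -> V)).
  by apply: red_eq; rewrite hy x0 rmorph0.
have [t [tT tK tq ty]] := teichmuller_exists x0 hy.
case: xgetP => [t' _ [_ [m [m0 cm tm]] [y' hy' ty']]|/(_ t tT)//].
have t0 : t != 0.
  apply: contra_neqN x0 => t00.
  rewrite -hy; apply/(hred.2 y); rewrite -/(vpos _).
  by move: ty; rewrite (eqP t00) sub0r vgeN; apply: vge_vpos.
suff -> : t' = t.
  by split => //; apply/R0P; split=> //; exact: (fixed_vge0 pp a0).
have M0 : (0 < m * q.-1)%N by rewrite muln_gt0 m0 pred_gt0.
have cM : coprime (m * q.-1) p by rewrite coprimeMl cm coprime_pred.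
apply: (unity_eq pp op M0 cM).
- by rewrite exprM tm expr1n.
- by rewrite mulnC exprM (fixed_unity pp t0 tq) expr1n.
apply: (vge_vpos ltr01); apply: vge_trans ty' _.
apply: (vge_trans (y := val y)); last by rewrite vgeBC.
by apply: red_eq; rewrite hy.
Qed.

Lemma teich_R0 x : T x \in R0.
Proof. by have [] := teichmullerP (svalP (red_lift x)). Qed.

Lemma teich_fixed x : T x ^+ q = T x.
Proof. by have [] := teichmullerP (svalP (red_lift x)). Qed.

Lemma teich_int x : vge 0 (T x).
Proof. exact: (fixed_vge0 pp a0 (teich_fixed x)). Qed.

Lemma teich0 : T 0 = 0.
Proof. by rewrite /teichmuller eqxx. Qed.

Lemma teich_add x x' : vpos (T (x + x') - (T x + T x')).
Proof.
have [y hy] := red_lift x; have [y' hy'] := red_lift x'.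
have hyy : red (y + y') = x + x' by rewrite rmorphD hy hy'.
have [_ _ /(vge_vpos ltr01) h1] := teichmullerP hy.
have [_ _ /(vge_vpos ltr01) h2] := teichmullerP hy'.
have [_ _ /(vge_vpos ltr01) h3] := teichmullerP hyy.
apply: (vpos_trans h3); rewrite vposBC rmorphD.
have -> : T x + T x' - (val y + val y') = (T x - val y) + (T x' - val y') by ring.
exact: vposD.
Qed.

Lemma teich_mul x x' : T (x * x') = T x * T x'.
Proof.
have [y hy] := red_lift x; have [y' hy'] := red_lift x'.
have hyy : red (y * y') = x * x' by rewrite rmorphM hy hy'.
have [_ _ /(vge_vpos ltr01) h1] := teichmullerP hy.
have [_ _ /(vge_vpos ltr01) h2] := teichmullerP hy'.
have [_ _ /(vge_vpos ltr01) h3] := teichmullerP hyy.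
apply: (fixed_eq pp op a0) => //; first exact: teich_fixed.
  by rewrite exprMn !teich_fixed.
apply: (vpos_trans h3); rewrite vposBC rmorphM vposBM ?teich_int //.
by have /R0P[] := valP y'.
Qed.

Lemma teich_neq0 x : x != 0 -> T x != 0.
Proof.
move=> x0; have [y hy] := red_lift x.
have [_ _ /(vge_vpos ltr01) h1] := teichmullerP hy.
apply: contra_neqN x0 => /eqP Tx0; rewrite -hy; apply/(hred.2 y).
by rewrite -/(vpos _) -vposN -sub0r -Tx0.
Qed.

Lemma teich1 : T 1 = 1.
Proof.
have h : T 1 != 0 by exact/teich_neq0/oner_neq0.
by apply: (mulfI h); rewrite -teich_mul !mulr1.
Qed.

Lemma teich_sum (I : Type) (r : seq I) (P : pred I) (G : I -> F) :
  vpos (T (\sum_(i <- r | P i) G i) - \sum_(i <- r | P i) T (G i)).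
Proof.
apply: (big_ind2 (fun x t => vpos (T x - t))) => [|x t x' t' h h'|i _].
- by rewrite teich0 subrr vpos0.
- apply: (vpos_trans (teich_add x x')).
  have -> : T x + T x' - (t + t') = (T x - t) + (T x' - t') by ring.
  exact: vposD.
- by rewrite subrr vpos0.
Qed.

(** The hypothesis on tau is only a congruence modulo p; it becomes an equality because tau x and
    x^p are both fixed by the q-th power. *)
Lemma teich_frobenius (pi : V) (tau : {rmorphism Rring K pi -> Rring K pi})
  (x : Rring K pi) (c : F) :
  is_frobenius_lift p tau -> val x = T c -> tau x = x ^+ p.
Proof.
move=> htau xc; have xR : val x \in R0 by rewrite xc teich_R0.
have xq : x ^+ q = x by apply: val_inj; rewrite rmorphXn /= xc teich_fixed.
apply: val_inj; rewrite rmorphXn /=.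
have [d /R0P[_ d0] hd] := htau x xR.
apply: (fixed_eq pp op a0).
- by have := congr1 (fun z => val (tau z)) xq; rewrite !rmorphXn.
- by rewrite exprAC xc teich_fixed.
by rewrite hd addrAC subrr add0r (vge_vpos ltr01) // vgeMr // /vge op.
Qed.

End Teich.

Lemma algclosed_root (R : realType) (V : valuedField R) (K : divringClosed V)
  (P : {poly V}) (t : V) : alg_closed_subfield K ->
  P \is a polyOver K -> P != 0 -> root P t -> t \in K.
Proof.
move=> cK; have [n] := ubnP (size P); elim: n P => // n IH P sP PK P0 Pt.
have s1 : (1 < size P)%N.
  rewrite ltnNge; apply: contraTN Pt => /size1_polyC Pc; move: P0.
  by rewrite Pc polyC_eq0 rootC.
have [x xK /factor_theorem[Q PQ]] := cK P PK s1.
have [->//|tx] := eqVneq t x.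
have Q0 : Q != 0 by apply: contra_neq P0; rewrite PQ => ->; rewrite mul0r.
have QK : Q \is a polyOver K.
  (* The relation Q_i = P_(i+1) + x Q_(i+1) gives the coefficients of Q from the top down; k bounds
     the distance to the top. *)
  have hQ k : forall i, (size Q - i <= k)%N -> Q`_i \in K.
    elim: k => [|k IHk] i hi.
      by rewrite nth_default ?rpred0 //; move: hi; rewrite leqn0 subn_eq0.
    have -> : Q`_i = P`_i.+1 + Q`_i.+1 * x.
      by rewrite PQ mulrBr coefB coefMX coefMC /= subrK.
    by rewrite rpredD ?rpredM ?(polyOverP PK) // IHk //; move: hi; lia.
  by apply/polyOverP => i; apply: hQ (leqnn _).
apply: (IH Q) => //.
- by move: sP; rewrite PQ size_Mmonic ?monicXsubC // size_XsubC addn2.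
- by move: Pt; rewrite PQ rootM root_XsubC (negbTE tx) orbF.
Qed.

Lemma algebra_minpoly (F L : fieldType) (iota : {rmorphism F -> L}) (g : L)
  (P0 : {poly F}) : P0 != 0 -> root (map_poly iota P0) g ->
  exists m : {poly F}, [/\ m \is monic, (1 < size m)%N
    & forall P, root (map_poly iota P) g -> m %| P].
Proof.
move=> P0n P0g.
have hex : exists n, `[< exists P, [/\ P != 0, root (map_poly iota P) g & size P = n] >].
  by exists (size P0); apply/asboolP; exists P0.
case: (ex_minnP hex) => n /asboolP[P [Pn Pg sP]] nmin.
have div Q : root (map_poly iota Q) g -> P %| Q.
  move=> Qg; apply/negPn/negP => nd.
  have : root (map_poly iota (Q %% P)) g.
    move: Qg; rewrite {1}(divp_eq Q P) rmorphD rmorphM /root hornerD hornerM.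
    by rewrite (eqP Pg) mulr0 add0r.
  move=> h; have := nmin (size (Q %% P)).
  have -> : `[< exists P1, [/\ P1 != 0, root (map_poly iota P1) g & size P1 = size (Q %% P)] >].
    by apply/asboolP; exists (Q %% P).
  by move/(_ isT); rewrite -sP leqNgt ltn_modp Pn.
have l0 : lead_coef P != 0 by rewrite lead_coef_eq0.
exists ((lead_coef P)^-1 *: P); split.
- by rewrite monicE lead_coefZ mulVf.
- rewrite size_scale ?invr_eq0 // ltnNge; apply: contraTN Pg => /size1_polyC Pc.
  rewrite Pc map_polyC rootC fmorph_eq0 -(polyC_eq0 P`_0) -Pc //.
- by move=> Q /div; rewrite dvdpZl // invr_eq0.
Qed.

(** * The Teichmuller lift of a finite extension L of the residue field *)

Section Omega.
Variables (R : realType) (p a : nat) (V : valuedField R).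
Hypotheses (pp : prime p) (a0 : (0 < a)%N) (hV : is_completed_alg_closure_Qp V p).
Variable K : divringClosed V.
Hypothesis hK : is_unramified_ext a K.
Variables (F : finFieldType) (red : {rmorphism subring_of (ring_of_integers K) -> F}).
Hypotheses (hF : #|F| = (p ^ a)%N) (hred : is_residue_map red).
Variables (L : finFieldType) (iota : {rmorphism F -> L}) (b : nat).
Hypotheses (b0 : (0 < b)%N) (ab : (a %| b)%N) (hL : #|L| = (p ^ b)%N).

Let op : ord (p%:R : V) = 1%:E. Proof. by case: hV. Qed.
Let cV : vcomplete V. Proof. by case: hV. Qed.

Local Notation T := (teichmuller p red).
Local Notation Q := (p ^ b)%N.

Implicit Types (P : {poly F}).

Let Tmul := teich_mul pp a0 op cV hK hF hred.
Let Tint := teich_int pp a0 op cV hK hF hred.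
Let Tsum := teich_sum pp a0 op cV hK hF hred.
Let T0 : T 0 = 0 := teich0 p red.
Let T1 : T 1 = 1 := teich1 pp a0 op cV hK hF hred.
Let TQ x : T x ^+ Q = T x.
Proof.
rewrite -(divnK ab) mulnC fixed_mul //.
exact: (teich_fixed pp a0 op cV hK hF hred x).
Qed.

(** The map T is additive only modulo the maximal ideal, so evaluating the lifted polynomial is a
    ring morphism only up to [vpos]. *)
Definition lift_eval (z : V) (P : {poly F}) : V := (map_poly T P).[z].

Lemma lift_evalE z P n : (size P <= n)%N -> lift_eval z P = \sum_(i < n) T P`_i * z ^+ i.
Proof.
move=> sP; rewrite /lift_eval (@horner_coef_wide _ n); last first.
  by apply: leq_trans sP; exact: size_poly.
by apply: eq_bigr => i _; rewrite coef_map_id0.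
Qed.

Section Eval.
Variable z : V.
Hypothesis z0 : vge 0 z.

Lemma lift_evalD P P' :
  vpos (lift_eval z (P + P') - (lift_eval z P + lift_eval z P')).
Proof.
pose n := maxn (size P) (size P').
rewrite !(@lift_evalE z _ n) ?leq_maxl ?leq_maxr //; last exact: size_polyD.
rewrite -big_split -sumrB; apply: vpos_sum => i _.
rewrite /= -mulrDl -mulrBl vposMr ?vgeX0 // coefD.
exact: (teich_add pp a0 op cV hK hF hred).
Qed.

Lemma lift_evalX i : lift_eval z 'X^i = z ^+ i.
Proof.
rewrite (@lift_evalE z _ i.+1) ?size_polyXn // big_ord_recr /= coefXn eqxx T1 mul1r.
rewrite big1 ?add0r // => j _.
by rewrite coefXn ltn_eqF ?T0 ?mul0r //; exact: ltn_ord.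
Qed.

Lemma lift_evalC c : lift_eval z c%:P = T c.
Proof.
rewrite (@lift_evalE z _ 1) ?size_polyC ?leq_b1 // big_ord_recr big_ord0 /=.
by rewrite add0r coefC eqxx expr0 mulr1.
Qed.

Lemma lift_evalN P : vpos (lift_eval z (- P) + lift_eval z P).
Proof.
have := lift_evalD (- P) P.
rewrite addNr -[0 : {poly F}]/((0 : F)%:P) lift_evalC T0 sub0r vposN.
by rewrite addrC.
Qed.

Lemma lift_evalB P P' :
  vpos (lift_eval z (P - P') - (lift_eval z P - lift_eval z P')).
Proof.
apply: (vpos_trans (lift_evalD _ _)).
have -> : lift_eval z P + lift_eval z (- P') - (lift_eval z P - lift_eval z P') =
  lift_eval z (- P') + lift_eval z P' by ring.
exact: lift_evalN.
Qed.

Lemma lift_evalM P P' :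
  vpos (lift_eval z (P * P') - lift_eval z P * lift_eval z P').
Proof.
pose n := (size P + size P').+1.
pose M (A : {poly F}) := map_poly T A.
have hM A i : (M A)`_i = T A`_i by rewrite coef_map_id0.
have sM A : (size (M A) <= size A)%N by exact: size_poly.
rewrite /lift_eval -/(M _) -/(M P) -/(M P') -hornerM.
rewrite !(@horner_coef_wide _ n).
- rewrite -sumrB; apply: vpos_sum => i _; rewrite -mulrBl vposMr ?vgeX0 //.
  rewrite hM !coefM; under [X in _ - X]eq_bigr do rewrite !hM.
  apply: (vpos_trans (Tsum _ _ _)); rewrite -sumrB vpos_sum // => j _.
  by rewrite Tmul subrr vpos0.
- apply: leq_trans (size_polyMleq _ _) _; apply: leq_trans (leq_pred _) _.
  by apply: leqW; apply: leq_add; exact: sM.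
- apply: leq_trans (sM _) _; apply: leq_trans (size_polyMleq _ _) _.
  by apply: leq_trans (leq_pred _) (leqW _).
Qed.

End Eval.

(** Lift the minimal polynomial m of g over F to M and take a root z of M in the algebraic closure.
    Every polynomial killing g is a multiple of m, so its lift is small at z. Applied to X^Q - X
    this gives z^Q congruent to z, and the Teichmuller limit t of z inherits all these relations. *)
Lemma residue_root (g : L) : g ^+ Q.-1 = 1 -> exists t : V,
  t ^+ Q = t /\
  forall P : {poly F}, root (map_poly iota P) g -> vpos (lift_eval t P).
Proof.
have Q1 := pred_gt0 pp b0.
move=> gQ; pose P0 : {poly F} := 'X^(Q.-1) - 1.
have P0n : P0 != 0.
  rewrite -size_poly_eq0 /P0 size_polyDl ?size_polyXn // size_polyN size_poly1.
  by rewrite ltnS.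
have P0g : root (map_poly iota P0) g.
  by rewrite /P0 rmorphB rmorph1 /= map_polyXn /root !hornerE gQ subrr.
have [m [mm sm mdiv]] := algebra_minpoly P0n P0g.
have [_ _ [K' [_ _ cK'] _]] := hV.
pose M := map_poly T m.
have Mc i : M`_i = T m`_i by rewrite coef_map_id0.
have Mm : M \is monic.
  rewrite monicE lead_coefE.
  have -> : size M = size m.
    apply: size_poly_eq; rewrite -lead_coefE (monicP mm) T1; exact: oner_neq0.
  by rewrite Mc -lead_coefE (monicP mm) T1.
have sM : size M = size m.
  by apply: size_poly_eq; rewrite -lead_coefE (monicP mm) T1; exact: oner_neq0.
have MK' : M \is a polyOver K'.
  apply/polyOverP => i; rewrite Mc.
  (* Each coefficient of M is a Teichmuller point, hence a root of X^Q - X, and therefore lies in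
     the algebraic closure K'. *)
  apply: (@algclosed_root _ _ _ ('X^Q - 'X) _ cK').
  - by rewrite rpredB // ?polyOverXn ?polyOverX.
  - rewrite -size_poly_eq0 size_polyDl ?size_polyXn // size_polyN size_polyX.
    by move: Q1; lia.
  - by rewrite /root !hornerE TQ subrr.
have sM1 : (1 < size M)%N by rewrite sM.
have [z _ /eqP hz] := cK' M MK' sM1.
have z0 : vge 0 z.
  by apply: (monic_root_integral Mm _ hz) => i; rewrite Mc.
have hzP P : root (map_poly iota P) g -> vpos (lift_eval z P).
  move=> /mdiv /divpK <-.
  have := lift_evalM z0 (P %/ m) m.
  by rewrite {3}/lift_eval -/M hz mulr0 subr0.
have : vpos (z ^+ Q - z).
  have gQ' : g ^+ Q = g.
    by rewrite -[Q]prednK ?expn_gt0 ?prime_gt0 // exprS gQ mulr1.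
  have := lift_evalB z0 'X^Q 'X^1; rewrite !lift_evalX expr1 vposBC => h.
  have h2 : vpos (lift_eval z ('X^Q - 'X^1)).
    by apply: hzP; rewrite rmorphB /= !map_polyXn /root !hornerE gQ' subrr.
  by have := vposD h h2; rewrite subrK.
move=> /vposP[c c0 hc].
have [t [tQ t0 tz _]] := teich_lim pp op cV z0 b0 c0 hc.
exists t; split => // P /hzP hP.
rewrite -[lift_eval t P](subrK (lift_eval z P)) vposD //.
rewrite !(lift_evalE _ (leqnn _)) -sumrB vpos_sum // => i _.
rewrite -mulrBr vposMl // subrXX vposMr //; first exact: vge_vpos c0 tz.
by rewrite vge_sum // => j _; rewrite vgeMl ?vgeX0.
Qed.

(* omega sends a primitive root g of L to the Teichmuller limit of a root of the
   lifted minimal polynomial of g over F. *)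
Lemma teich_embedding : exists omega : L -> V,
  [/\ omega 0 = 0, {morph omega : x y / x * y},
      (forall x, omega x ^+ Q = omega x) & (forall x, x != 0 -> omega x != 0)] /\
  (forall x y, vpos (omega (x + y) - (omega x + omega y))) /\
  (forall c, omega (iota c) = T c).
Proof.
have Q1 := pred_gt0 pp b0.
have unit_Q (x : L) : x != 0 -> x ^+ Q.-1 = 1.
  move=> x0; apply: (mulfI x0); rewrite -exprS prednK ?expn_gt0 ?prime_gt0 //.
  by rewrite mulr1 -hL finfield.expf_card.
have [g gP] := finField_primitive_root L; rewrite hL in gP.
have [t [tQ hP]] := residue_root (prim_expr_order gP).
have t0 : vge 0 t by exact: (fixed_vge0 pp b0 tQ).
have /choice[dl hdl] : forall x : L, exists i : nat, x != 0 -> x = g ^+ i.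
  move=> x; have [->|x0] := eqVneq x 0; first by exists 0%N => /eqP.
  by have [i ->] := prim_rootP gP (unit_Q x x0); exists i.
pose om (x : L) := if x == 0 then 0 else t ^+ dl x.
(* Each value of [om] is the lift at t of a polynomial representing x at g; an identity in L thus
   becomes a polynomial vanishing at g, to which [hP] applies. *)
have omP x : exists P : {poly F}, (map_poly iota P).[g] = x /\ om x = lift_eval t P.
  rewrite /om; case: eqVneq => [->|x0].
    exists 0%:P; rewrite map_polyC hornerC rmorph0 lift_evalC.
    by split; [exact: rmorph0|rewrite T0].
  by exists 'X^(dl x); rewrite map_polyXn hornerXn -hdl // lift_evalX.
have omQ x : om x ^+ Q = om x.
  rewrite /om; case: ifP => _; last by rewrite exprAC tQ.
  by rewrite expr0n expn_eq0 eqn0Ngt prime_gt0.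
have om_int x : vge 0 (om x) by exact: (fixed_vge0 pp b0 (omQ x)).
have om_add x y : vpos (om (x + y) - (om x + om y)).
  have [P [Px ->]] := omP x; have [P' [Py ->]] := omP y.
  have [P2 [Pxy ->]] := omP (x + y).
  have h : root (map_poly iota (P2 - (P + P'))) g.
    by rewrite rmorphB rmorphD /= /root !hornerE Px Py Pxy subrr.
  have := hP _ h => h1; have h2 := lift_evalB t0 P2 (P + P').
  have h3 := lift_evalD t0 P P'.
  apply: (vpos_trans (y := lift_eval t (P + P'))) h3.
  by move: h2; rewrite vposBC => h2; have := vposD h2 h1; rewrite subrK.
have om_mul x y : om (x * y) = om x * om y.
  (* Both sides are fixed by the Q-th power, so a congruence modulo the maximal ideal suffices. *)
  apply: (fixed_eq pp op b0); rewrite ?omQ ?exprMn ?omQ //.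
  have [P [Px ->]] := omP x; have [P' [Py ->]] := omP y.
  have [P2 [Pxy ->]] := omP (x * y).
  have h : root (map_poly iota (P2 - P * P')) g.
    by rewrite rmorphB rmorphM /= /root !hornerE Px Py Pxy subrr.
  have := hP _ h => h1; have h2 := lift_evalB t0 P2 (P * P').
  have h3 := lift_evalM t0 P P'.
  apply: (vpos_trans (y := lift_eval t (P * P'))) h3.
  by move: h2; rewrite vposBC => h2; have := vposD h2 h1; rewrite subrK.
have om_iota c : om (iota c) = T c.
  apply: (fixed_eq pp op b0); rewrite ?omQ ?TQ //.
  have [P [Px ->]] := omP (iota c).
  have h : root (map_poly iota (P - c%:P)) g.
    by rewrite rmorphB /= map_polyC /root !hornerE Px subrr.
  have := hP _ h => h1; have := lift_evalB t0 P c%:P.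
  by rewrite lift_evalC vposBC => h2; have := vposD h2 h1; rewrite subrK.
exists om; split=> //; split=> //; first by rewrite /om eqxx.
move=> x x0; have : om 1 = 1 by rewrite -(rmorph1 iota) om_iota T1.
rewrite -(divff x0) om_mul; apply: contra_eq_neq => ->.
by rewrite mul0r eq_sym oner_neq0.
Qed.

End Omega.

(** * The splitting function theta *)

Lemma sum_triangle (A : nmodType) (G : nat -> nat -> A) n :
  \sum_(l < n) \sum_(i < l.+1) G (l - i)%N i =
  \sum_(i < n) \sum_(j < n - i) G j i.
Proof.
elim: n => [|n IH]; first by rewrite !big_ord0.
rewrite big_ord_recr /= IH [in RHS]big_ord_recr /= subSnn big_ord1.
rewrite [in LHS]big_ord_recr /= subnn addrA -big_split /=; congr (_ + _).
apply: eq_bigr => i _; rewrite subSn; last exact/ltnW/ltn_ord.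
by rewrite big_ord_recr.
Qed.

(** * Formal exponentials, coefficient by coefficient *)

Section Exponential.
Variable V : fieldType.
Hypothesis V0 : forall n, (n.+1%:R : V) != 0.
Implicit Types (g h : {poly V}).

(** The coefficient of z^m in exp(g) when g has no constant term: g^l then starts in degree l, so
    the finite sum is exact. The summand is the one in [theta]. *)
Definition expc g (m : nat) : V := \sum_(l < m.+1) (l`!)%:R^-1 * (g ^+ l)`_m.

Lemma coef_exp_small g l m : g`_0 = 0 -> (m < l)%N -> (g ^+ l)`_m = 0.
Proof.
move=> g0; elim: l m => // l IH m ml.
rewrite exprS coefM big1 // => -[[|i] /= ilt] _; first by rewrite g0 mul0r.
by rewrite IH ?mulr0 //; lia.
Qed.

Lemma expc_wide g m n : g`_0 = 0 -> (m < n)%N ->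
  expc g m = \sum_(l < n) (l`!)%:R^-1 * (g ^+ l)`_m.
Proof.
move=> g0 mn; rewrite /expc (big_ord_widen n (fun l => (l`!)%:R^-1 * (g ^+ l)`_m)) //.
rewrite big_mkcond /=; apply: eq_bigr => l _; case: ltnP => // ml.
by rewrite coef_exp_small ?mulr0.
Qed.

(** The binomial theorem gives the terms g^b h^a with a + b <= m, and the product of exponentials
    gives all a, b <= m; the extra ones start in degree a + b > m. *)
Lemma expcD g h m : g`_0 = 0 -> h`_0 = 0 ->
  expc (g + h) m = \sum_(i < m.+1) expc g i * expc h (m - i).
Proof.
move=> g0 h0; pose n := m.+1.
have fn k : (k`!%:R : V) != 0.
  by have := fact_gt0 k; case: (k`!) => // j _; exact: V0.
have -> : \sum_(i < m.+1) expc g i * expc h (m - i) =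
    \sum_(a < n) \sum_(b < n) (a`!)%:R^-1 * (b`!)%:R^-1 * (g ^+ b * h ^+ a)`_m.
  rewrite exchange_big /=.
  under eq_bigr => i _.
    rewrite (@expc_wide g _ n) ?(@expc_wide h _ n) //; last by rewrite /n; lia.
    rewrite big_distrlr /=; over.
  rewrite exchange_big; apply: eq_bigr => a _ /=.
  rewrite exchange_big; apply: eq_bigr => b _ /=.
  rewrite coefM mulr_sumr; apply: eq_bigr => i _; ring.
transitivity (\sum_(l < n) \sum_(i < l.+1)
    (i`!)%:R^-1 * ((l - i)`!)%:R^-1 * (g ^+ (l - i) * h ^+ i)`_m).
  apply: eq_bigr => l _; rewrite exprDn coef_sum mulr_sumr.
  apply: eq_bigr => i _; rewrite coefMn -mulr_natr.
  have il : (i <= l)%N by rewrite -ltnS; exact: ltn_ord.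
  have := congr1 (fun k => k%:R : V) (bin_fact il); rewrite !natrM => <-.
  have hb : ('C(l, i)%:R : V) != 0.
    have : (0 < 'C(l, i))%N by rewrite bin_gt0.
    by case: 'C(l, i)%N => // j _; exact: V0.
  have := fn i; have := fn (l - i)%N => h1 h2.
  by field; rewrite h1 h2 hb.
rewrite (sum_triangle (fun a b => (b`!)%:R^-1 * (a`!)%:R^-1 * (g ^+ a * h ^+ b)`_m)).
apply: eq_bigr => a _.
rewrite (big_ord_widen n (fun b => (a`!)%:R^-1 * (b`!)%:R^-1 * (g ^+ b * h ^+ a)`_m)) ?leq_subr //.
rewrite big_mkcond /=; apply: eq_bigr => b _; case: ltnP => // hab.
rewrite coefM big1 ?mulr0 // => i _.
have [ib|ib] := ltnP i b; first by rewrite coef_exp_small ?mul0r.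
rewrite [X in _ * X]coef_exp_small ?mulr0 //.
by move: hab ib (ltn_ord i) (ltn_ord a); rewrite /n /=; lia.
Qed.

Lemma expc_0 g : expc g 0 = 1.
Proof. by rewrite /expc big_ord1 expr0 fact0 invr1 mul1r coef1. Qed.

Lemma expc_high h M i : (forall j, (j < M)%N -> h`_j = 0) -> (i < M)%N ->
  expc h i = (i == 0)%:R.
Proof.
move=> hM iM; rewrite /expc big_ord_recl big1 /= => [|l _].
  by rewrite expr0 coef1 fact0 invr1 mul1r addr0.
rewrite exprS coefM big1 ?mulr0 // => j _.
by rewrite hM ?mul0r //; apply: leq_ltn_trans iM; rewrite -ltnS.
Qed.

Lemma expc_poly0 i : expc 0 i = (i == 0)%:R.
Proof. by apply: (@expc_high _ i.+1) => // j _; rewrite coef0. Qed.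

Lemma expcD_high g h M i : g`_0 = 0 -> (0 < M)%N ->
  (forall j, (j < M)%N -> h`_j = 0) -> (i < M)%N -> expc (g + h) i = expc g i.
Proof.
move=> g0 M0 hM iM; rewrite expcD ?hM // big_ord_recr /= subnn expc_0 mulr1.
rewrite big1 ?add0r // => j _; rewrite (expc_high hM); last by lia.
by rewrite subn_eq0 leqNgt ltn_ord mulr0.
Qed.

Lemma expc_scale g c m : expc (g \Po (c *: 'X)) m = c ^+ m * expc g m.
Proof.
rewrite /expc mulr_sumr; apply: eq_bigr => l _; rewrite mulrCA; congr (_ * _).
rewrite -(rmorphXn (comp_poly (c *: 'X))) /=; move: (g ^+ l) => {}g.
rewrite comp_polyE coef_sum.
have [sg|sg] := ltnP m (size g).
  rewrite (bigD1 (Ordinal sg)) //= big1 ?addr0 => [|i].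
    by rewrite exprZn !coefZ coefXn eqxx mulr1 mulrC.
  rewrite -val_eqE /= => im.
  by rewrite exprZn !coefZ coefXn eq_sym (negbTE im) !mulr0.
rewrite (nth_default 0 sg) mulr0 big1 // => i _.
by rewrite exprZn !coefZ coefXn gtn_eqF ?mulr0 // (leq_trans _ sg).
Qed.

Lemma expc_Xn c d m : (0 < d)%N ->
  expc (c *: 'X^d) m = if (d %| m)%N then c ^+ (m %/ d) / ((m %/ d)`!)%:R else 0.
Proof.
move=> d0; have cE l : ((c *: 'X^d) ^+ l)`_m = c ^+ l * (m == d * l)%N%:R.
  by rewrite exprZn -exprM coefZ coefXn.
rewrite /expc; case: ifP => dm.
  have md : (m %/ d < m.+1)%N by rewrite ltnS leq_div.
  rewrite (bigD1 (Ordinal md)) //= big1 ?addr0 => [|i].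
    by rewrite cE mulnC divnK // eqxx mulr1 mulrC.
  rewrite -val_eqE /= => im; rewrite cE; case: eqP => [mE|]; last by rewrite !mulr0.
  by move/eqP: im; case; rewrite [in RHS]mE mulKn.
rewrite big1 // => i _; rewrite cE; case: eqP => [mE|]; last by rewrite !mulr0.
by have := dvdn_mulr (nat_of_ord i) (dvdnn d); rewrite -mE dm.
Qed.

Lemma expc_comp_Xn g d m : g`_0 = 0 -> (0 < d)%N ->
  expc (g \Po 'X^d) m = if (d %| m)%N then expc g (m %/ d) else 0.
Proof.
move=> g0 d0.
have cE l : ((g \Po 'X^d) ^+ l)`_m = if (d %| m)%N then (g ^+ l)`_(m %/ d) else 0.
  by rewrite -(rmorphXn (comp_poly 'X^d)) /= coef_comp_poly_Xn.
rewrite {1}/expc; under eq_bigr => l _ do rewrite cE.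
case: ifP => _; last by rewrite big1 // => l _; rewrite mulr0.
by rewrite (@expc_wide g _ m.+1) // ltnS leq_div.
Qed.

Definition expc_trunc g m : {poly V} := \poly_(i < m.+1) expc g i.

Lemma expc_truncX g m s j : g`_0 = 0 -> (j <= m)%N ->
  (expc_trunc g m ^+ s)`_j = expc (g *+ s) j.
Proof.
move=> g0; elim: s j => [|s IH] j jm.
  by rewrite expr0 mulr0n expc_poly0 coef1.
have gs0 : (g *+ s)`_0 = 0 by rewrite coefMn g0 mul0rn.
rewrite exprS mulrS expcD // coefM; apply: eq_bigr => i _.
have ij := ltn_ord i.
by rewrite IH ?coef_poly; [case: ltnP => //; lia|lia].
Qed.

End Exponential.

(** * Integrality of the Artin-Hasse exponential *)

Section ArtinHasse.
Variables (R : realType) (p : nat) (V : valuedField R).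
Hypotheses (pp : prime p) (op : ord (p%:R : V) = 1%:E).
Implicit Types (g h : {poly V}).

Let V0 n : (n.+1%:R : V) != 0. Proof. exact: (natr_neq0 pp op). Qed.
Let p0 : (0 < p)%N. Proof. exact: prime_gt0. Qed.
Let p1 : (1 < p)%N. Proof. exact: prime_gt1. Qed.
Lemma vintP (x : V) : reflect (vge 0 x) (x \in @vint R V).
Proof. exact: idP. Qed.

Lemma frobenius_poly_add g h : g \is a polyOver (@vint R V) ->
  h \is a polyOver (@vint R V) ->
  exists2 c, c \is a polyOver (@vint R V) & (g + h) ^+ p = g ^+ p + h ^+ p + c *+ p.
Proof.
move=> hg hh; have [p' pE] : exists p', p = p'.+1 by exists p.-1; rewrite prednK.
exists (\sum_(i < p') (g ^+ (p - i.+1) * h ^+ i.+1) *+ ('C(p, i.+1) %/ p)).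
  by apply: rpred_sum => i _; rewrite rpredMn // rpredM ?rpredX.
have sumE (G : nat -> {poly V}) :
    \sum_(i < p.+1) G i = G 0%N + \sum_(i < p') G i.+1 + G p.
  rewrite pE big_ord_recl big_ord_recr addrA; congr (_ + _ + _).
rewrite exprDn (sumE (fun i => g ^+ (p - i) * h ^+ i *+ 'C(p, i))) /=.
rewrite subn0 expr0 mulr1 bin0 mulr1n subnn expr0 mul1r binn mulr1n addrAC.
congr (_ + _); rewrite -sumrMnl; apply: eq_bigr => i _.
by rewrite -mulrnA divnK // prime_dvd_bin //= pE ltnS ltn_ord.
Qed.

Lemma frobenius_poly (e : nat -> V) n : (forall i, (i < n)%N -> vge 0 (e i)) ->
  exists2 c, c \is a polyOver (@vint R V) &
    (\poly_(i < n) e i) ^+ p = \sum_(i < n) e i ^+ p *: 'X^(i * p) + c *+ p.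
Proof.
elim: n => [|n IH] he.
  exists 0; first exact: rpred0.
  rewrite big_ord0 mul0rn add0r.
  have -> : \poly_(i < 0) e i = 0 by apply/polyP => i; rewrite coef_poly coef0.
  by rewrite expr0n gtn_eqF.
have [|c hc cE] := IH; first by move=> i hi; apply: he; exact: leqW.
have -> : \poly_(i < n.+1) e i = \poly_(i < n) e i + e n *: 'X^n.
  by rewrite !poly_def big_ord_recr.
have [||c' hc' ->] := @frobenius_poly_add (\poly_(i < n) e i) (e n *: 'X^n).
- apply/polyOverP => i; rewrite coef_poly; case: ifP => hi; last exact: rpred0.
  by apply/vintP/he; exact: leqW.
- by rewrite polyOverZ ?polyOverXn //; apply/vintP/he.
exists (c + c'); first by rewrite rpredD.
by rewrite cE big_ord_recr /= exprZn -exprM mulrnDl -!addrA; congr (_ + _); rewrite addrCA.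
Qed.

(** The truncated logarithm of the Artin-Hasse exponential. *)
Definition ah_poly I : {poly V} :=
  \sum_(i < I.+1) ((p ^ i)%:R)^-1 *: 'X^(p ^ i).

Lemma ah_poly0 I : (ah_poly I)`_0 = 0.
Proof.
rewrite coef_sum big1 // => i _.
by rewrite coefZ coefXn eq_sym expn_eq0 eqn0Ngt p0 mulr0.
Qed.

(** The functional equation p l(X) = l(X^p) + p X; the truncation costs one term, whose degree
    p^(I+1) lies beyond the range in which it is used. *)
Lemma ah_polyMp I : ah_poly I *+ p =
  ah_poly I \Po 'X^p + p%:R *: 'X^1 - ((p ^ I)%:R)^-1 *: 'X^(p ^ I.+1).
Proof.
have -> : ah_poly I \Po 'X^p = \sum_(i < I.+1) ((p ^ i)%:R)^-1 *: 'X^(p ^ i.+1).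
  rewrite /ah_poly raddf_sum; apply: eq_bigr => i _ /=.
  by rewrite comp_polyZ comp_Xn_poly -exprM expnS.
rewrite big_ord_recr /= addrAC addrK -scaler_nat.
rewrite /ah_poly big_ord_recl /= expn0 invr1 scale1r scalerDr addrC; congr (_ + _).
rewrite scaler_sumr; apply: eq_bigr => i _; rewrite /bump /= add1n.
rewrite scalerA; congr (_ *: _); rewrite expnS natrM invfM mulrA divff ?mul1r //.
exact: (natr_neq0 pp op).
Qed.

Lemma isfrac_poly g l i : (forall j, isfrac g`_j) -> isfrac (g ^+ l)`_i.
Proof.
move=> hg; elim: l i => [|l IH] i.
  by rewrite expr0 coef1; exact: isfrac_nat.
rewrite exprS coefM; apply: (isfrac_sum pp op) => j _.
by apply: (isfracM pp op).
Qed.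

Lemma isfrac_expc g i : (forall j, isfrac g`_j) -> isfrac (expc g i).
Proof.
move=> hg; apply: (isfrac_sum pp op) => j _; apply: (isfracM pp op).
  exact: isfracVn.
exact: isfrac_poly.
Qed.

(* Dwork's lemma: with e = exp g one has e^p = e(X^p) exp(p X), while e^p and
   e(X^p) agree mod p in degree m up to the term p e_m. *)
Lemma artin_hasse_integral I m : (m < p ^ I.+1)%N -> vge 0 (expc (ah_poly I) m).
Proof.
set g := ah_poly I; have g0 : g`_0 = 0 := ah_poly0 I.
have gf i : isfrac (expc g i).
  apply: isfrac_expc => j; rewrite coef_sum; apply: (isfrac_sum pp op) => k _.
  rewrite coefZ coefXn; apply: (isfracM pp op); last exact: isfrac_nat.
  exact: isfracVn.
have [n] := ubnP m; elim: n m => // n IH [|m] mn mI.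
  by rewrite expc_0 vge1.
rewrite ltnS in mn; set e := expc g.
have he i : (i < m.+1)%N -> vge 0 (e i).
  by move=> im; apply: IH; [exact: leq_trans mn|exact: ltn_trans mI].
pose E' := if (p %| m.+1)%N then e (m.+1 %/ p)%N else 0.
(* T contains the coefficient under study, while T' only has those already known to be integral. *)
pose T := expc_trunc g m.+1; pose T' := \poly_(i < m.+1) e i.
have h1 : vge 1 ((T ^+ p)`_m.+1 - E').
  rewrite expc_truncX // ah_polyMp (@expcD_high _ V0 _ _ (p ^ I.+1)) //; first last.
  - by move=> j hj; rewrite coefN coefZ coefXn ltn_eqF // mulr0 oppr0.
  - by rewrite expn_gt0 p0.
  - rewrite coefD coef_comp_poly_Xn // dvdn0 div0n ah_poly0.
    by rewrite coefZ coefXn mulr0 addr0.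
  rewrite (expcD V0); last 2 first.
  - by rewrite coef_comp_poly_Xn // dvdn0 div0n ah_poly0.
  - by rewrite coefZ coefXn mulr0.
  rewrite big_ord_recr /= subnn expc_0 mulr1 expc_comp_Xn // addrK.
  apply: vge_sum => i _; rewrite expc_comp_Xn //.
  case: ifP => pi; last by rewrite mul0r vge0.
  apply: vgeMl.
    by apply: he; apply: leq_ltn_trans (leq_div _ _) (ltn_ord _).
  rewrite expc_Xn // dvd1n divn1; set k := (m.+1 - i)%N.
  have k0 : (0 < k)%N by rewrite subn_gt0.
  (* The terms of exp(p X) are p^k / k!, of valuation at least k - (k - 1) / (p - 1) >= 1 for k >=
     1. *)
  apply: vge_le (vgeM (vgeX k (_ : vge 1 p%:R)) (vge_factV pp op k0)).
    rewrite mulr1 lerBrDr -lerBrDl -[k in leRHS]prednK // -natr1 addrK.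
    rewrite ler_pdivrMr ?ltr0n -?subn1 ?subn_gt0 // ler_peMr // ler1n subn1.
    by rewrite -subn1 subn_gt0.
  by rewrite /vge op.
(* Modulo p the p-th power of T' is the sum of the e_i^p X^(ip), and [isfrac_Fermat] replaces e_i^p
   by e_i: this is where rationality of the coefficients enters. *)
have h2 : vge 1 ((T' ^+ p)`_m.+1 - E').
  have [c hc ->] := frobenius_poly he.
  rewrite coefD coefMn addrAC vgeD //; last first.
    rewrite -mulr_natr -[1 : R]add0r vgeM //; last by rewrite /vge op.
    exact/vintP/(polyOverP hc).
  rewrite coef_sum /E'; case: ifP => pm; last first.
    rewrite big1 ?subr0 ?vge0 // => i _; rewrite coefZ coefXn.
    case: eqP => [mE|]; rewrite ?mulr0 //.
    by have := dvdn_mull (nat_of_ord i) (dvdnn p); rewrite -mE pm.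
  have hlt : (m.+1 %/ p < m.+1)%N by rewrite ltn_Pdiv.
  rewrite (bigD1 (Ordinal hlt)) //= big1 ?addr0 => [|i].
    rewrite coefZ coefXn divnK // eqxx mulr1.
    by apply: (isfrac_Fermat pp op); [exact: gf|exact: he].
  rewrite -val_eqE /= => im; rewrite coefZ coefXn; case: eqP => [mE|]; rewrite ?mulr0 //.
  by move/eqP: im; case; rewrite [in RHS]mE mulnK.
(* T - T' is a monomial of degree m + 1, so in T^p - T'^p only the constant terms of the p cofactors
   matter, and each of them is 1. *)
have h3 : (T ^+ p)`_m.+1 = (T' ^+ p)`_m.+1 + p%:R * e m.+1.
  have TE : T = T' + e m.+1 *: 'X^(m.+1).
    by rewrite /T /expc_trunc poly_def big_ord_recr /T' poly_def.
  have T0 : T`_0 = 1 by rewrite coef_poly expc_0.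
  have T'0 : T'`_0 = 1 by rewrite coef_poly /e expc_0.
  rewrite -[T ^+ p](subrK (T' ^+ p)) subrXX addrC coefD; congr (_ + _).
  rewrite {1}TE addrAC subrr add0r -scalerAl coefZ coefXnM ltnn subnn mulrC.
  congr (_ * _); rewrite coef_sum -[p in RHS]card_ord -sumr_const.
  apply: eq_bigr => i _; rewrite coefM big_ord1 subnn.
  have c0X (A : {poly V}) k : (A ^+ k)`_0 = A`_0 ^+ k by exact: (rmorphXn (coefp 0) k A).
  by rewrite !c0X T0 T'0 !expr1n mulr1.
have : vge 1 (p%:R * e m.+1).
  have -> : p%:R * e m.+1 = ((T ^+ p)`_m.+1 - E') - ((T' ^+ p)`_m.+1 - E').
    by rewrite h3; ring.
  exact: vgeB.
have p_neq0 : (p%:R : V) != 0 by exact: (natr_neq0 pp op).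
by move=> /(vge_divr op); rewrite subrr mulrAC divff // mul1r.
Qed.

End ArtinHasse.

Section Theta.
Variables (R : realType) (p : nat) (V : valuedField R) (pi : V).
Hypotheses (pp : prime p) (op : ord (p%:R : V) = 1%:E).
Hypothesis hpi : pi ^+ p.-1 = - p%:R.
Implicit Types (g h : {poly V}).

Let V0 n : (n.+1%:R : V) != 0. Proof. exact: (natr_neq0 pp op). Qed.
Let p0 : (0 < p)%N. Proof. exact: prime_gt0. Qed.
Let p1 : (1 < p)%N. Proof. exact: prime_gt1. Qed.
Let pm0 : (0 < p.-1)%N. Proof. by rewrite -subn1 subn_gt0. Qed.

Definition kappa : R := p.-1%:R / p%:R ^+ 2.

Lemma kappa_gt0 : 0 < kappa.
Proof. by rewrite divr_gt0 ?exprn_gt0 ?ltr0n. Qed.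

Definition decay (c : R) (u : nat -> V) := forall j, vge (j%:R * c) (u j).

Lemma expcD_decay c g h : g`_0 = 0 -> h`_0 = 0 ->
  decay c (expc g) -> decay c (expc h) -> decay c (expc (g + h)).
Proof.
move=> g0 h0 dg dh m; rewrite expcD //; apply: vge_sum => i _.
have im : (i <= m)%N by rewrite -ltnS ltn_ord.
by rewrite -{1}(subnKC im) natrD mulrDl vgeM.
Qed.

Lemma expc_sum_decay c (I : Type) (r : seq I) (P : pred I) (g : I -> {poly V}) :
  (forall i, P i -> (g i)`_0 = 0 /\ decay c (expc (g i))) ->
  (\sum_(i <- r | P i) g i)`_0 = 0 /\ decay c (expc (\sum_(i <- r | P i) g i)).
Proof.
move=> hg; apply: (big_ind (fun g => g`_0 = 0 /\ decay c (expc g))) => //.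
  split=> [|j]; first by rewrite coef0.
  by rewrite expc_poly0; case: j => [|j] /=; rewrite ?mul0r ?vge1 ?vge0.
move=> g1 g2 [g10 d1] [g20 d2]; split; last exact: expcD_decay.
by rewrite coefD g10 g20 addr0.
Qed.

Lemma pow_bernoulli j : (1 + j * p.-1 <= p ^ j)%N.
Proof.
elim: j => [|j IH]; first by rewrite expn0.
by rewrite expnS; move: IH p1; move: (p ^ j)%N => x; nia.
Qed.

(** The case i = 0 fixes [kappa]: each further power of the term of degree p^2 adds p^2 / (p - 1) -
    2, less 1 / (p - 1) for the factorial, which is p - 1 = p^2 kappa. For larger i, Bernoulli's
    inequality lets p^i outgrow the loss i + 2. *)
Lemma expc_tail_decay i :
  decay kappa (expc ((- (pi ^+ (p ^ i.+2) / (p ^ i.+2)%:R)) *: 'X^(p ^ i.+2))).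
Proof.
set d := (p ^ i.+2)%N; set c := - _.
have d0 : (0 < d)%N by rewrite expn_gt0 p0.
have oc : vge (d%:R / p.-1%:R - i.+2%:R) c.
  rewrite vgeN; apply: vge_divr; last exact: vge_piX.
  by rewrite (ord_nat pp op d0) /d pfactorK.
move=> j; rewrite expc_Xn //; case: ifP => [dj|_]; last exact: vge0.
set k := (j %/ d)%N; have jE : j = (k * d)%N by rewrite divnK.
have [k0|k0] := posnP k.
  by rewrite jE k0 mul0n mul0r expr0 fact0 invr1 mulr1 vge1.
apply: vge_le (vgeM (vgeX k oc) (vge_factV pp op k0)).
rewrite jE natrM -mulrA -[k in k.-1]prednK // -pred_Sn.
have -> : (k.-1%:R : R) = k%:R - 1 by rewrite -{2}[k]prednK // -natr1 addrK.
have q0 : 0 < (p.-1%:R : R) by rewrite ltr0n.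
have P0 : 0 < (p%:R : R) by rewrite ltr0n.
have K0 : 1 <= (k%:R : R) by rewrite ler1n.
have pE : (p%:R : R) = p.-1%:R + 1 by rewrite natr1 prednK.
have dE : (d%:R : R) = (p ^ i)%:R * p%:R ^+ 2.
  by rewrite /d -addn2 expnD natrM; congr (_ * _); exact: natrX.
have hB : (i%:R * p.-1%:R + 1 : R) <= (p ^ i)%:R.
  by rewrite -natrM natr1 -addn1 ler_nat addnC pow_bernoulli.
have -> : d%:R * kappa = (p ^ i)%:R * p.-1%:R.
  by rewrite dE /kappa; field; rewrite lt0r_neq0.
rewrite dE -natr1 -[i.+1%:R]natr1.
set e := p.-1%:R in q0 pE hB *; set x := (p ^ i)%:R in hB *.
set y := i%:R in hB *; set K := k%:R in K0 *.
have y0 : 0 <= y by exact: ler0n.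
rewrite -subr_ge0.
have -> : K * (x * p%:R ^+ 2 / e - (y + 1 + 1)) - (K - 1) / e - K * (x * e) =
  (K * (x * (2 * e + 1) - (y + 2) * e - 1) + 1) / e.
  by rewrite pE; field; rewrite lt0r_neq0.
apply: divr_ge0; last exact: ltW.
have : 0 <= x * (2 * e + 1) - (y + 2) * e - 1.
  have h : 0 <= (x - (y * e + 1)) * (2 * e + 1).
    by apply: mulr_ge0; [rewrite subr_ge0|lra].
  have h2 : 0 <= y * e * e by rewrite !mulr_ge0 // ltW.
  nra.
by move=> h; apply: addr_ge0 => //; apply: mulr_ge0 => //; lra.
Qed.

(** As pi^p / p = -pi, the first two terms of the Artin-Hasse logarithm at pi X are pi X - pi X^p;
    the second sum removes the others. *)
Lemma theta_poly_decomp m :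
  pi *: 'X - pi *: 'X^p = ah_poly p V m.+1 \Po (pi *: 'X) +
    \sum_(i < m) (- (pi ^+ (p ^ i.+2) / (p ^ i.+2)%:R)) *: 'X^(p ^ i.+2).
Proof.
have -> : ah_poly p V m.+1 \Po (pi *: 'X) =
    \sum_(i < m.+2) (pi ^+ (p ^ i) / (p ^ i)%:R) *: 'X^(p ^ i).
  rewrite /ah_poly raddf_sum; apply: eq_bigr => i _ /=.
  by rewrite comp_polyZ comp_Xn_poly exprZn scalerA mulrC.
rewrite !big_ord_recl -!addrA -big_split /= big1 => [|i _]; last first.
  by rewrite /bump /= !add1n -scalerDl subrr scale0r.
rewrite addr0 expn0 expr1 divr1 expr1 /bump /= addn0 expn1; congr (_ + _).
rewrite -scaleNr; congr (_ *: _).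
rewrite -[p in pi ^+ p]prednK // exprS hpi mulrN mulNr mulfK //.
exact: (natr_neq0 pp op).
Qed.

Lemma theta_decay : decay kappa (theta p pi).
Proof.
move=> m; have -> : theta p pi m = expc (pi *: 'X - pi *: 'X^p) m by [].
rewrite (theta_poly_decomp m).
have hp : (m < p ^ m.+2)%N by apply: leq_trans (ltn_expl m p1) _; rewrite leq_exp2l //; lia.
pose h i : {poly V} := (- (pi ^+ (p ^ i.+2) / (p ^ i.+2)%:R)) *: 'X^(p ^ i.+2).
have hh (i : 'I_m) : true -> (h i)`_0 = 0 /\ decay kappa (expc (h i)).
  move=> _; split; last exact: expc_tail_decay.
  by rewrite coefZ coefXn eq_sym expn_eq0 eqn0Ngt p0 mulr0.
have [H0 Hd] := expc_sum_decay (index_enum 'I_m) hh.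
rewrite expcD //; last first.
  by rewrite -horner_coef0 horner_comp !hornerE horner_coef0 (ah_poly0 _ pp).
apply: vge_sum => i _; have im : (i <= m)%N by rewrite -ltnS ltn_ord.
rewrite -{1}(subnKC im) natrD mulrDl vgeM // expc_scale.
rewrite vgeMr ?(artin_hasse_integral pp op) //; last by exact: leq_ltn_trans hp.
apply: vge_le (vge_piX pp op hpi i).
rewrite ler_wpM2l // /kappa ler_pdivrMr ?exprn_gt0 ?ltr0n //.
rewrite mulrC ler_pdivlMr ?ltr0n // -expr2 lerXn2r ?nnegrE // ler_nat.
exact: leq_pred.
Qed.

(** Reduction by pi^(p-1) = -p writes theta_m as a sum of y_i pi^i with rational y_i. As theta_m is
    integral, [pi_indep] gives ord y_i >= -i / (p - 1) > -1, hence ord y_i >= 0. *)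
Lemma theta_Zpi m : theta p pi m \in Zp_adjoin pi.
Proof.
pose c l : V := (l`!)%:R^-1 * (('X - 'X^p) ^+ l)`_m.
have cf l : isfrac (c l).
  apply: (isfracM pp op); first exact: isfracVn.
  apply: (isfrac_poly pp op) => j; rewrite coefB coefX coefXn.
  by apply: (isfracD pp op); [|apply: (isfracN pp op)]; exact: isfrac_nat.
have tE : theta p pi m = \sum_(i < p.-1) pi_red c m.+1 i * pi ^+ i.
  rewrite -(pi_redE pp hpi); apply: eq_bigr => l _; rewrite /c -mulrA; congr (_ * _).
  by rewrite -scalerBr exprZn coefZ mulrC.
set y := pi_red c m.+1 in tE.
have yf i : isfrac (y i).
  apply: (isfrac_sum pp op) => l _; apply: (isfracM pp op) => //.
  by apply: (isfracX pp op); apply: (isfracN pp op); exact: isfrac_nat.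
have yQ i := isfrac_Qp pp op (yf i).
have t0 : vge 0 (theta p pi m).
  by apply: vge_le (theta_decay m); rewrite mulr_ge0 // ltW // kappa_gt0.
rewrite tE in t0 *.
have hi := pi_indep pp op hpi (fun i => Qp_ord_int pp op (yQ i)) t0.
apply: rpred_sum => i _; rewrite rpredM ?rpredX ?pi_Zpi //.
apply: Zp_Zpi; apply/andP; split; first exact: yQ.
have [->|y0] := eqVneq (y i) 0; first exact: vge0.
have := vge_divr (ord_piX pp op hpi i) (hi i).
rewrite mulfK ?expf_neq0 ?(pi_neq0 pp op hpi) // /vge.
have [z ->] := Qp_ord_int pp op (yQ i) y0; rewrite !lee_fin ler0z sub0r.
have : (-1 : R) < - (i%:R / p.-1%:R).
  by rewrite ltrN2 ltr_pdivrMr ?ltr0n // mul1r ltr_nat.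
move=> h1 h2; have := lt_le_trans h1 h2.
by rewrite -[-1](rmorphN1 (intr : int -> R)) ltr_int; lia.
Qed.

Lemma theta0 : theta p pi 0 = 1.
Proof. exact: expc_0. Qed.

End Theta.

(** * The additive character attached to theta *)

Section Evaluation.
Variables (R : realType) (V : valuedField R).
Hypothesis cV : vcomplete V.
Implicit Types (u v : nat -> V) (c : R).

Definition psum u (D : nat) : V := \sum_(i < D) u i.

(** The value at 1 of the series with coefficients u; evaluation at z is obtained by scaling the
    coefficients first. *)
Definition ev u : V := xget 0 [set l | vcvg (psum u) l].

Lemma decay_le c d u : c <= d -> decay d u -> decay c u.
Proof. by move=> cd du j; apply: vge_le (du j); rewrite ler_wpM2l. Qed.

Lemma ev_psum c u D : 0 < c -> decay c u -> vge (D%:R * c) (ev u - psum u D).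
Proof.
move=> c0 du.
have hs n : vge (0 + n%:R * c) (psum u n.+1 - psum u n).
  by rewrite /psum big_ord_recr /= addrAC subrr !add0r.
have [cu hu] := vcauchy_step c0 hs.
rewrite /ev; case: xgetP => [l _ hl|h]; last by have [l /h] := cV cu.
have hl' : vcvg (fun n => psum u n - psum u D) (l - psum u D).
  move=> C; have [n0 h] := hl C; exists n0 => n hn.
  have -> : psum u n - psum u D - (l - psum u D) = psum u n - l by ring.
  exact: h.
by apply: (vge_lim (n0 := D) hl') => n hn; rewrite -[X in vge X]add0r hu.
Qed.

Lemma decay_vge0 c u i : 0 < c -> decay c u -> vge 0 (u i).
Proof. by move=> c0 du; apply: vge_le (du i); rewrite mulr_ge0 // ltW. Qed.

Lemma psum_vge0 c u D : 0 < c -> decay c u -> vge 0 (psum u D).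
Proof. by move=> c0 du; apply: vge_sum => i _; exact: decay_vge0 du. Qed.

Lemma ev_vge0 c u : 0 < c -> decay c u -> vge 0 (ev u).
Proof.
by move=> c0 /(ev_psum 0 c0); rewrite mul0r /psum big_ord0 subr0.
Qed.

Lemma vge_eq_scale c (x y : V) : 0 < c -> (forall D : nat, vge (D%:R * c) (x - y)) -> x = y.
Proof.
move=> c0 h; apply: vge_eq => n; have := h (Num.bound (n%:R / c)).
apply: vge_le; rewrite -ler_pdivrMr //; apply/ltW/archi_boundP.
by rewrite divr_ge0 // ltW.
Qed.

Lemma ev_unique c u l : 0 < c -> decay c u ->
  (forall D, vge (D%:R * c) (l - psum u D)) -> ev u = l.
Proof.
move=> c0 du h; apply: (vge_eq_scale c0) => D.
by apply: vge_trans (ev_psum D c0 du) _; rewrite vgeBC.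
Qed.

Lemma ev_conv c u v : 0 < c -> decay c u -> decay c v ->
  ev (fun m => \sum_(i < m.+1) u i * v (m - i)%N) = ev u * ev v.
Proof.
move=> c0 du dv; apply: (ev_unique c0) => [m|D].
  apply: vge_sum => i _; have im : (i <= m)%N by rewrite -ltnS ltn_ord.
  by rewrite -{1}(subnKC im) natrD mulrDl vgeM.
apply: (vge_trans (y := psum u D * psum v D)).
  have -> : ev u * ev v - psum u D * psum v D =
    ev u * (ev v - psum v D) + (ev u - psum u D) * psum v D by ring.
  apply: vgeD.
    by apply: vgeMl; [exact: ev_vge0 du|exact: ev_psum].
  by apply: vgeMr; [exact: ev_psum|exact: psum_vge0 dv].
rewrite /psum big_distrlr /= (sum_triangle (fun a b => u b * v a)) -sumrB.
apply: vge_sum => i _.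
rewrite [X in _ - X](big_ord_widen D (fun j => u i * v j)) ?leq_subr //.
rewrite [X in _ - X]big_mkcond -sumrB /=.
apply: vge_sum => j _ /=; case: ltnP => hij; first by rewrite subrr vge0.
rewrite subr0; apply: vge_le (vgeM (du i) (dv j)).
by rewrite -mulrDl -natrD ler_pM2r // ler_nat; lia.
Qed.

End Evaluation.

Section Character.
Variables (R : realType) (p : nat) (V : valuedField R) (pi : V).
Hypotheses (pp : prime p) (op : ord (p%:R : V) = 1%:E) (cV : vcomplete V).
Hypothesis hpi : pi ^+ p.-1 = - p%:R.
Implicit Types (g h : {poly V}) (c : R).

Let V0 n : (n.+1%:R : V) != 0. Proof. exact: (natr_neq0 pp op). Qed.
Let p0 : (0 < p)%N. Proof. exact: prime_gt0. Qed.
Let p1 : (1 < p)%N. Proof. exact: prime_gt1. Qed.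
Let pm0 : (0 < p.-1)%N. Proof. by rewrite -subn1 subn_gt0. Qed.

Local Notation Exp g := (ev (expc g)).

Lemma ExpD c g h : 0 < c -> g`_0 = 0 -> h`_0 = 0 ->
  decay c (expc g) -> decay c (expc h) -> Exp (g + h) = Exp g * Exp h.
Proof.
move=> c0 g0 h0 dg dh; rewrite -(ev_conv cV c0 dg dh); congr ev.
by apply/funext => m; exact: expcD.
Qed.

Lemma Exp0 : Exp (0 : {poly V}) = 1.
Proof.
apply: (ev_unique cV ltr01) => [j|D].
  by rewrite expc_poly0; case: j => [|j]; rewrite ?mul0r ?vge1 ?vge0.
rewrite /psum; case: D => [|D]; first by rewrite big_ord0 subr0 mul0r vge1.
rewrite big_ord_recl big1 /= => [|i _]; last by rewrite expc_poly0.
by rewrite expc_0 addr0 subrr vge0.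
Qed.

Lemma Exp_sum c (I : Type) (r : seq I) (g : I -> {poly V}) : 0 < c ->
  (forall i, (g i)`_0 = 0 /\ decay c (expc (g i))) ->
  Exp (\sum_(i <- r) g i) = \prod_(i <- r) Exp (g i).
Proof.
move=> c0 hg; elim: r => [|i r IH]; first by rewrite !big_nil Exp0.
have [s0 ds] := expc_sum_decay pp op r (P := xpredT) (fun i _ => hg i).
by rewrite !big_cons (ExpD c0) ?IH //; have [] := hg i.
Qed.

Lemma Exp_muln c g s : 0 < c -> g`_0 = 0 -> decay c (expc g) ->
  (g *+ s)`_0 = 0 /\ decay c (expc (g *+ s)) /\ Exp (g *+ s) = Exp g ^+ s.
Proof.
move=> c0 g0 dg; have h (i : 'I_s) : true -> g`_0 = 0 /\ decay c (expc g) by [].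
have [s0 ds] := expc_sum_decay pp op (index_enum 'I_s) h.
have := Exp_sum (index_enum 'I_s) c0 (fun i => h i isT).
rewrite prodr_const sumr_const card_ord in s0 ds * => ->.
by [].
Qed.

(* Summing exp(y h) by powers of h instead of by degree gives
   sum_l y^l / l! * h(1)^l. *)
Lemma Exp_vanish (e : R) (y : V) h : 0 < e ->
  (forall l, vge (l%:R * e) (y ^+ l / (l`!)%:R)) ->
  h \is a polyOver (@vint R V) -> h`_0 = 0 -> h.[1] = 0 ->
  let c := e / (size h).+1%:R in decay c (expc (y *: h)) /\ Exp (y *: h) = 1.
Proof.
move=> e0 hy hh h0 h1; set d := (size h).+1 => c.
have d0 : 0 < (d%:R : R) by rewrite ltr0n.
have c0 : 0 < c by rewrite divr_gt0.
have yh0 : (y *: h)`_0 = 0 by rewrite coefZ h0 mulr0.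
have hl l m : vge 0 (h ^+ l)`_m by have /polyOverP := rpredX l hh; apply.
have sl l m : (l * d < m)%N -> (size (h ^+ l) <= m)%N.
  move=> lm; apply: leq_trans (size_exp_leq _ _) _.
  by apply: leq_ltn_trans lm; rewrite mulnC leq_mul2l /d; apply/orP; right; lia.
(* Reaching degree m takes at least m / d powers of h, so the decay rate e in l becomes e / d in
   m. *)
have cl l m : (m <= l * d)%N -> m%:R * c <= l%:R * e.
  by move=> hm; rewrite /c mulrA ler_pdivrMr // mulrAC ler_pM2r // -natrM ler_nat.
have dec : decay c (expc (y *: h)).
  move=> m; apply: vge_sum => l _; rewrite exprZn coefZ [X in vge _ X]mulrC [X in vge _ X]mulrAC.
  have [ml|ml] := leqP m (l * d)%N.
    by apply: vgeMr => //; apply: vge_le (hy l); exact: cl.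
  by rewrite (nth_default 0 (sl _ _ ml)) mulr0 vge0.
split => //; apply: (ev_unique cV c0 dec) => -[|D].
  by rewrite /psum big_ord0 subr0 mul0r vge1.
have -> : psum (expc (y *: h)) D.+1 =
   \sum_(l < D.+1) (y ^+ l / (l`!)%:R) * \sum_(m < D.+1) (h ^+ l)`_m.
  rewrite /psum; under eq_bigr => m _ do rewrite (@expc_wide _ _ _ D.+1) //.
  rewrite exchange_big; apply: eq_bigr => l _; rewrite mulr_sumr.
  by apply: eq_bigr => m _; rewrite exprZn coefZ; ring.
rewrite vgeBC big_ord_recl /= fact0 !expr0 invr1 !mul1r.
have -> : \sum_(m < D.+1) (1 : {poly V})`_m = 1.
  by rewrite big_ord_recl big1 ?coef1 ?addr0 // => i _; rewrite coef1.
rewrite addrAC subrr add0r; apply: vge_sum => l _; rewrite /bump leq0n add1n.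
have [ml|ml] := leqP D.+1 (l.+1 * d)%N.
  by apply: vgeMr; [apply: vge_le (hy l.+1); exact: cl|exact: vge_sum].
have -> : \sum_(m < D.+1) (h ^+ l.+1)`_m = (h ^+ l.+1).[1].
  rewrite (horner_coef_wide _ (sl _ _ ml)); apply: eq_bigr => m _.
  by rewrite expr1n mulr1.
by rewrite horner_exp h1 expr0n mulr0 vge0.
Qed.

(** The factor pi^l / l! has valuation at least 1 / (p - 1) for every l >= 1 but need not tend to 0;
    the positive valuation of y is what makes the expansion in powers of X - X^p converge, and that
    polynomial vanishes at 1. *)
Lemma Exp_pi_vanish (y : V) : vpos y -> exists2 c : R, 0 < c &
  decay c (expc ((pi * y) *: ('X - 'X^p))) /\ Exp ((pi * y) *: ('X - 'X^p)) = 1.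
Proof.
move=> /vposP[e e0 hy]; pose h : {poly V} := 'X - 'X^p.
exists (e / (size h).+1%:R); first by rewrite divr_gt0.
apply: (@Exp_vanish e (pi * y) h) => //.
- case=> [|l]; first by rewrite expr0 fact0 invr1 mulr1 mul0r vge1.
  rewrite exprMn [X in vge _ X]mulrAC.
  have -> : l.+1%:R * e = (l.+1%:R / p.-1%:R + - (l.+1.-1%:R / p.-1%:R)) - 1 / p.-1%:R + l.+1%:R * e.
    by rewrite -natr1 /=; field; rewrite pnatr_eq0 -lt0n.
  apply: vge_le (vgeM (vgeM (vge_piX pp op hpi l.+1) (vge_factV pp op (ltn0Sn l))) (vgeX l.+1 hy)).
  by rewrite lerD2r gerBl divr_ge0.
- by rewrite rpredB ?polyOverX ?polyOverXn.
- by rewrite coefB coefX coefXn (ltn_eqF p0) /= subrr.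
- by rewrite !hornerE expr1n subrr.
Qed.

(** The logarithm of theta(z X), so that [theta_val z] is theta(z). *)
Definition theta_poly (z : V) : {poly V} := (pi * z) *: 'X - (pi * z ^+ p) *: 'X^p.

Lemma theta_poly_0 z : (theta_poly z)`_0 = 0.
Proof. by rewrite coefB !coefZ coefX coefXn (ltn_eqF p0) /= !mulr0 subr0. Qed.

Lemma expc_theta_poly z m : expc (theta_poly z) m = z ^+ m * theta p pi m.
Proof.
have -> : theta p pi m = expc (pi *: 'X - pi *: 'X^p) m by [].
rewrite -expc_scale comp_polyB !comp_polyZ comp_polyX comp_Xn_poly exprZn !scalerA.
by [].
Qed.

Lemma theta_poly_decay z : vge 0 z -> decay (kappa R p) (expc (theta_poly z)).
Proof.
move=> z0 m; rewrite expc_theta_poly vgeMl ?vgeX0 //.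
exact: (theta_decay pp op hpi).
Qed.

Definition theta_val (z : V) : V := Exp (theta_poly z).

Lemma theta_val_psum z D : vge 0 z ->
  vge (D%:R * kappa R p) (theta_val z - \sum_(m < D) theta p pi m * z ^+ m).
Proof.
move=> z0; have := ev_psum cV D (kappa_gt0 R pp) (theta_poly_decay z0).
rewrite /psum; under eq_bigr => m _ do rewrite expc_theta_poly mulrC.
by [].
Qed.

Lemma theta_val_vge0 z : vge 0 z -> vge 0 (theta_val z).
Proof. by move=> z0; exact: (ev_vge0 cV (kappa_gt0 R pp) (theta_poly_decay z0)). Qed.

(** The exponent splits into s copies of [theta_poly 1] and a part controlled by y, whose
    exponential is 1. *)
Lemma theta_val_shift (y : V) s : vpos y ->
  Exp ((pi * (s%:R + y)) *: ('X - 'X^p)) = theta_val 1 ^+ s.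
Proof.
move=> hy; have [c c0 [dc Ec]] := Exp_pi_vanish hy.
have k0 : 0 < kappa R p := kappa_gt0 R pp.
pose m := Num.min c (kappa R p).
have m0 : 0 < m by rewrite lt_min c0.
have mc : m <= c by rewrite ge_min lexx.
have mk : m <= kappa R p by rewrite ge_min lexx orbT.
have d1 := decay_le mk (theta_poly_decay (vge1 V)).
have [s0 [ds sE]] := Exp_muln s m0 (theta_poly_0 1) d1.
have -> : (pi * (s%:R + y)) *: ('X - 'X^p) = theta_poly 1 *+ s + (pi * y) *: ('X - 'X^p).
  rewrite /theta_poly expr1n mulr1 -scalerBr -scaler_nat scalerA -scalerDl.
  by congr (_ *: _); ring.
rewrite (ExpD m0 s0 _ ds (decay_le mc dc)) ?sE ?Ec ?mulr1 //.
by rewrite coefZ coefB coefX coefXn (ltn_eqF p0) /= subrr mulr0.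
Qed.

(** The number p can be read as s = p with y = 0, which gives theta(1)^p, or as an element y = p of
    the maximal ideal, which gives 1. *)
Lemma theta_val1_unity : theta_val 1 ^+ p = 1.
Proof.
rewrite -(@theta_val_shift 0); last exact: vpos0.
rewrite addr0; have pv : vpos (p%:R : V) by rewrite /vpos op lte_fin.
by have [c _ [_ ->]] := Exp_pi_vanish pv.
Qed.

(* Formally the product is exp(pi S (t - t^p)) at t = 1, where S is the sum of the
   z^(p^i); the difference S - s only contributes a convergent exponential, equal
   to 1 at t = 1. *)
Lemma theta_val_trace b (z : V) s : (0 < b)%N -> z ^+ (p ^ b) = z ->
  vpos (\sum_(i < b) z ^+ (p ^ i) - s%:R) ->
  \prod_(i < b) theta_val (z ^+ (p ^ i)) = theta_val 1 ^+ s.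
Proof.
move=> b0 zb hs; set S := \sum_(i < b) _ in hs.
have z0 : vge 0 z by exact: (fixed_vge0 pp b0 zb).
rewrite /theta_val -(@Exp_sum (kappa R p)); last 2 first.
- exact: kappa_gt0.
- by move=> i; split; [exact: theta_poly_0|apply: theta_poly_decay; exact: vgeX0].
rewrite -/(theta_val 1) -(theta_val_shift s hs) [_ + (S - _)]addrC subrK.
congr (ev (expc _)).
rewrite /theta_poly sumrB -!scaler_suml -!mulr_sumr -/S scalerBr.
congr (_ - _ *: _); congr (_ * _).
(* As z^(p^b) = z, raising to the p-th power permutes the terms of S cyclically. *)
under eq_bigr => i _ do rewrite -exprM -expnSr.
rewrite /S; case: b b0 zb {hs S} => // b _ zb.
rewrite big_ord_recr /= zb [in RHS]big_ord_recl /= expn0 expr1 addrC.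
by congr (_ + _); apply: eq_bigr => i _; rewrite /bump leq0n add1n.
Qed.

End Character.

(* For p = 2 the lower bound m kappa exceeds ord pi only for m >= 5. *)
Lemma theta_two_small (R : realType) (V : valuedField R) (pi : V) m :
  ord (2%:R : V) = 1%:E -> pi = - 2%:R -> (2 <= m)%N -> (m <= 4)%N ->
  vge (2 : R) (theta 2 pi m).
Proof.
move=> op ->.
have V0 n : (n.+1%:R : V) != 0 by exact: (natr_neq0 (isT : prime 2) op).
have h4 : vge (2 : R) (4%:R : V).
  by rewrite -[4%N]/(2 * 2)%N natrM /vge ordM op -EFinD lee_fin; lra.
have o3 : ord (3%:R : V) = 0%:E by exact: (ord_coprime (isT : prime 2) op).
have -> : theta 2 (- 2%:R : V) m = expc ((- 2%:R) *: 'X^1 + 2%:R *: 'X^2) m.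
  by rewrite /theta /expc expr1 !scaleNr opprK.
rewrite expcD //; [|by rewrite coefZ coefXn mulr0|by rewrite coefZ coefXn mulr0].
under eq_bigr => i _ do rewrite !expc_Xn // dvd1n divn1.
have V3 : 3 != 0 :> V := V0 2%N.
have V2 : 2 != 0 :> V := V0 1%N.
have f0 : (0`!%:R : V) = 1 by [].
have f1 : (1`!%:R : V) = 1 by [].
have f2 : (2`!%:R : V) = 2%:R by [].
have f3 : (3`!%:R : V) = 6%:R by [].
have f4 : (4`!%:R : V) = 24%:R by [].
case: m => [|[|[|[|[|m]]]]] // _ _; rewrite !big_ord_recr big_ord0 /=.
- have [e1 e0] : ((2 - 0) %/ 2)%N = 1%N /\ ((2 - 2) %/ 2)%N = 0%N by [].
  rewrite e1 e0 [X in vge _ X](_ : _ = 4%:R) //.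
  by rewrite ?f0 ?f1 ?f2; field; rewrite ?oner_neq0 ?V2.
- have [e1 e0] : ((3 - 1) %/ 2)%N = 1%N /\ ((3 - 3) %/ 2)%N = 0%N by [].
  rewrite e1 e0 [X in vge _ X](_ : _ = 4%:R * (- 4%:R / 3%:R)).
    by apply: vgeMr => //; rewrite -(subr0 (0 : R)); apply: vge_divr => //; rewrite vgeN vge_nat.
  by rewrite ?f0 ?f1 ?f2 ?f3; field; rewrite ?oner_neq0 ?V2 ?V3 ?(V0 5%N).
- have [e2 e1 e0] : [/\ ((4 - 0) %/ 2)%N = 2%N, ((4 - 2) %/ 2)%N = 1%N & ((4 - 4) %/ 2)%N = 0%N] by [].
  rewrite ?e2 e1 e0 [X in vge _ X](_ : _ = 4%:R * (5%:R / 3%:R)).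
    by apply: vgeMr => //; rewrite -(subr0 (0 : R)); apply: vge_divr => //; rewrite vge_nat.
  by rewrite ?f0 ?f1 ?f2 ?f3 ?f4; field; rewrite ?oner_neq0 ?V2 ?V3 ?(V0 23%N) ?(V0 5%N).
Qed.

Section CharacterSum.
Variables (R : realType) (p : nat) (V : valuedField R) (pi : V).
Hypotheses (pp : prime p) (op : ord (p%:R : V) = 1%:E) (cV : vcomplete V).
Hypothesis hpi : pi ^+ p.-1 = - p%:R.

Let V0 n : (n.+1%:R : V) != 0. Proof. exact: (natr_neq0 pp op). Qed.
Let p0 : (0 < p)%N. Proof. exact: prime_gt0. Qed.
Let p1 : (1 < p)%N. Proof. exact: prime_gt1. Qed.
Let pm0 : (0 < p.-1)%N. Proof. by rewrite -subn1 subn_gt0. Qed.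

(** All terms of theta(1) past 1 + pi are smaller than pi. For p = 2 the bound 5/4 is 5 kappa. For
    odd p, theta_2 = pi^2 / 2, and 3 kappa > 1 / (p - 1) settles m >= 3. *)
Lemma theta_ge2 : exists2 e : R, p.-1%:R^-1 < e &
  forall m, (2 <= m)%N -> vge e (theta p pi m).
Proof.
have [p2|p2] := eqVneq p 2%N.
  exists (5%:R / 4%:R); first by rewrite p2 invr1; lra.
  move=> m m2; have [m4|m4] := leqP m 4%N.
    rewrite p2; apply: vge_le (theta_two_small _ _ m2 m4); first by lra.
      by move: op; rewrite p2.
    by move: hpi; rewrite p2 expr1.
  apply: vge_le (theta_decay pp op hpi m); rewrite /kappa p2 /= expr2 -natrM mul1r.
  by rewrite ler_pM2r ?invr_gt0 ?ltr0n // ler_nat.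
have p3 : (2 < p)%N by rewrite ltn_neqAle eq_sym p2.
have e2 : 2 <= (p.-1%:R : R) by rewrite (ler_nat R 2) -ltnS prednK.
have e0 : 0 < (p.-1%:R : R) by lra.
have kE : kappa R p = p.-1%:R / (p.-1%:R + 1) ^+ 2 by rewrite /kappa natr1 prednK.
exists (Num.min (2%:R / p.-1%:R) (3%:R * kappa R p)).
  rewrite lt_min; apply/andP; split.
    by rewrite ltr_pdivlMr // mulVf ?lt0r_neq0 // ltr1n.
  rewrite kE; set e : R := p.-1%:R in e2 e0 *.
  have E0 : 0 < (e + 1) ^+ 2 by rewrite exprn_gt0 //; lra.
  rewrite mulrA ltr_pdivlMr // mulrC ltr_pdivrMr //; nra.
move=> m m2; have [m3|m3] := leqP 3 m.
  apply: vge_le (theta_decay pp op hpi m); rewrite ge_min; apply/orP; right.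
  by rewrite ler_pM2r ?kappa_gt0 // ler_nat.
have {m2 m3} -> : m = 2%N by apply/eqP; rewrite eqn_leq m2 -ltnS m3.
have -> : theta p pi 2 = expc (pi *: 'X^1 + - (pi *: 'X^p)) 2 by rewrite expr1.
rewrite (@expcD_high _ V0 _ _ p) //; first last.
- by move=> j jp; rewrite coefN coefZ coefXn ltn_eqF // mulr0 oppr0.
- by rewrite coefZ coefXn mulr0.
rewrite expc_Xn // dvd1n divn1; apply: (@vge_le _ _ _ (2%:R / p.-1%:R - 0)).
  by rewrite subr0 ge_min lexx.
apply: vge_divr; last exact: vge_piX.
by rewrite (ord_coprime pp op) // prime_coprime // dvdn_prime2 //= eq_sym.
Qed.

(** theta(1) - 1 equals pi up to an element of larger valuation, so it cannot vanish. *)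
Lemma theta_val1_neq1 : theta_val p pi 1 != 1.
Proof.
have [e he hm] := theta_ge2; apply/eqP => h1.
(* The two successors let the terms 1 and pi be split off. *)
pose D := (Num.bound (e / kappa R p)).+2.
have k0 := kappa_gt0 R pp.
have e0 : 0 < e by apply: lt_trans he; rewrite invr_gt0 ltr0n.
have hD : e <= D%:R * kappa R p.
  rewrite -ler_pdivrMr //; apply: ltW; apply: lt_le_trans (archi_boundP _) _.
    by rewrite divr_ge0 // ltW.
  by rewrite ler_nat /D; exact: (leqW (leqnSn _)).
have := theta_val_psum pp op cV hpi D (vge1 V).
rewrite h1 => /(vge_le hD); rewrite /D big_ord_recl big_ord_recl /=.
rewrite expr0 mulr1 (theta0 p pi) addrA -addrA [1 - _]addrC.
have t1 : theta p pi 1 = pi.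
  have -> : theta p pi 1 = expc (pi *: 'X^1 + - (pi *: 'X^p)) 1 by rewrite expr1.
  rewrite (@expcD_high _ V0 _ _ p) //; first last.
  - by move=> j jp; rewrite coefN coefZ coefXn ltn_eqF // mulr0 oppr0.
  - by rewrite coefZ coefXn mulr0.
  by rewrite expc_Xn // dvd1n divn1 expr1 divr1.
set S := \sum_(i < _) _.
have hS : vge e S.
  by apply: vge_sum => i _; rewrite expr1n mulr1; apply: hm; rewrite /bump; lia.
rewrite expr1 mulr1 /bump /= t1.
have -> : - (1 + (pi + S)) + 1 = - S - pi by ring.
rewrite vgeDl ?vgeN // /vge (ord_pi pp op hpi) lee_fin leNgt he.
by [].
Qed.

Variables (L : finFieldType) (b : nat) (omega : L -> V).
Hypotheses (b0 : (0 < b)%N) (hL : #|L| = (p ^ b)%N).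
Hypotheses (om0 : omega 0 = 0) (omM : {morph omega : x y / x * y}).
Hypotheses (omQ : forall x, omega x ^+ (p ^ b) = omega x).
Hypotheses (omN0 : forall x, x != 0 -> omega x != 0).
Hypothesis omD : forall x y, vpos (omega (x + y) - (omega x + omega y)).

Lemma om1 : omega 1 = 1.
Proof.
by apply: (mulfI (omN0 (oner_neq0 L))); rewrite -omM !mulr1.
Qed.

Lemma om_int x : vge 0 (omega x).
Proof. exact: (fixed_vge0 pp b0 (omQ x)). Qed.

Lemma omX x n : omega (x ^+ n) = omega x ^+ n.
Proof. by elim: n => [|n IH]; rewrite ?expr0 ?om1 // !exprS omM IH. Qed.

Lemma om_prod (I : Type) (r : seq I) (P : pred I) (G : I -> L) :
  omega (\prod_(i <- r | P i) G i) = \prod_(i <- r | P i) omega (G i).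
Proof. exact: (big_morph omega omM om1). Qed.

Lemma om_sum (I : Type) (r : seq I) (P : pred I) (G : I -> L) :
  vpos (omega (\sum_(i <- r | P i) G i) - \sum_(i <- r | P i) omega (G i)).
Proof.
apply: (big_ind2 (fun x t => vpos (omega x - t))) => [|x t x' t' h h'|i _].
- by rewrite om0 subrr vpos0.
- apply: (vpos_trans (omD x x')).
  have -> : omega x + omega x' - (t + t') = (omega x - t) + (omega x' - t') by ring.
  exact: vposD.
- by rewrite subrr vpos0.
Qed.

Lemma om_nat s : vpos (omega s%:R - s%:R).
Proof.
have := om_sum (index_enum 'I_s) xpredT (fun _ => 1).
by rewrite sumr_const om1 sumr_const card_ord.
Qed.

(** The value of [omega] at p is congruent to p, hence lies in the maximal ideal; a fixed point of
    the Q-th power there is 0. *)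
Lemma pchar_L : p \in [pchar L].
Proof.
apply/andP; split => //; apply/eqP; apply: contraTeq (om_nat p) => h.
have := omN0 h; apply: contra => hv.
have : vpos (omega p%:R).
  rewrite -[omega _](subrK (p%:R)); apply: vposD => //.
  by rewrite /vpos op lte_fin.
by move/(fixed_vpos pp b0 (omQ _)) ->.
Qed.

Definition trace (x : L) : L := \sum_(i < b) x ^+ (p ^ i).

Lemma traceD x y : trace (x + y) = trace x + trace y.
Proof.
rewrite /trace -big_split; apply: eq_bigr => i _ /=.
elim: (nat_of_ord i) => [|j IH]; first by rewrite expn0 !expr1.
rewrite expnSr !exprM IH; exact: (pFrobenius_autD_comm pchar_L (mulrC _ _)).
Qed.

(** The trace is fixed by Frobenius, and the p elements of the prime field already exhaust the roots
    of X^p - X. A natural representative s is wanted as the exponent of theta(1). *)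
Lemma traceP x : exists s : nat, trace x = s%:R.
Proof.
have tp : trace x ^+ p = trace x.
  have -> : trace x ^+ p = \sum_(i < b) x ^+ (p ^ i.+1).
    rewrite -(pFrobenius_autE pchar_L) rmorph_sum; apply: eq_bigr => i _.
    by rewrite /= pFrobenius_autE -exprM expnSr.
  have xQ : x ^+ (p ^ b) = x by rewrite -hL finfield.expf_card.
  rewrite /trace; case: b b0 xQ => // b' _ xQ.
  rewrite big_ord_recr /= xQ [in RHS]big_ord_recl /= expn0 expr1 addrC.
  by congr (_ + _); apply: eq_bigr => i _; rewrite /bump leq0n add1n.
have [/mapP[s _ ->]|nt] := boolP (trace x \in [seq s%:R | s <- iota 0 p]).
  by exists s.
have P0 : size ('X^p - 'X : {poly L}) = p.+1.
  by rewrite size_polyDl ?size_polyXn // size_polyN size_polyX.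
have Pn : ('X^p - 'X : {poly L}) != 0 by rewrite -size_poly_eq0 P0.
suff [h1 h2] : all (root ('X^p - 'X)) (trace x :: [seq s%:R | s <- iota 0 p]) /\
  uniq (trace x :: [seq s%:R | s <- iota 0 p]).
  by have := max_poly_roots Pn h1 h2; rewrite P0 /= size_map size_iota ltnn.
rewrite /=; split.
- apply/andP; split; first by rewrite /root !hornerE tp subrr.
  apply/allP => _ /mapP[s _ ->]; rewrite /root !hornerE.
  by rewrite -(pFrobenius_autE pchar_L) rmorph_nat subrr.
- rewrite nt map_inj_in_uniq ?iota_uniq // => s s'; rewrite !mem_iota !add0n /=.
  wlog ss : s s' / (s <= s')%N.
    by move=> h sp sp' e; case: (leqP s s') => ss; [|symmetry]; apply: h => //; exact: ltnW.
  move=> sp sp' e.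
  have : (s' - s)%:R == 0 :> L by rewrite natrB // e subrr.
  rewrite -(dvdn_pcharf pchar_L) => /dvdn_leq h.
  by move: h; case: (posnP (s' - s)); lia.
Qed.

(** The trace is a nonzero polynomial of degree at most p^(b-1), too small to vanish on all p^b
    elements. *)
Lemma trace_neq0 : exists x, trace x != 0.
Proof.
pose P : {poly L} := \sum_(i < b) 'X^(p ^ i).
have Pn : P != 0.
  have : P`_1 != 0.
    rewrite coef_sum; case: b b0 => // b' _; rewrite big_ord_recl big1 /= => [|i _].
      by rewrite expn0 coefXn addr0 oner_neq0.
    rewrite coefXn /bump leq0n add1n; case: eqP => // h; exfalso.
    have : (p ^ i.+1 <= 1)%N by rewrite -h.
    by rewrite -(expn0 p) leq_exp2l.
  by apply: contra_neq => ->; rewrite coef0.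
have [/existsP[x hx]|/existsPn hn] := boolP [exists x, trace x != 0]; first by exists x.
have := @max_poly_roots _ P (enum L) Pn.
rewrite enum_uniq -cardE hL => h.
have : (p ^ b < size P)%N.
  apply: h => //; apply/allP => x _; rewrite /root /P horner_sum.
  have := hn x; rewrite negbK /trace => /eqP h.
  by apply/eqP; rewrite -[RHS]h; apply: eq_bigr => i _; rewrite hornerXn.
have : (size P <= (p ^ b.-1).+1)%N.
  apply: leq_trans (size_sum _ _ _) _; apply/bigmax_leqP => i _.
  by rewrite size_polyXn ltnS leq_exp2l //; have := ltn_ord i; lia.
have : (p ^ b = p * p ^ b.-1)%N by rewrite -expnS prednK.
have : (0 < p ^ b.-1)%N by rewrite expn_gt0 p0.
by move: p1; nia.
Qed.

Definition Psi (x : L) : V := \prod_(i < b) theta_val p pi (omega x ^+ (p ^ i)).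

Lemma PsiE x s : trace x = s%:R -> Psi x = theta_val p pi 1 ^+ s.
Proof.
move=> hs; apply: (theta_val_trace pp op cV hpi b0 (omQ x)).
have := om_nat s; rewrite -hs; apply: vpos_trans; rewrite vposBC.
have := om_sum (index_enum 'I_b) xpredT (fun i => x ^+ (p ^ i)).
by under [X in _ - X]eq_bigr => i _ do rewrite omX.
Qed.

Lemma PsiD x y : Psi (x + y) = Psi x * Psi y.
Proof.
have [s hs] := traceP x; have [s' hs'] := traceP y.
rewrite (PsiE hs) (PsiE hs') -exprD; apply: PsiE.
by rewrite traceD hs hs' natrD.
Qed.

Lemma Psi0 : Psi 0 = 1.
Proof.
rewrite (@PsiE 0 0) // /trace big1 // => i _.
by rewrite expr0n expn_eq0 eqn0Ngt p0.
Qed.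

Lemma Psi_sum (I : Type) (r : seq I) (G : I -> L) :
  Psi (\sum_(i <- r) G i) = \prod_(i <- r) Psi (G i).
Proof. exact: (big_morph Psi PsiD Psi0). Qed.

(** If the trace of x is s, prime to p, then theta(1)^s = 1 together with theta(1)^p = 1 would force
    theta(1) = 1. *)
Lemma Psi_nontrivial : exists x, Psi x != 1.
Proof.
have [x hx] := trace_neq0; exists x; have [s hs] := traceP x.
rewrite (PsiE hs); apply: contra_neq theta_val1_neq1 => h.
have cs : coprime s p.
  rewrite coprime_sym prime_coprime //; apply: contra hx.
  by rewrite hs (dvdn_pcharf pchar_L).
have s0 : (0 < s)%N by case: s hs {h cs} => // hs; move: hx; rewrite hs eqxx.
have [u v uv _] := egcdnP p s0; rewrite (eqP cs) in uv.
have t := theta_val1_unity pp op cV hpi.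
have : theta_val p pi 1 ^+ (u * s) = theta_val p pi 1 ^+ (v * p + 1) by rewrite uv.
by rewrite mulnC exprM h expr1n exprD mulnC exprM t expr1n mul1r expr1.
Qed.

Lemma sum_Psi (c : L) : \sum_x Psi (x * c) = if c == 0 then (p ^ b)%:R else 0.
Proof.
case: eqVneq => [->|c0].
  by under eq_bigr => x _ do rewrite mulr0 Psi0; rewrite sumr_const hL.
have -> : \sum_x Psi (x * c) = \sum_x Psi x.
  rewrite [RHS](reindex (fun x => x * c)) //=.
  by exists (fun x => x / c) => x _; rewrite ?mulfK ?mulfVK.
have [y hy] := Psi_nontrivial; apply/eqP.
have : \sum_x Psi x = \sum_x Psi x * Psi y.
  rewrite [LHS](reindex (fun x => x + y)) /=; last first.
    by exists (fun x => x - y) => x _; rewrite ?addrK ?subrK.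
  by apply: eq_bigr => x _; rewrite PsiD.
rewrite -mulr_suml => /eqP; rewrite -subr_eq0 -{1}[\sum_x _]mulr1 -mulrBr mulf_eq0.
by rewrite [1 - _ == _]subr_eq0 [1 == _]eq_sym (negbTE hy) orbF.
Qed.

Lemma sum_omegaX m : \sum_(x | x != 0) omega x ^+ m =
  if ((p ^ b).-1 %| m)%N then (p ^ b)%:R - 1 else 0.
Proof.
have Q1 := pred_gt0 pp b0.
have omQ1 x : x != 0 -> omega x ^+ (p ^ b).-1 = 1.
  by move=> x0; apply: (fixed_unity pp); [exact: omN0|exact: omQ].
case: ifP => hm.
  rewrite (eq_bigr (fun=> 1)) => [|x x0]; last first.
    by rewrite -(divnK hm) mulnC exprM omQ1 // expr1n.
  rewrite sumr_const -hL -cardsT.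
  have -> : #|(fun x : L => x != 0)| = #|[set: L] :\ 0|.
    by apply: eq_card => x; rewrite !inE andbT.
  by rewrite (cardsD1 0 [set: L]) inE add1n -natr1 addrK.
have [y y0 hy] : exists2 y, y != 0 & omega y ^+ m != 1.
  have [g gP] := finField_primitive_root L; rewrite hL in gP.
  have g0 : g != 0.
    have := prim_expr_order gP; apply: contra_eq_neq => ->.
    by rewrite expr0n gtn_eqF // eq_sym oner_neq0.
  exists g => //; rewrite -omX -om1; apply: contraFN hm => /eqP h.
  (* If g^m and 1 had the same image, g^m - 1 would be sent to the maximal ideal, hence to 0,
     against the order of g. *)
  have : vpos (omega (g ^+ m - 1)).
    have := omD (g ^+ m - 1) 1; rewrite subrK h om1 => hv.
    by rewrite -vposN; have -> : - omega (g ^+ m - 1) = 1 - (omega (g ^+ m - 1) + 1) by ring.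
  move/(fixed_vpos pp b0 (omQ _)) => /eqP.
  have [//|h1] := eqVneq (g ^+ m - 1) 0; last by rewrite (negbTE (omN0 h1)).
  by move=> e _; rewrite (prim_order_dvd gP) -subr_eq0 e.
apply/eqP; have : \sum_(x | x != 0) omega x ^+ m = \sum_(x | x != 0) omega x ^+ m * omega y ^+ m.
  rewrite [LHS](reindex (fun x => x * y)) /=; last first.
    by exists (fun x => x / y) => x _; rewrite ?mulfK ?mulfVK.
  by apply: eq_big => x; [rewrite mulf_eq0 (negbTE y0) orbF|rewrite omM exprMn].
rewrite -mulr_suml => /eqP; rewrite -subr_eq0 -{1}[\sum_(_ | _) _]mulr1 -mulrBr mulf_eq0.
by rewrite [1 - _ == _]subr_eq0 [1 == _]eq_sym (negbTE hy) orbF.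
Qed.

End CharacterSum.

(** * The trace formula *)

Lemma sum_torus (V : fieldType) (n : nat) (L : finFieldType) (omega : L -> V)
    (M : nat) (c : V) (H : mpoly n V) :
  (forall m, \sum_(x | x != 0) omega x ^+ m = if (M %| m)%N then c else 0) ->
  \sum_(x : {ffun 'I_n -> L} | [forall i, x i != 0]) meval (fun i => omega (x i)) H =
  c ^+ n * \sum_(r <- msupp H | [forall i : 'I_n, (M %| r i)%N]) mcoeff r H.
Proof.
move=> hs; under eq_bigr => x _ do rewrite mevalE.
rewrite exchange_big mulr_sumr [RHS]big_mkcond; apply: eq_bigr => r _ /=.
rewrite -mulr_sumr.
have -> : \sum_(x : {ffun 'I_n -> L} | [forall i, x i != 0])
    \prod_(i < n) omega (x i) ^+ r i =
    \prod_(i < n) \sum_(y | y != 0) omega y ^+ r i.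
  rewrite bigA_distr_big; apply: eq_bigl => x.
  by apply/forallP/ffun_onP.
case: ifP => [/forallP hr|/negbT/forallPn[i hi]].
  rewrite (eq_bigr (fun=> c)) => [|i _]; last by rewrite hs hr.
  by rewrite prodr_const card_ord mulrC.
by rewrite (bigD1 i) //= hs (negbTE hi) mul0r mulr0.
Qed.

Section PowerMap.
Variables (V : fieldType) (n : nat).
Implicit Types (P H : mpoly n V) (r s u v w : multinom n).

(** The substitution of X_i^e for each X_i, not the power P^e. *)
Definition mpow (e : nat) P : mpoly n V :=
  comp_mpoly [tuple mpolyX V (mnm_muln (mnm1 i) e) | i < n] P.

Lemma mpowX e r : mpow e (mpolyX V r) = mpolyX V (mnm_muln r e).
Proof.
rewrite /mpow comp_mpolyX mpolyXE_id; apply: eq_bigr => i _.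
rewrite tnth_mktuple !mpolyXn; congr (mpolyX _ _); apply/mnmP => j.
by rewrite !mulmnE -mulnA (mulnC e).
Qed.

Lemma mpowE e P : mpow e P = \sum_(r <- msupp P) mcoeff r P *: mpolyX V (mnm_muln r e).
Proof.
rewrite /mpow comp_mpolyEX; apply: eq_bigr => r _; congr (_ *: _); exact: mpowX.
Qed.

Lemma meval_mpow e P (x : 'I_n -> V) :
  meval x (mpow e P) = meval (fun i => x i ^+ e) P.
Proof.
rewrite /mpow comp_mpoly_meval; apply: meval_eq => i.
rewrite tnth_mktuple mevalX (bigD1 i) //= big1 => [|j ji].
  by rewrite mulmnE mnm1E eqxx mul1n mulr1.
by rewrite mulmnE mnm1E eq_sym (negbTE ji) mul0n expr0.
Qed.

(* the coefficient of X^(e u - v), with value 0 when e u - v has a negative entry *)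
Definition cfd (e : nat) P u v : V :=
  if lem v (mnm_muln u e) then mcoeff (mnm_sub (mnm_muln u e) v) P else 0.

Lemma cfdX e r u v : cfd e (mpolyX V r) u v = (mnm_add r v == mnm_muln u e)%:R.
Proof.
rewrite /cfd; case: ifP => h.
  rewrite mcoeffX -(eqm_add2r v) submK //.
case: eqP => // e1; move: h; rewrite -e1.
have -> // : lem v (mnm_add r v).
by apply/mnm_lepP => i; rewrite mnmDE leq_addl.
Qed.

Lemma cfd_sum e (I : Type) (t : seq I) (a : I -> V) (r : I -> multinom n) u v :
  cfd e (\sum_(i <- t) a i *: mpolyX V (r i)) u v =
  \sum_(i <- t) a i * (mnm_add (r i) v == mnm_muln u e)%:R.
Proof.
under [RHS]eq_bigr => i _ do rewrite -cfdX.
rewrite /cfd; case: ifP => h; last by rewrite big1 // => i _; rewrite mulr0.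
rewrite raddf_sum; apply: eq_bigr => i _ /=.
by rewrite mcoeffZ.
Qed.

Lemma cfdE e P u v :
  cfd e P u v = \sum_(r <- msupp P) mcoeff r P * (mnm_add r v == mnm_muln u e)%:R.
Proof. by rewrite {1}[P]mpolyE cfd_sum. Qed.

Lemma mnm_mulnD u v e : mnm_muln (mnm_add u v) e = mnm_add (mnm_muln u e) (mnm_muln v e).
Proof. by apply/mnmP => i; rewrite !(mulmnE, mnmDE) mulnDl. Qed.

Lemma mnm_mulnM u d e : mnm_muln u (d * e) = mnm_muln (mnm_muln u d) e.
Proof. by apply/mnmP => i; rewrite !mulmnE mulnA. Qed.

Lemma mnm_muln_inj e : (0 < e)%N -> injective (fun u : multinom n => mnm_muln u e).
Proof.
move=> e0 u v /= /mnmP h; apply/mnmP => i; have := h i; rewrite !mulmnE.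
by move/eqP; rewrite eqn_pmul2r // => /eqP.
Qed.

Lemma mnm_add_swap r s v :
  mnm_add (mnm_add r s) v = mnm_add r (mnm_add s v).
Proof. by rewrite addmA. Qed.

Section Step.
Variables (W : nat) (idx : 'I_W -> multinom n).
Hypothesis idx_inj : injective idx.

(** For given exponents r, s, u and j at most one middle index w fits, determined by e w = s +
    [idx j]; the closure hypothesis says that w is in the list, so the finite sum loses nothing. *)
Lemma cfd_mul d e P H u (j : 'I_W) : (0 < e)%N ->
  (forall s w, s \in msupp H -> mnm_add s (idx j) = mnm_muln w e ->
     exists k, idx k = w) ->
  \sum_k cfd d P u (idx k) * cfd e H (idx k) (idx j) =
  cfd (d * e) (mpow e P * H) u (idx j).
Proof.
move=> e0 hcl.
have -> : mpow e P * H = \sum_(rs <- [seq (r, s) | r <- msupp P, s <- msupp H])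
    (mcoeff rs.1 P * mcoeff rs.2 H) *: mpolyX V (mnm_add (mnm_muln rs.1 e) rs.2).
  rewrite big_allpairs mpowE [H in LHS]mpolyE mulr_suml.
  apply: eq_bigr => r _; rewrite mulr_sumr; apply: eq_bigr => s _ /=.
  by rewrite -scalerAl -scalerAr scalerA mpolyXD.
rewrite cfd_sum big_allpairs.
rewrite (eq_bigr (fun k => \sum_(r <- msupp P) \sum_(s <- msupp H)
  (mcoeff r P * (mnm_add r (idx k) == mnm_muln u d)%:R) *
  (mcoeff s H * (mnm_add s (idx j) == mnm_muln (idx k) e)%:R))); last first.
  by move=> k _; rewrite !cfdE big_distrlr.
rewrite exchange_big; apply: eq_bigr => r _ /=.
rewrite exchange_big; apply: eq_big_seq => s sH /=.
under eq_bigr => k _ do rewrite mulrACA -natrM mulnb.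
rewrite -mulr_sumr; congr (_ * _).
rewrite mnm_add_swap mnm_mulnM.
case: eqP => [h|h]; last first.
  rewrite big1 // => k _; case: andP => // -[/eqP h1 /eqP h2]; case: h.
  by rewrite h2 -mnm_mulnD h1.
have ru : lem r (mnm_muln u d).
  apply/mnm_lepP => i; have /mnmP/(_ i) := h.
  rewrite mnmDE !mulmnE => hi; rewrite -(leq_pmul2r e0) -hi leq_addr //.
have hw : mnm_add s (idx j) = mnm_muln (mnm_sub (mnm_muln u d) r) e.
  apply: (@addmI n (mnm_muln r e)); rewrite h -mnm_mulnD.
  by rewrite addmC submK.
have [k hk] := hcl s _ sH hw.
rewrite (bigD1 k) //= hw hk eqxx andbT big1 ?addr0 => [|k' kk].
  by rewrite addmC submK // eqxx.
case: andP => // -[_] => /eqP /(mnm_muln_inj e0) e1.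
by move: kk; rewrite (idx_inj (etrans hk e1)) eqxx.
Qed.

End Step.
End PowerMap.

Section TraceFormula.
Variables (V : fieldType) (n : nat) (p : nat).
Hypothesis p1 : (1 < p)%N.
Variable C : multinom n.+1 -> Prop.
Hypothesis C0 : C (@mnm0 n.+1).
Hypothesis CD : forall r s, C r -> C s -> C (mnm_add r s).
Hypothesis CM : forall r e, C r -> C (mnm_muln r e).
Hypothesis CV : forall r e, (0 < e)%N -> C (mnm_muln r e) -> C r.
Implicit Types (P H : mpoly n.+1 V) (s : seq (mpoly n.+1 V)).

Definition graded (D : nat) P :=
  forall r, r \in msupp P -> C r /\ (r ord0 <= D)%N.

Fixpoint frob_prod s : mpoly n.+1 V :=
  if s is P :: s' then mpow (p ^ size s') P * frob_prod s' else 1.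

(** The shape D (Q - 1) of the bound, Q = p^(size s), makes the index set closed: Q w = r + v with
    r_0 <= D (Q - 1) and v_0 <= D gives w_0 <= D. *)
Lemma graded_frob_prod D s : (forall P, P \in s -> graded D P) ->
  graded (D * (p ^ size s).-1) (frob_prod s).
Proof.
have p0 : (0 < p)%N by exact: ltnW.
elim: s => [|P s IH] hs t /=.
  by rewrite -mpolyC1 msupp1 inE => /eqP ->; rewrite mnm0E.
have {}IH := IH (fun Q h => hs Q (@mem_behead _ (P :: s) Q h)).
have hP := hs P (mem_head _ _).
move=> /msuppM_le /allpairsP[[r1 r2] /= [h1 h2 ->]].
have {h1} [r [rP ->]] : exists r, r \in msupp P /\ r1 = mnm_muln r (p ^ size s).
  move: h1; rewrite mpowE => /msupp_sum_le /flattenP[t' /mapP[r]].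
  rewrite filter_predT => rP -> /msuppZ_le /mem_msuppXP <-.
  by exists r.
have [Cr rD] := hP r rP; have [C2 r2D] := IH r2 h2.
split; first by apply: CD => //; exact: CM.
rewrite mnmDE mulmnE expnS; move: r2D; have := expn_gt0 p (size s); rewrite p0 /=.
by move: (p ^ size s)%N => x x0; nia.
Qed.

Lemma meval_frob_prod s (x : 'I_n.+1 -> V) :
  meval x (frob_prod s) =
  \prod_(i < size s) meval (fun j => x j ^+ (p ^ (size s - i.+1))) (nth 0 s i).
Proof.
elim: s => [|P s IH] /=; first by rewrite big_ord0 meval1.
by rewrite big_ord_recl mevalM meval_mpow IH subSS subn0.
Qed.

Variables (D W : nat) (idx : 'I_W -> multinom n.+1).
Hypothesis idx_inj : injective idx.
Hypothesis idx_im : forall w, (exists i, idx i = w) <-> C w /\ (w ord0 <= D)%N.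

Definition cfmx P : 'M[V]_W := \matrix_(i, j) cfd p P (idx i) (idx j).

Lemma prod_cfmx s : (forall P, P \in s -> graded D P) ->
  forall i j, (\prod_(P <- s) cfmx P) i j =
    cfd (p ^ size s) (frob_prod s) (idx i) (idx j).
Proof.
have p0 : (0 < p)%N by exact: ltnW.
elim: s => [|P s IH] hs i j.
  rewrite big_nil !mxE /= expn0 cfdE -mpolyC1 msupp1 big_seq1 mcoeffC eqxx mulr1 mul1r.
  by rewrite add0m (inj_eq idx_inj) eq_sym.
have hs' Q : Q \in s -> graded D Q by move=> h; apply: hs; rewrite inE h orbT.
rewrite big_cons mxE /=.
under eq_bigr => k _ do rewrite IH // mxE.
rewrite expnS; apply: cfd_mul => //; first by rewrite expn_gt0 p0.
move=> r w rH hw; apply/idx_im.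
have [Cr rD] := graded_frob_prod hs' rH.
have [Cj jD] := (idx_im (idx j)).1 (ex_intro _ j erefl).
split; first by apply: (@CV _ (p ^ size s)); [rewrite expn_gt0 p0|rewrite -hw; exact: CD].
have /mnmP/(_ ord0) := hw; rewrite mnmDE mulmnE.
move: rD; have := expn_gt0 p (size s); rewrite p0 /=.
by move: (p ^ size s)%N => x x0; nia.
Qed.

(** The diagonal entry at u is the coefficient of X^((Q-1) u). Conversely an exponent of the support
    divisible by Q - 1 is (Q - 1) w, and w is an index since C is saturated and w_0 <= D. *)
Lemma trace_cfmx s : (0 < size s)%N -> (forall P, P \in s -> graded D P) ->
  \tr (\prod_(P <- s) cfmx P) =
  \sum_(r <- msupp (frob_prod s) | [forall i, ((p ^ size s).-1 %| r i)%N])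
     mcoeff r (frob_prod s).
Proof.
have p0 : (0 < p)%N by exact: ltnW.
move=> s0 hs; set Q := (p ^ size s)%N; set H := frob_prod s.
have Q1 : (0 < Q.-1)%N.
  by rewrite -ltnS prednK ?expn_gt0 ?p0 // -(expn0 p) ltn_exp2l.
have hH : graded (D * Q.-1) H by exact: graded_frob_prod.
have -> : \tr (\prod_(P <- s) cfmx P) = \sum_i mcoeff (mnm_muln (idx i) Q.-1) H.
  apply: eq_bigr => i _; rewrite prod_cfmx // /cfd -/Q.
  have QE : Q = Q.-1.+1 by rewrite prednK // expn_gt0 p0.
  have e : mnm_muln (idx i) Q = mnm_add (mnm_muln (idx i) Q.-1) (idx i).
    by rewrite [in LHS]QE mulmSr.
  rewrite e addmK; case: ifP => // /negbT/negP; case.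
  by apply/mnm_lepP => j; rewrite mnmDE leq_addl.
have inj : injective (fun i => mnm_muln (idx i) Q.-1).
  by move=> i j /(mnm_muln_inj Q1) /idx_inj.
rewrite (bigID (fun i => mnm_muln (idx i) Q.-1 \in msupp H)) /= [X in _ + X]big1 ?addr0; last first.
  by move=> i; exact: memN_msupp_eq0.
rewrite -[RHS]big_filter.
rewrite -(big_map (fun i => mnm_muln (idx i) Q.-1) (mem (msupp H)) (fun r => mcoeff r H)) -big_filter.
apply: perm_big; apply: uniq_perm.
- by rewrite filter_uniq // map_inj_uniq // index_enum_uniq.
- by rewrite filter_uniq // msupp_uniq.
move=> r; rewrite !mem_filter; apply/andP/andP => -[h1 h2]; split => //.
- by case/mapP: h2 => i _ ->; apply/forallP => j; rewrite mulmnE dvdn_mull.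
- have [Cr rD] := hH r h2.
  pose w := Multinom [tuple (r i %/ Q.-1)%N | i < n.+1].
  have rw : r = mnm_muln w Q.-1.
    by apply/mnmP => i; rewrite mulmnE mnmE divnK //; exact: (forallP h1).
  have [i hi] : exists i, idx i = w.
    apply/idx_im; split; first by apply: (CV Q1); rewrite -rw.
    by move: rD; rewrite rw mulmnE leq_pmul2r.
  by apply/mapP; exists i; rewrite ?mem_index_enum // hi.
Qed.

Lemma trace_formula (L : finFieldType) (omega : L -> V) (c : V) s :
  (0 < size s)%N -> (forall P, P \in s -> graded D P) ->
  (forall m, \sum_(x | x != 0) omega x ^+ m =
     if ((p ^ size s).-1 %| m)%N then c else 0) ->
  c ^+ n.+1 * \tr (\prod_(P <- s) cfmx P) =
  \sum_(x : {ffun 'I_n.+1 -> L} | [forall i, x i != 0])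
    \prod_(i < size s) meval (fun j => omega (x j) ^+ (p ^ (size s - i.+1))) (nth 0 s i).
Proof.
move=> s0 hs hsum; rewrite trace_cfmx // -(sum_torus _ hsum).
by apply: eq_bigr => x _; rewrite meval_frob_prod.
Qed.

End TraceFormula.

(** * Cones and weights *)

Lemma finite_enumeration (T : eqType) (A : set T) : finite_set A ->
  exists W (idx : 'I_W -> T), injective idx /\ forall w, (exists i, idx i = w) <-> A w.
Proof.
move=> /finite_seqP[s ->]; pose u := undup s.
exists (size u), (fun i => tnth (in_tuple u) i); split.
  move=> i j; have x0 := tnth (in_tuple u) i; rewrite !(tnth_nth x0) /= => /eqP.
  by rewrite nth_uniq ?undup_uniq // => /eqP /val_inj.
move=> w; split=> [[i <-]|/= ws].
  by have := mem_tnth i (in_tuple u); rewrite /= mem_undup.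
have iw : (index w u < size u)%N by rewrite index_mem mem_undup.
by exists (Ordinal iw); rewrite (tnth_nth w) /= nth_index // mem_undup.
Qed.

Lemma finite_bounded_multinom n (M : nat) :
  finite_set [set w : multinom n | forall i, (w i <= M)%N].
Proof.
pose g (x : {ffun 'I_n -> 'I_M.+1}) := Multinom [tuple nat_of_ord (x i) | i < n].
apply: (@sub_finite_set _ _ [set` [seq g x | x <- enum {: {ffun 'I_n -> 'I_M.+1}}]]).
  move=> w /= hw; apply/mapP; exists [ffun i => inord (w i)]; first by rewrite mem_enum.
  by apply/mnmP => i; rewrite mnmE ffunE inordK // ltnS hw.
by apply/finite_seqP; eexists.
Qed.

Section Conic.
Variables (R : realType) (n : nat) (delta : set 'rV[R]_n).
Implicit Types (y : 'rV[R]_(1 + n)) (x : 'rV[R]_n).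

Lemma row_mx1_head x : row_mx 1%:M x 0 ord0 = 1.
Proof.
have -> : ord0 = lshift n (ord0 : 'I_1) by exact: val_inj.
by rewrite row_mxEl mxE.
Qed.

Lemma row_mx1_tail x i : row_mx (1%:M : 'M_1) x 0 (rshift 1 i) = x 0 i.
Proof. exact: row_mxEr. Qed.

(** Nonnegative combinations without the normalisation of a convex hull, so that stability under
    addition is concatenation of lists; [cone_DeltaP] identifies this with the cone over [Delta]. *)
Definition conic y := exists s : seq (R * 'rV[R]_n),
  (forall e, e \in s -> 0 <= e.1 /\ delta e.2) /\
  y = \sum_(e <- s) e.1 *: row_mx 1%:M e.2.

Lemma conic0 : conic 0.
Proof. by exists [::]; rewrite big_nil. Qed.

Lemma conicD y y' : conic y -> conic y' -> conic (y + y').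
Proof.
move=> [s [hs ->]] [s' [hs' ->]]; exists (s ++ s'); rewrite big_cat; split => // e.
by rewrite mem_cat => /orP[/hs|/hs'].
Qed.

Lemma conicZ (t : R) y : 0 <= t -> conic y -> conic (t *: y).
Proof.
move=> t0 [s [hs ->]]; exists [seq (t * e.1, e.2) | e <- s]; split.
  by move=> _ /mapP[e /hs[e0 eD] ->] /=; split => //; exact: mulr_ge0.
by rewrite big_map scaler_sumr; apply: eq_bigr => e _; rewrite scalerA.
Qed.

Lemma conic_row x : delta x -> conic (row_mx 1%:M x).
Proof.
move=> dx; exists [:: (1, x)]; rewrite big_seq1 scale1r; split => // e.
by rewrite inE => /eqP ->.
Qed.

Lemma conic_sum (I : Type) (r : seq I) (F : I -> 'rV[R]_(1 + n)) :
  (forall i, conic (F i)) -> conic (\sum_(i <- r) F i).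
Proof. by move=> h; apply: (big_ind conic) => //; [exact: conic0|exact: conicD]. Qed.

Lemma Delta_conic y : Delta delta y -> conic y /\ y 0 ord0 <= 1.
Proof.
move=> [k [v [c [hv c0 c1 ->]]]]; split.
  apply: conic_sum => i; apply: conicZ => //.
  by case: (hv i) => [->|[x dx ->]]; [exact: conic0|exact: conic_row].
rewrite summxE -c1; apply: ler_sum => i _; rewrite mxE.
case: (hv i) => [->|[x dx ->]]; first by rewrite mxE mulr0.
by rewrite row_mx1_head mulr1.
Qed.

Lemma dilate_Delta_conic (t : R) y : 0 <= t -> dilate t (Delta delta) y ->
  conic y /\ y 0 ord0 <= t.
Proof.
move=> t0 [z /Delta_conic[cz z1] <-]; split; first exact: conicZ.
by rewrite mxE ler_piMr.
Qed.

Lemma conic_head s :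
  (\sum_(e <- s) e.1 *: row_mx 1%:M e.2 : 'rV[R]_(1 + n)) 0 ord0 = \sum_(e <- s) e.1.
Proof.
by rewrite summxE; apply: eq_bigr => e _; rewrite mxE row_mx1_head mulr1.
Qed.

(** The coefficients sum to the first coordinate of y; after division by t the missing mass is put
    on the origin, a point of the generating set of [Delta]. *)
Lemma conic_dilate (t : R) y : 0 < t -> conic y -> y 0 ord0 <= t ->
  dilate t (Delta delta) y.
Proof.
move=> t0 [s [hs ->]]; rewrite conic_head => hS.
pose v (i : 'I_(size s).+1) : 'rV[R]_(1 + n) :=
  if unlift ord0 i is Some j then row_mx 1%:M (tnth (in_tuple s) j).2 else 0.
pose c (i : 'I_(size s).+1) : R :=
  if unlift ord0 i is Some j then (tnth (in_tuple s) j).1 / t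
  else 1 - (\sum_(e <- s) e.1) / t.
have c_0 : c ord0 = 1 - (\sum_(e <- s) e.1) / t by rewrite /c unlift_none.
have c_S i : c (lift ord0 i) = (tnth (in_tuple s) i).1 / t by rewrite /c liftK.
exists (t^-1 *: \sum_(e <- s) e.1 *: row_mx 1%:M e.2); last first.
  by rewrite scalerA divff ?scale1r // lt0r_neq0.
exists (size s).+1, v, c; split.
- move=> i; rewrite /v; case: unliftP => [j _|_]; [right|by left].
  by exists (tnth (in_tuple s) j).2 => //; have [] := hs _ (mem_tnth j (in_tuple s)).
- move=> i; rewrite /c; case: unliftP => [j _|_].
    apply: divr_ge0; last exact: ltW.
    by have [] := hs _ (mem_tnth j (in_tuple s)).
  by rewrite subr_ge0 ler_pdivrMr // mul1r.
- rewrite big_ord_recl c_0 (eq_bigr _ (fun i _ => c_S i)).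
  by rewrite -mulr_suml [in X in _ - X / _]big_tnth subrK.
- rewrite big_ord_recl /v unlift_none scaler0 add0r.
  rewrite big_tnth scaler_sumr; apply: eq_bigr => i _.
  by rewrite c_S liftK scalerA mulrC.
Qed.

Lemma conic_head_ge0 y : conic y -> 0 <= y 0 ord0.
Proof.
by move=> [s [hs ->]]; rewrite conic_head big_seq sumr_ge0 // => e /hs[].
Qed.

Lemma cone_DeltaP y : cone (Delta delta) y <-> conic y.
Proof.
split=> [[t t0 /(dilate_Delta_conic t0)[]//]|cy].
have t0 : 0 < y 0 ord0 + 1 by rewrite ltr_wpDl ?conic_head_ge0.
by exists (y 0 ord0 + 1); [exact: ltW|apply: conic_dilate => //; rewrite lerDl].
Qed.

Lemma conic_tail_bounds (d : R) y : (forall x, delta x -> forall i, 0 <= x 0 i <= d) ->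
  conic y -> forall i, 0 <= y 0 (rshift 1 i) <= d * y 0 ord0.
Proof.
move=> hd [s [hs ->]] i; rewrite conic_head summxE mulr_sumr.
rewrite big_seq [X in _ <= _ <= X]big_seq; apply/andP; split.
  apply: sumr_ge0 => e /hs[e0 /hd /(_ i)/andP[x0 _]].
  by rewrite mxE row_mx1_tail mulr_ge0.
apply: ler_sum => e /hs[e0 /hd /(_ i)/andP[_ xd]].
by rewrite mxE row_mx1_tail mulrC ler_wpM2r.
Qed.

End Conic.

Lemma delta2_bounds (R : realType) (F : fieldType) (n : nat) (f : mpoly n F) (x : 'rV[R]_n) :
  delta2 f x -> forall i, 0 <= x 0 i <= (msize f).-1%:R.
Proof.
move=> [k [v [c [hv c0 c1 ->]]]] i; rewrite summxE.
have hvi j : 0 <= v j 0 i <= (msize f).-1%:R.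
  case: (hv j) => [->|[l ->]]; first by rewrite mxE lexx ler0n.
  rewrite !mxE eqxx /=; case: eqP => _; first by rewrite mulr1 lexx ler0n.
  by rewrite mulr0 lexx ler0n.
apply/andP; split.
  by apply: sumr_ge0 => j _; rewrite mxE mulr_ge0 //; have /andP[] := hvi j.
have -> : ((msize f).-1%:R : R) = \sum_j c j * (msize f).-1%:R.
  by rewrite -mulr_suml c1 mul1r.
by apply: ler_sum => j _; rewrite mxE ler_wpM2l //; have /andP[] := hvi j.
Qed.

Section IndexSet.
Variables (R : realType) (p N n : nat) (F : fieldType) (f : mpoly n F).
Variable delta : set 'rV[R]_n.
Hypotheses (pp : prime p) (N0 : (0 < N)%N) (dsub : delta `<=` delta2 f).
Implicit Types (u : 'rV[int]_(1 + n)) (w : multinom n.+1).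

Definition cone_mnm w : Prop := conic delta (mnm_toR R w : 'rV[R]_(1 + n)).

Definition weight_bound : R := (p%:R / (p%:R - 1)) ^+ 2 * N%:R.

Definition of_mnm w : 'rV[int]_(1 + n) := \row_i (w i)%:Z.

Definition to_mnm u : multinom n.+1 := Multinom [tuple absz (u 0 i) | i < n.+1].

Lemma of_mnmK : cancel of_mnm to_mnm.
Proof. by move=> w; apply/mnmP => i; rewrite mnmE mxE. Qed.

Lemma to_mnmK u : (forall i, 0 <= u 0 i) -> of_mnm (to_mnm u) = u.
Proof. by move=> hu; apply/rowP => i; rewrite mxE mnmE gez0_abs. Qed.

Lemma toR_of_mnm w : toR R (of_mnm w) = mnm_toR R w.
Proof. by apply/rowP => i; rewrite !mxE -pmulrn. Qed.

Lemma cone_mnm0 : cone_mnm (@mnm0 _).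
Proof.
rewrite /cone_mnm; have -> : mnm_toR R (@mnm0 n.+1) = 0.
  by apply/rowP => i; rewrite !mxE mnm0E.
exact: conic0.
Qed.

Lemma cone_mnmD w w' : cone_mnm w -> cone_mnm w' -> cone_mnm (mnm_add w w').
Proof.
move=> hw hw'; rewrite /cone_mnm.
have -> : mnm_toR R (mnm_add w w') = mnm_toR R w + mnm_toR R w'.
  by apply/rowP => i; rewrite !mxE mnmDE natrD.
exact: conicD.
Qed.

Lemma cone_mnmM w e : cone_mnm w -> cone_mnm (mnm_muln w e).
Proof.
move=> hw; rewrite /cone_mnm.
have -> : mnm_toR R (mnm_muln w e) = e%:R *: mnm_toR R w.
  by apply/rowP => i; rewrite !mxE mulmnE natrM mulrC.
exact: conicZ.
Qed.

Lemma cone_mnmV w e : (0 < e)%N -> cone_mnm (mnm_muln w e) -> cone_mnm w.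
Proof.
move=> e0 hw; rewrite /cone_mnm.
have -> : mnm_toR R w = e%:R^-1 *: mnm_toR R (mnm_muln w e).
  apply/rowP => i; rewrite !mxE mulmnE natrM mulrCA mulVf ?mulr1 //.
  by rewrite pnatr_eq0 -lt0n.
by apply: conicZ => //; rewrite invr_ge0.
Qed.

Lemma cone_mnm_finite D : finite_set [set w | cone_mnm w /\ (w ord0 <= D)%N].
Proof.
apply: sub_finite_set (finite_bounded_multinom n.+1 ((msize f).-1 * D + D)).
move=> w [cw wD] i.
have hd x : delta x -> forall i, 0 <= x 0 i <= (msize f).-1%:R.
  by move=> /dsub; exact: delta2_bounds.
case: (unliftP ord0 i) => [j ->|->]; last by apply: leq_trans wD _; rewrite leq_addl.
have := conic_tail_bounds hd cw j; rewrite !mxE => /andP[_].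
rewrite -natrM ler_nat; have -> : rshift 1 j = lift ord0 j :> 'I_n.+1 by exact: val_inj.
move=> h; apply: leq_trans h _; apply: leq_trans (leq_addr _ _).
by rewrite leq_mul2l wD orbT.
Qed.

(** Nonnegativity of the entries follows from membership in the cone, since [delta2] lies in the
    positive orthant. *)
Lemma index_setP u : index_set p N delta u <->
  conic delta (toR R u) /\ (u 0 ord0)%:~R < weight_bound.
Proof.
have hd x : delta x -> forall i, 0 <= x 0 i <= (msize f).-1%:R.
  by move=> /dsub; exact: delta2_bounds.
split=> [[u0 /cone_DeltaP cu]|[cu wu]].
  by rewrite /weight mem_set ?lte_fin ?mxE //; exact/cone_DeltaP.
split; last 2 first.
- exact/cone_DeltaP.
- by rewrite /weight mem_set ?lte_fin ?mxE //; exact/cone_DeltaP.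
move=> i; case: (unliftP ord0 i) => [j ->|->].
  have := conic_tail_bounds hd cu j; rewrite mxE ler0z => /andP[h _].
  by have -> : lift ord0 j = rshift 1 j by exact: val_inj.
by have := conic_head_ge0 cu; rewrite mxE ler0z.
Qed.

Lemma index_set_mnm w : index_set p N delta (of_mnm w) <->
  cone_mnm w /\ (w ord0)%:R < weight_bound.
Proof. by rewrite index_setP toR_of_mnm mxE -pmulrn. Qed.

Lemma index_set_finite : finite_set (index_set p N delta).
Proof.
apply: (@sub_finite_set _ _ (of_mnm @` [set w | cone_mnm w /\ (w ord0 <= Num.bound weight_bound)%N])).
  move=> u hu; have [u0 _ _] := hu.
  exists (to_mnm u); last exact: to_mnmK.
  move: hu; rewrite -{1}(to_mnmK u0) index_set_mnm => -[cu wu]; split => //.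
  rewrite -(ler_nat R); apply: le_trans (ltW wu) (ltW _).
  apply: archi_boundP; exact: le_trans (ler0n _ _) (ltW wu).
exact/finite_image/cone_mnm_finite.
Qed.

Lemma weight_boundE : weight_bound = p%:R ^+ 2 * N%:R / (p%:R - 1) ^+ 2.
Proof.
have p1 : (p%:R - 1 : R) != 0 by rewrite subr_eq0 pnatr_eq1 gtn_eqF // prime_gt1.
by rewrite /weight_bound; field.
Qed.

Lemma weight_bound_gt1 : 1 < weight_bound.
Proof.
have p2 : (2 : R) <= p%:R by rewrite (ler_nat R 2) prime_gt1.
have N1 : (1 : R) <= N%:R by rewrite ler1n.
rewrite weight_boundE ltr_pdivlMr ?exprn_gt0 //; last by lra.
set x : R := p%:R in p2 *; nra.
Qed.

(** An integer is below the bound exactly when it is at most its ceiling minus 1. The bound exceeds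
    1, so t > 0 and [conic_dilate] may divide by t. *)
Lemma index_set_dilate (t : int) : t = Num.ceil weight_bound - 1 ->
  lattice_points (dilate t%:~R (Delta delta)) = index_set p N delta.
Proof.
move=> tE; have t0 : (0 : R) < t%:~R.
  have : 1 < Num.ceil weight_bound by rewrite ceil_gt_int weight_bound_gt1.
  by rewrite ltr0z tE subr_gt0.
have hint u : ((u 0 ord0)%:~R < weight_bound) = (u 0 ord0 <= t).
  by rewrite -ceil_gt_int tE; move: (Num.ceil _) => c; apply/idP/idP; lia.
apply/seteqP; split => u.
  move=> /(dilate_Delta_conic (ltW t0)) [cu]; rewrite mxE ler_int -hint => wu.
  exact/index_setP.
move=> /index_setP[cu]; rewrite hint => wu; apply: conic_dilate => //.
by rewrite mxE ler_int.
Qed.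

End IndexSet.

(** * The Frobenius matrix *)

Section Series.
Variables (A : comNzRingType) (n : nat).
Implicit Types (J : seq (multinom n.+1)) (th : nat -> A) (al : multinom n.+1 -> A).
Implicit Types (P Q : mpoly n.+1 A) (r : multinom n.+1).

(** Stated over any ring A: the same series is needed over R, where tau acts, and over V, where
    valuations are estimated. *)
Definition theta_factor th al D (j : multinom n.+1) : mpoly n.+1 A :=
  \sum_(m < D.+1) th m *: (al j *: mpolyX A j) ^+ m.

Definition theta_series J th al D : mpoly n.+1 A :=
  \prod_(j <- J) theta_factor th al D j.

Lemma theta_factorE th al D j :
  theta_factor th al D j =
  \sum_(m < D.+1) (th m * al j ^+ m) *: mpolyX A (mnm_muln j m).
Proof. by apply: eq_bigr => m _; rewrite exprZn scalerA mpolyXn. Qed.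

Lemma mcoeff_factor th al D j r : mcoeff r (theta_factor th al D j) =
  \sum_(m < D.+1) th m * al j ^+ m * (mnm_muln j m == r)%:R.
Proof.
rewrite theta_factorE raddf_sum; apply: eq_bigr => m _ /=.
by rewrite mcoeffZ mcoeffX.
Qed.

Lemma msupp_factor th al D j r : r \in msupp (theta_factor th al D j) ->
  exists2 m, (m <= D)%N & r = mnm_muln j m.
Proof.
rewrite theta_factorE => /msupp_sum_le /flattenP[t /mapP[m]].
rewrite filter_predT => _ -> /msuppZ_le /mem_msuppXP <-.
by exists m => //; rewrite -ltnS.
Qed.

Lemma theta_series_ext J th th' al al' D : th =1 th' -> {in J, al =1 al'} ->
  theta_series J th al D = theta_series J th' al' D.
Proof.
move=> ht ha; apply: eq_big_seq => j jJ; apply: eq_bigr => m _.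
by rewrite ht ha.
Qed.

(** Equality modulo X_0^(d+1). *)
Definition agree (d : nat) P Q :=
  forall r, (r ord0 <= d)%N -> mcoeff r P = mcoeff r Q.

Lemma agreeM d P P' Q Q' : agree d P P' -> agree d Q Q' -> agree d (P * Q) (P' * Q').
Proof.
move=> hP hQ r rd; rewrite !mcoeffM; apply: eq_bigr => -[k1 k2] /= /eqP rE.
have /mnmP/(_ ord0) := rE; rewrite mnmDE => e0.
by rewrite hP ?hQ //; apply: leq_trans rd; rewrite e0 ?leq_addl ?leq_addr.
Qed.

(** The m-th term of each factor has degree m in X_0. This allows one truncation D for all matrix
    entries, whereas [Fcoef] truncates each at its own r_0. *)
Lemma theta_series_stable J th al d D : (forall j, j \in J -> j ord0 = 1%N) ->
  (d <= D)%N -> agree d (theta_series J th al D) (theta_series J th al d).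
Proof.
move=> hJ dD; rewrite /theta_series; elim: J hJ => [|j J IH] hJ.
  by rewrite !big_nil.
rewrite !big_cons; apply: agreeM; last first.
  by apply: IH => i iJ; apply: hJ; rewrite inE iJ orbT.
move=> r rd; rewrite !mcoeff_factor.
rewrite [RHS](big_ord_widen D.+1 (fun m => th m * al j ^+ m * (mnm_muln j m == r)%:R)) //.
rewrite [RHS]big_mkcond /=; apply: eq_bigr => m _; rewrite ltnS; case: leqP => // dm.
case: eqP => [re|_]; last by rewrite mulr0.
by move: rd; rewrite -re mulmnE hJ ?mem_head // mul1n leqNgt dm.
Qed.

End Series.

Lemma theta_series_map (A A' : comNzRingType) (g : {rmorphism A -> A'}) n
    (J : seq (multinom n.+1)) th al D :
  map_mpoly g (theta_series J th al D) = theta_series J (g \o th) (g \o al) D.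
Proof.
rewrite rmorph_prod; apply: eq_bigr => j _; rewrite rmorph_sum; apply: eq_bigr => m _ /=.
by rewrite map_mpolyZ rmorphXn /= map_mpolyZ map_mpolyX.
Qed.

Lemma meval_theta_series (V : fieldType) n (J : seq (multinom n.+1)) th (al : _ -> V) D x :
  meval x (theta_series J th al D) =
  \prod_(j <- J) \sum_(m < D.+1) th m * (al j * \prod_i x i ^+ j i) ^+ m.
Proof.
rewrite rmorph_prod; apply: eq_bigr => j _ /=; rewrite rmorph_sum; apply: eq_bigr => m _ /=.
by rewrite mevalZ rmorphXn /= mevalZ mevalX.
Qed.

Section SeriesGrowth.
Variables (R : realType) (V : valuedField R) (n : nat) (c : R).
Implicit Types (J : seq (multinom n.+1)) (P Q : mpoly n.+1 V).

Definition mdecay P := forall r : multinom n.+1, vge ((r ord0)%:R * c) (mcoeff r P).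

Lemma mdecayM P Q : mdecay P -> mdecay Q -> mdecay (P * Q).
Proof.
move=> hP hQ r; rewrite mcoeffM; apply: vge_sum => -[k1 k2] /= /eqP rE.
by have /mnmP/(_ ord0) := rE; rewrite mnmDE => ->; rewrite natrD mulrDl vgeM.
Qed.

Lemma theta_series_decay J th al D : (forall j, j \in J -> j ord0 = 1%N) ->
  (forall m, vge (m%:R * c) (th m)) -> (forall j, vge 0 (al j)) ->
  mdecay (theta_series J th al D).
Proof.
move=> hJ hth hal; rewrite /theta_series; elim: J hJ => [|j J IH] hJ.
  rewrite big_nil => r; rewrite mcoeff1; case: eqP => [->|_]; last exact: vge0.
  by rewrite mnm0E mul0r vge1.
rewrite big_cons; apply: mdecayM; last first.
  by apply: IH => i iJ; apply: hJ; rewrite inE iJ orbT.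
move=> r; rewrite mcoeff_factor; apply: vge_sum => m _.
case: eqP => [<-|_]; last by rewrite mulr0 vge0.
by rewrite mulr1 mulmnE hJ ?mem_head // mul1n vgeMr // vgeX0.
Qed.

Lemma theta_series_graded (C : multinom n.+1 -> Prop) J th (al : _ -> V) D :
  C (@mnm0 _) -> (forall r s, C r -> C s -> C (mnm_add r s)) ->
  (forall r e, C r -> C (mnm_muln r e)) ->
  (forall j, j \in J -> j ord0 = 1%N /\ C j) ->
  graded C (D * size J) (theta_series J th al D).
Proof.
move=> C0 CD CM hJ; rewrite /theta_series; elim: J hJ => [|j J IH] hJ.
  by rewrite big_nil => r; rewrite -mpolyC1 msupp1 inE => /eqP ->; rewrite mnm0E.
have {}IH : graded C (D * size J) (\prod_(j <- J) theta_factor th al D j).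
  by apply: IH => i iJ; apply: hJ; rewrite inE iJ orbT.
rewrite big_cons => r /msuppM_le /allpairsP[[r1 r2] /= [h1 h2 ->]].
have [m mD ->] := msupp_factor h1; have [C2 D2] := IH _ h2.
have [j1 Cj] := hJ j (mem_head _ _).
split; first by apply: CD => //; exact: CM.
by rewrite mnmDE mulmnE j1 mul1n mulnS leq_add.
Qed.

End SeriesGrowth.

Section X0mul.
Variables (F : fieldType) (n : nat).
Implicit Types (f : mpoly n F) (m : multinom n).

Definition cons1 m : multinom n.+1 :=
  Multinom [tuple if unlift ord0 i is Some j then m j else 1%N | i < n.+1].

Lemma cons1_head m : cons1 m ord0 = 1%N.
Proof. by rewrite mnmE unlift_none. Qed.

Lemma cons1_tail m i : cons1 m (lift ord0 i) = m i.
Proof. by rewrite mnmE liftK. Qed.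

Lemma X0_mulE f :
  X0_mul f = \sum_(m <- msupp f) mcoeff m f *: mpolyX F (cons1 m).
Proof.
rewrite /X0_mul comp_mpolyEX mulr_sumr; apply: eq_bigr => m _.
rewrite -scalerAr; congr (_ *: _); rewrite comp_mpolyX.
rewrite [RHS]mpolyXE_id big_ord_recl cons1_head expr1 ; congr (_ * _).
by apply: eq_bigr => i _; rewrite tnth_mktuple cons1_tail.
Qed.

Lemma msupp_X0_mul f j : j \in msupp (X0_mul f) ->
  exists2 m, m \in msupp f & j = cons1 m.
Proof.
rewrite X0_mulE => /msupp_sum_le /flattenP[t /mapP[m]].
rewrite filter_predT => hm -> /msuppZ_le /mem_msuppXP <-.
by exists m.
Qed.

Lemma msupp_X0_head f j : j \in msupp (X0_mul f) -> j ord0 = 1%N.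
Proof. by move=> /msupp_X0_mul[m _ ->]; exact: cons1_head. Qed.

Lemma cons1_toR (R : realType) m :
  mnm_toR R (cons1 m) = row_mx 1%:M (mnm_toR R m) :> 'rV[R]_(1 + n).
Proof.
apply/rowP => i; case: (unliftP ord0 i) => [j ->|->].
  rewrite (_ : lift ord0 j = rshift 1 j); last exact: val_inj.
  rewrite row_mx1_tail !mxE.
  by rewrite -[rshift 1 j](_ : lift ord0 j = _ :> 'I_n.+1) ?cons1_tail //; exact: val_inj.
by rewrite row_mx1_head mxE cons1_head.
Qed.

Lemma msupp_X0_cone (R : realType) (delta : set 'rV[R]_n) f j :
  delta1 f `<=` delta -> j \in msupp (X0_mul f) -> cone_mnm delta j.
Proof.
move=> hd /msupp_X0_mul[m mf ->]; rewrite /cone_mnm cons1_toR.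
apply/conic_row/hd; exists 1%N, (fun=> mnm_toR R m), (fun=> 1); split=> //.
- by move=> _; exists m.
- by rewrite big_ord1.
- by rewrite big_ord1 scale1r.
Qed.

Variables (L : fieldType) (iota : {rmorphism F -> L}).

Lemma meval_map_sum k (I : Type) (s : seq I) (c : I -> F) (r : I -> multinom k) (x : 'I_k -> L) :
  meval x (map_mpoly iota (\sum_(i <- s) c i *: mpolyX F (r i))) =
  \sum_(i <- s) iota (c i) * \prod_l x l ^+ r i l.
Proof.
have -> : map_mpoly iota (\sum_(i <- s) c i *: mpolyX F (r i)) =
    \sum_(i <- s) iota (c i) *: mpolyX L (r i).
  rewrite (raddf_sum (map_mpoly iota)); apply: eq_bigr => i _ /=.
  by rewrite map_mpolyZ map_mpolyX.
rewrite (raddf_sum (meval x)); apply: eq_bigr => i _ /=.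
by rewrite mevalZ mevalX.
Qed.

Lemma meval_X0_mul f (x : 'I_n.+1 -> L) :
  \sum_(j <- msupp (X0_mul f)) iota (mcoeff j (X0_mul f)) * \prod_l x l ^+ j l =
  x ord0 * meval (fun i => x (lift ord0 i)) (map_mpoly iota f).
Proof.
rewrite -meval_map_sum -mpolyE X0_mulE meval_map_sum [f in RHS]mpolyE meval_map_sum mulr_sumr.
apply: eq_bigr => m _; rewrite big_ord_recl cons1_head expr1 mulrCA.
congr (_ * (_ * _)); apply: eq_bigr => i _.
by rewrite cons1_tail.
Qed.

End X0mul.

(** * Truncation of matrices with weighted growth *)

Section Truncation.
Variables (R : realType) (V : valuedField R) (W W' : nat) (h : 'I_W -> 'I_W').
Variables (w : 'I_W' -> R) (c k N : R).
Hypotheses (h_inj : injective h) (c0 : 0 <= c) (k1 : 1 <= k) (w0 : forall u, 0 <= w u).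
Hypothesis w_out : forall u, (forall i, h i != u) -> N <= w u * (k - 1) * c.
Implicit Types (M : 'M[V]_W').

(* Conjugation by the diagonal matrix of the weights turns these conditions into
   ord >= 0 and ord >= N. *)
Definition mx_ok M := forall u v, vge ((w u - w v) * c) (M u v).
Definition mx_small M := forall u v, vge (N + (w u - w v) * c) (M u v).

Lemma mx_okM M M' : mx_ok M -> mx_ok M' -> mx_ok (M *m M').
Proof.
move=> hM hM' u v; rewrite mxE; apply: vge_sum => i _.
have -> : (w u - w v) * c = (w u - w i) * c + (w i - w v) * c by ring.
exact: vgeM.
Qed.

Lemma mx_smallMl M M' : mx_ok M -> mx_small M' -> mx_small (M *m M').
Proof.
move=> hM hM' u v; rewrite mxE; apply: vge_sum => i _.
have -> : N + (w u - w v) * c = (w u - w i) * c + (N + (w i - w v) * c) by ring.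
exact: vgeM.
Qed.

Lemma mx_smallMr M M' : mx_small M -> mx_ok M' -> mx_small (M *m M').
Proof.
move=> hM hM' u v; rewrite mxE; apply: vge_sum => i _.
have -> : N + (w u - w v) * c = (N + (w u - w i) * c) + (w i - w v) * c by ring.
exact: vgeM.
Qed.

Definition mx_emb : 'M[V]_(W, W') := \matrix_(i, u) (h i == u)%:R.

(** Only rows outside the image of h are erased, since the row weight is what makes an entry small;
    in the trace of a product the block on the image alone remains. *)
Definition mx_trunc M : 'M[V]_W' := mx_emb^T *m (mx_emb *m M).

Lemma mx_embE m (M : 'M[V]_(W', m)) i v : (mx_emb *m M) i v = M (h i) v.
Proof.
rewrite mxE (bigD1 (h i)) //= big1 => [|u uh]; first by rewrite mxE eqxx mul1r addr0.
by rewrite mxE eq_sym (negbTE uh) mul0r.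
Qed.

Lemma mx_truncE M u v : mx_trunc M u v = if [exists i, h i == u] then M u v else 0.
Proof.
rewrite mxE; case: ifP => [/existsP[i /eqP hi]|/negbT/existsPn hi].
  rewrite (bigD1 i) //= big1 => [|j ji].
    by rewrite !mxE hi eqxx mul1r addr0 -hi -mx_embE mxE.
  rewrite !mxE; case: eqP => [hj|_]; last by rewrite mul0r.
  by move: ji; rewrite (h_inj (etrans hj (esym hi))) eqxx.
by rewrite big1 // => i _; rewrite !mxE (negbTE (hi i)) mul0r.
Qed.

Definition mx_restrict M : 'M[V]_W := \matrix_(i, j) M (h i) (h j).

Lemma mx_restrictE M : mx_restrict M = mx_emb *m M *m mx_emb^T.
Proof.
apply/matrixP => i j; rewrite !mxE (bigD1 (h j)) //= mx_embE !mxE eqxx mulr1.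
rewrite big1 ?addr0 // => u uh.
by rewrite !mxE [h j == u]eq_sym (negbTE uh) mulr0.
Qed.

Lemma prod_trunc (s : seq 'M[V]_W') :
  (\prod_(M <- s) mx_trunc M) *m mx_emb^T =
  mx_emb^T *m \prod_(M <- s) mx_restrict M.
Proof.
elim: s => [|M s IH]; first by rewrite !big_nil mul1mx mulmx1.
have mulE k' (X Y : 'M[V]_k') : X * Y = X *m Y by [].
rewrite !big_cons !mulE.
by rewrite -mulmxA IH mx_restrictE /mx_trunc !mulmxA.
Qed.

Lemma trace_prod_trunc (s : seq 'M[V]_W') : (0 < size s)%N ->
  \tr (\prod_(M <- s) mx_trunc M) = \tr (\prod_(M <- s) mx_restrict M).
Proof.
case: s => [//|M s] _.
have mulE k' (X Y : 'M[V]_k') : X * Y = X *m Y by [].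
rewrite !big_cons !mulE.
rewrite /mx_trunc -mulmxA mxtrace_mulC -!mulmxA prod_trunc mx_restrictE.
by rewrite !mulmxA.
Qed.

(** The bound splits as (w u - w v) c + (k - 1) w u c, whose second part is at least N on the erased
    rows. The difference of products telescopes through M A - M' B = M (A - B) + (M - M') B, and on
    the diagonal the conjugation weight is 0. *)
Lemma trace_truncation (s : seq 'M[V]_W') : (0 < size s)%N ->
  (forall M, M \in s -> forall u v, vge ((k * w u - w v) * c) (M u v)) ->
  vge N (\tr (\prod_(M <- s) M) - \tr (\prod_(M <- s) mx_restrict M)).
Proof.
move=> s0 hs; rewrite -trace_prod_trunc //.
have kw u : w u <= k * w u by rewrite ler_peMl.
have okM M : M \in s -> mx_ok M.
  move=> Ms u v; apply: vge_le (hs M Ms u v); rewrite ler_wpM2r // lerB //.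
have okT M : M \in s -> mx_ok (mx_trunc M).
  by move=> Ms u v; rewrite mx_truncE; case: ifP => _; [exact: okM|exact: vge0].
have smT M : M \in s -> mx_small (M - mx_trunc M).
  move=> Ms u v.
  have -> : (M - mx_trunc M) u v = M u v - mx_trunc M u v by rewrite mxE [X in _ + X]mxE.
  rewrite mx_truncE; case: ifP => [_|/negbT/existsPn hu]; first by rewrite subrr vge0.
  rewrite subr0; apply: vge_le (hs M Ms u v).
  by have := w_out hu; lra.
have : mx_small (\prod_(M <- s) M - \prod_(M <- s) mx_trunc M).
  suff [_ [_]] : mx_ok (\prod_(M <- s) M) /\ mx_ok (\prod_(M <- s) mx_trunc M) /\
    mx_small (\prod_(M <- s) M - \prod_(M <- s) mx_trunc M) by [].
  have ok1 : mx_ok 1%:M.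
    move=> u v; rewrite mxE; case: eqP => [->|_]; last exact: vge0.
    by rewrite subrr mul0r vge1.
  elim: s {s0 hs} okM okT smT => [|M s IH] okM okT smT.
    rewrite !big_nil; split => //; split => // u v.
    by rewrite subrr mxE vge0.
  have [|||o1 [o2 o3]] := IH.
  - by move=> M' h'; apply: okM; rewrite inE h' orbT.
  - by move=> M' h'; apply: okT; rewrite inE h' orbT.
  - by move=> M' h'; apply: smT; rewrite inE h' orbT.
  have oM := okM M (mem_head _ _); have oT := okT M (mem_head _ _).
  have sM := smT M (mem_head _ _).
  rewrite !big_cons; split; first exact: mx_okM.
  split; first exact: mx_okM.
  set A := \prod_(M <- s) M in o1 o3 *; set B := \prod_(M <- s) _ in o2 o3 *.
  have -> : M * A - mx_trunc M * B = M *m (A - B) + (M - mx_trunc M) *m B.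
    by rewrite mulmxBr mulmxBl addrA subrK.
  move=> u v; rewrite mxE; apply: vgeD; first exact: mx_smallMl.
  exact: mx_smallMr.
move=> hsm; rewrite -raddfB /= /mxtrace; apply: vge_sum => u _.
by have := hsm u u; rewrite subrr mul0r addr0.
Qed.

End Truncation.

Lemma vge_prodB (R : realType) (V : valuedField R) (N : R) (I : Type) (s : seq I)
    (x y : I -> V) : (forall i, vge 0 (x i)) -> (forall i, vge 0 (y i)) ->
  (forall i, vge N (x i - y i)) ->
  vge N (\prod_(i <- s) x i - \prod_(i <- s) y i).
Proof.
move=> x0 y0 h; elim: s => [|i s IH]; first by rewrite !big_nil subrr vge0.
rewrite !big_cons; set X := \prod_(_ <- _) x _; set Y := \prod_(_ <- _) y _.
have -> : x i * X - y i * Y = x i * (X - Y) + (x i - y i) * Y by ring.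
by apply: vgeD; [exact: vgeMl|apply: vgeMr => //; exact: vge_prod0].
Qed.

(** * The character sum over the torus and its polynomial approximation *)

Section CharSum.
Variables (R : realType) (p : nat) (V : valuedField R) (pi : V).
Hypotheses (pp : prime p) (op : ord (p%:R : V) = 1%:E) (cV : vcomplete V).
Hypothesis hpi : pi ^+ p.-1 = - p%:R.
Variables (L : finFieldType) (b : nat) (omega : L -> V).
Hypotheses (b0 : (0 < b)%N) (hL : #|L| = (p ^ b)%N).
Hypotheses (om0 : omega 0 = 0) (omM : {morph omega : x y / x * y}).
Hypotheses (omQ : forall x, omega x ^+ (p ^ b) = omega x).
Hypotheses (omN0 : forall x, x != 0 -> omega x != 0).
Hypothesis omD : forall x y, vpos (omega (x + y) - (omega x + omega y)).
Variables (n : nat) (F : fieldType) (f : mpoly n F) (iota : {rmorphism F -> L}).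

Local Notation Psi := (Psi p pi b omega).
Local Notation Q := (p ^ b)%N.

Let x0_inv (x : {ffun 'I_n.+1 -> L}) : L * {ffun 'I_n -> L} :=
  (x ord0, [ffun i => x (lift ord0 i)]).
Let x0_cons (y : L * {ffun 'I_n -> L}) : {ffun 'I_n.+1 -> L} :=
  [ffun i => if unlift ord0 i is Some j then y.2 j else y.1].

Lemma sum_torus_cons (G : {ffun 'I_n.+1 -> L} -> V) :
  \sum_(x : {ffun 'I_n.+1 -> L} | [forall i, x i != 0]) G x =
  \sum_(y : {ffun 'I_n -> L} | [forall i, y i != 0]) \sum_(z | z != 0) G (x0_cons (z, y)).
Proof.
rewrite [RHS]exchange_big pair_big /=.
rewrite (reindex x0_cons) /=; last first.
  exists x0_inv => x _; last first.
    apply/ffunP => i; rewrite !ffunE.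
    by case: unliftP => [j ->|->] //=; rewrite ffunE.
  case: x => z y; rewrite /x0_inv ffunE unlift_none; congr pair.
  by apply/ffunP => i; rewrite !ffunE liftK.
apply: eq_big => [[z y]|[z y] _] //=; apply/forallP/andP => /= [h|[hz /forallP hy] i].
  split; first by have := h ord0; rewrite ffunE unlift_none.
  by apply/forallP => i; have := h (lift ord0 i); rewrite ffunE liftK.
by rewrite ffunE; case: unliftP.
Qed.

(** Summing over all x_0 would give Q for each zero of f; leaving out x_0 = 0 costs 1 at each of the
    (Q - 1)^n points. *)
Lemma torus_char_sum :
  \sum_(x : {ffun 'I_n.+1 -> L} | [forall i, x i != 0])
    Psi (x ord0 * meval (fun i => x (lift ord0 i)) (map_mpoly iota f)) =
  Q%:R * (torus_count iota f)%:R - (Q%:R - 1) ^+ n.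
Proof.
rewrite sum_torus_cons.
rewrite (eq_bigr (fun y : {ffun 'I_n -> L} =>
    Q%:R * (meval y (map_mpoly iota f) == 0)%:R - 1)); last first.
  move=> y _; set c := meval y (map_mpoly iota f).
  have -> : \sum_(z | z != 0) Psi (x0_cons (z, y) ord0 *
      meval (fun i => x0_cons (z, y) (lift ord0 i)) (map_mpoly iota f)) =
      \sum_(z | z != 0) Psi (z * c).
    apply: eq_bigr => z _.
    have e1 : x0_cons (z, y) ord0 = z by rewrite ffunE unlift_none.
    have e2 : meval (fun i => x0_cons (z, y) (lift ord0 i)) (map_mpoly iota f) = c.
      by apply: meval_eq => i; rewrite ffunE liftK.
    by rewrite e1 e2.
  have := sum_Psi pp op cV hpi b0 hL om0 omM omQ omN0 omD c.
  rewrite (bigD1 0) //= mul0r (Psi0 pp op cV hpi b0 om0 omM omQ omN0 omD) => h.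
  rewrite -[LHS](addKr 1) h addrC; congr (_ - 1).
  by case: eqP; rewrite ?mulr1 ?mulr0.
rewrite big_split /= -mulr_sumr; congr (_ * _ + _).
  rewrite /torus_count -sum1_card natr_sum big_mkcond [RHS]big_mkcond /=.
  apply: eq_bigr => y _; rewrite /in_mem /mem /= /in_set /mkset asboolb.
  by case: [forall i, _] => //=; case: eqP.
rewrite sumrN; congr (- _).
(* The points of the torus are counted by the case H = 1 of [sum_torus]. *)
have := @sum_torus V n L omega Q.-1 (Q%:R - 1) 1 (sum_omegaX pp b0 hL omM omQ omN0 omD).
rewrite -mpolyC1 msupp1 big_cons big_nil mcoeffC eqxx mulr1 addr0.
have -> : [forall i, (Q.-1 %| (@mnm0 n) i)%N] by apply/forallP => i; rewrite mnm0E dvdn0.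
rewrite mulr1 => <-; apply: eq_bigr => x _.
by rewrite mevalC.
Qed.

Variables (T : F -> V).
Hypothesis omT : forall c, omega (iota c) = T c.

Definition teich_series D e : mpoly n.+1 V :=
  theta_series (msupp (X0_mul f)) (theta p pi) (fun j => T (mcoeff j (X0_mul f)) ^+ e) D.

(** Entry i carries the coefficients twisted by tau^(-(i+1)), which is the power p^(b-(i+1)) on
    Teichmuller points; the shift by 1 is the tau^(-1) in the entries of the matrix. *)
Definition frobenius_list D : seq (mpoly n.+1 V) :=
  [seq teich_series D (p ^ (b - i.+1)) | i <- seq.iota 0 b].

(** At position i the coefficients and the variables carry the same power p^(b-i-1), so each factor
    is a truncated theta at a Frobenius power of the lifted monomial; reversing the order of i gives
    the product defining [Psi]. *)
Lemma frobenius_list_approx D (N : R) (x : {ffun 'I_n.+1 -> L}) :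
  N <= D.+1%:R * kappa R p ->
  vge N (\prod_(i < size (frobenius_list D))
      meval (fun j => omega (x j) ^+ (p ^ (size (frobenius_list D) - i.+1)))
        (nth 0 (frobenius_list D) i) -
    Psi (x ord0 * meval (fun i => x (lift ord0 i)) (map_mpoly iota f))).
Proof.
move=> hD; have sz : size (frobenius_list D) = b by rewrite size_map size_iota.
rewrite sz -meval_X0_mul (Psi_sum pp op cV hpi b0 hL om0 omM omQ omN0 omD).
set J := msupp (X0_mul f).
pose z (j : multinom n.+1) := omega (iota (mcoeff j (X0_mul f)) * \prod_l x l ^+ j l).
pose tD y : V := \sum_(m < D.+1) theta p pi m * y ^+ m.
have z0 j : vge 0 (z j) by exact: (om_int pp b0 omQ).
have -> : \prod_(i < b) meval (fun j => omega (x j) ^+ (p ^ (b - i.+1))) (nth 0 (frobenius_list D) i) =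
    \prod_(j <- J) \prod_(i < b) tD (z j ^+ (p ^ i)).
  rewrite [RHS]exchange_big /= [RHS](reindex_inj rev_ord_inj) /=.
  apply: eq_bigr => i _; rewrite (nth_map 0%N) ?size_iota // nth_iota // add0n.
  rewrite meval_theta_series; apply: eq_bigr => j _; apply: eq_bigr => m _.
  congr (_ * _ ^+ _); rewrite /z omM omT exprMn; congr (_ * _).
  rewrite (om_prod omM omN0) -prodrXl; apply: eq_bigr => l _.
  by rewrite (omX omM omN0) -!exprM mulnC.
have tV0 y : vge 0 y -> vge 0 (theta_val p pi y) by exact: (theta_val_vge0 pp op cV hpi).
have tD0 y : vge 0 y -> vge 0 (tD y).
  move=> y0; apply: vge_sum => m _; rewrite vgeMl ?vgeX0 //.
  apply: vge_le (theta_decay pp op hpi m).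
  by rewrite mulr_ge0 // ltW // kappa_gt0.
have zX j i : vge 0 (z j ^+ (p ^ i)) by exact: vgeX0.
apply: vge_prodB => j.
- by apply: vge_prod0 => i _; exact: (tD0 _ (zX j i)).
- by apply: vge_prod0 => i _; exact: (tV0 _ (zX j i)).
apply: vge_prodB => i; [exact: (tD0 _ (zX j i))|exact: (tV0 _ (zX j i))|].
by rewrite vgeBC; apply: (vge_le hD); exact: (theta_val_psum pp op cV hpi D.+1 (zX j i)).
Qed.

Variable delta : set 'rV[R]_n.
Hypotheses (d1 : delta1 f `<=` delta) (d2 : delta `<=` delta2 f).
Hypothesis Tint : forall c, vge 0 (T c).
Variables (N : nat) (W : nat) (idx : 'I_W -> multinom n.+1).
Hypothesis idx_inj : injective idx.
Hypothesis idx_im : forall w, (exists i, idx i = w) <->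
  cone_mnm delta w /\ (w ord0)%:R < weight_bound R p N.

Lemma teich_series_graded D e :
  graded (cone_mnm delta) (D * size (msupp (X0_mul f))) (teich_series D e).
Proof.
apply: theta_series_graded.
- exact: cone_mnm0.
- by move=> r s; exact: cone_mnmD.
- by move=> r s; exact: cone_mnmM.
- by move=> j hj; split; [exact: msupp_X0_head hj|exact: msupp_X0_cone hj].
Qed.

Lemma teich_series_decay D e : mdecay (kappa R p) (teich_series D e).
Proof.
apply: theta_series_decay.
- by move=> j hj; exact: msupp_X0_head hj.
- exact: (theta_decay pp op hpi).
- by move=> j; exact: vgeX0.
Qed.

Lemma dwork_congruence D :
  N%:R <= D.+1%:R * kappa R p -> weight_bound R p N <= D%:R ->
  vge N%:R ((Q%:R - 1) ^+ n.+1 *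
      \tr (\prod_(P <- frobenius_list D) cfmx p idx P) -
    (Q%:R * (torus_count iota f)%:R - (Q%:R - 1) ^+ n)).
Proof.
move=> hD hB; set s := frobenius_list D.
have sz : size s = b by rewrite size_map size_iota.
have p1 := prime_gt1 pp.
(* The factor [size] bounds the degree of the series in X_0; the extra 1 ensures E >= D, so that the
   large index set contains the given one. *)
pose E := (D * (size (msupp (X0_mul f))).+1)%N.
have gr P : P \in s -> graded (cone_mnm delta) E P.
  move=> /mapP[i _ ->] r hr; have [Cr rD] := teich_series_graded hr.
  by split => //; apply: leq_trans rD _; rewrite leq_mul2l leqnSn orbT.
have [W' [idx' [inj' im']]] := finite_enumeration (cone_mnm_finite d2 E).
have /choice[h hh] : forall i, exists i', idx' i' = idx i.
  move=> i; apply/im'; have [Ci iB] := (idx_im (idx i)).1 (ex_intro _ i erefl).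
  split => //; rewrite -(ler_nat R); apply: le_trans (ltW iB) _.
  by apply: le_trans hB _; rewrite ler_nat /E mulnS leq_addr.
have h_inj : injective h by move=> i j hij; apply: idx_inj; rewrite -!hh hij.
have k0 : 0 < kappa R p := kappa_gt0 R pp.
have tF := trace_formula p1 (cone_mnm0 delta) (@cone_mnmD _ _ delta) (@cone_mnmM _ _ delta)
  (@cone_mnmV _ _ delta).
have {tF} tF := tF V E W' idx' inj' im' L omega (Q%:R - 1) s.
rewrite sz in tF; have {tF} tF := tF b0 gr (sum_omegaX pp b0 hL omM omQ omN0 omD).
have trT : vge N%:R (\tr (\prod_(P <- s) cfmx p idx' P) - \tr (\prod_(P <- s) cfmx p idx P)).
  rewrite -(big_map (cfmx p idx') xpredT id).
  have -> : \prod_(P <- s) cfmx p idx P =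
      \prod_(M <- [seq cfmx p idx' P | P <- s]) mx_restrict h M.
    rewrite big_map; apply: eq_bigr => P _; apply/matrixP => i j.
    by rewrite !mxE !hh.
  apply: (@trace_truncation _ _ _ _ h (fun u => (idx' u ord0)%:R) (kappa R p) p%:R) => //.
  - exact: ltW.
  - by rewrite ler1n ltnW.
  - move=> u hu.
    have uB : weight_bound R p N <= (idx' u ord0)%:R.
      rewrite leNgt; apply/negP => hlt.
      have [Cu _] := (im' (idx' u)).1 (ex_intro _ u erefl).
      have [i hi] := (idx_im (idx' u)).2 (conj Cu hlt).
      by have := hu i; rewrite (inj' _ _ (etrans (hh i) hi)) eqxx.
    have q0 : 0 < (p%:R - 1 : R) by rewrite subr_gt0 ltr1n.
    have P0 : 0 < (p%:R : R) by rewrite ltr0n ltnW.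
    have -> : N%:R = weight_bound R p N * (p%:R - 1) * kappa R p.
      have pE : p.-1%:R = p%:R - 1 :> R by rewrite -[p in RHS]prednK ?(ltnW p1) // -natr1 addrK.
      by rewrite /weight_bound /kappa pE; field; rewrite !lt0r_neq0.
    by rewrite ler_pM2r // ler_pM2r.
  - by rewrite size_map sz.
  - move=> _ /mapP[P Ps ->] u v; rewrite mxE /cfd; case: ifP => hl; last exact: vge0.
    have {Ps} hP : mdecay (kappa R p) P.
      by move: Ps => /mapP[i _ ->]; exact: teich_series_decay.
    have := hP (mnm_sub (mnm_muln (idx' u) p) (idx' v)).
    have := mnm_lepP hl ord0; rewrite mulmnE mnmBE mulmnE => huv.
    by rewrite natrB // natrM [_ * p%:R]mulrC.
have c0 : vge 0 ((Q%:R - 1 : V) ^+ n.+1) by rewrite vgeX0 // vgeB ?vge_nat ?vge1.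
apply: (vge_trans (y := (Q%:R - 1) ^+ n.+1 * \tr (\prod_(P <- s) cfmx p idx' P))).
  by rewrite -mulrBr vgeMl // vgeBC.
rewrite tF -torus_char_sum -sumrB; apply: vge_sum => x _.
by have := frobenius_list_approx x hD; rewrite -/s sz.
Qed.

End CharSum.

Lemma prodr_periodic (S : pzRingType) (B : nat -> S) (a k : nat) :
  (forall i, B (i + a)%N = B i) ->
  (\prod_(i < a) B i) ^+ k = \prod_(i < a * k) B i.
Proof.
move=> hB; elim: k => [|k IH]; first by rewrite expr0 muln0 big_ord0.
rewrite exprSr IH mulnS addnC big_split_ord /=; congr (_ * _).
apply: eq_bigr => i _; elim: k {IH} => [|k IH]; first by rewrite muln0 add0n.
by rewrite mulnS -addnA addnC hB.
Qed.

Lemma map_mx_prod (S S' : pzRingType) (g : {rmorphism S -> S'}) (W : nat)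
    (I : Type) (s : seq I) (B : I -> 'M[S]_W) :
  map_mx g (\prod_(i <- s) B i) = \prod_(i <- s) map_mx g (B i).
Proof.
elim: s => [|i s IH]; first by rewrite !big_nil map_mx1.
by rewrite !big_cons -IH; exact: map_mxM.
Qed.

Lemma map_mx_exp (S S' : pzRingType) (g : {rmorphism S -> S'}) (W : nat)
    (B : 'M[S]_W) k : map_mx g (B ^+ k) = map_mx g B ^+ k.
Proof.
elim: k => [|k IH]; first by rewrite !expr0 map_mx1.
by rewrite !exprS -IH; exact: map_mxM.
Qed.

(** * The Frobenius matrix over R and its reduction modulo p^N *)

Section Dwork.
Variables (R : realType) (p a n : nat) (pp : prime p) (ha : (0 < a)%N)
  (Omega : valuedField R) (hOmega : is_completed_alg_closure_Qp Omega p)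
  (pi : Omega) (hpi : pi ^+ p.-1 = - p%:R)
  (K : divringClosed Omega) (hK : is_unramified_ext a K)
  (F : finFieldType) (hF : #|F| = (p ^ a)%N)
  (red : {rmorphism subring_of (ring_of_integers K) -> F})
  (hred : is_residue_map red)
  (tau tauV : {rmorphism Rring K pi -> Rring K pi})
  (tauK : cancel tau tauV)
  (tau_id : forall x : Rring K pi, val x \in Zp_adjoin pi -> tau x = x)
  (tau_frob : is_frobenius_lift p tau)
  (f : mpoly.mpoly n F).

Let op : ord (p%:R : Omega) = 1%:E. Proof. by case: hOmega. Qed.
Let cV : vcomplete Omega. Proof. by case: hOmega. Qed.

Local Notation T := (teichmuller p red).
Local Notation J := (msupp (X0_mul f)).
Local Notation Rr := (Rring K pi).

Definition thetaR (m : nat) : Rr := Subring (Zpi_Rring K (theta_Zpi pp op hpi m)).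

Definition teichR (j : multinom n.+1) : Rr :=
  Subring (R0_Rring pi (teich_R0 pp ha op cV hK hF hred (mcoeff j (X0_mul f)))).

Definition seriesR (al : multinom n.+1 -> Rr) D : mpoly n.+1 Rr :=
  theta_series J thetaR al D.

Lemma tauV_thetaR m : tauV (thetaR m) = thetaR m.
Proof. by rewrite -{1}(@tau_id (thetaR m)) ?tauK //; exact: (theta_Zpi pp op hpi). Qed.

Lemma iter_tau_teichR i j : iter i tau (teichR j) = teichR j ^+ (p ^ i).
Proof.
elim: i => [|i IH]; first by rewrite expn0 expr1.
rewrite iterS IH rmorphXn /=.
rewrite (teich_frobenius pp ha op cV hK hF hred (c := mcoeff j (X0_mul f)) tau_frob) //.
by rewrite -exprM -expnS.
Qed.

Lemma teichR_fixed b j : (a %| b)%N -> teichR j ^+ (p ^ b) = teichR j.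
Proof.
move=> ab; apply: val_inj; rewrite rmorphXn /= -(divnK ab) mulnC fixed_mul //.
exact: (teich_fixed pp ha op cV hK hF hred).
Qed.

(** Since tau is the p-th power here and the p^b-th power is the identity, tau^(-i) is the power
    p^(b-i), with no negative exponent. *)
Lemma iter_tauV_teichR b i j : (a %| b)%N -> (i <= b)%N ->
  iter i tauV (teichR j) = teichR j ^+ (p ^ (b - i)).
Proof.
move=> ab ib.
have tX (g : {rmorphism Rr -> Rr}) k (x : Rr) m : iter k g (x ^+ m) = iter k g x ^+ m.
  by elim: k => //= k ->; rewrite rmorphXn.
have tK k : cancel (iter k tau) (iter k tauV).
  by elim: k => // k IH x; rewrite iterSr iterS tauK.
rewrite -{1}(teichR_fixed j ab) -{1}(subnK ib) expnD mulnC exprM -iter_tau_teichR.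
by rewrite -tX tK.
Qed.

Lemma tauV_series al D r :
  tauV (mcoeff r (seriesR al D)) = mcoeff r (seriesR (tauV \o al) D).
Proof.
rewrite -mcoeff_map_mpoly theta_series_map; congr (mcoeff _ _).
by apply: theta_series_ext => // m; exact: tauV_thetaR.
Qed.

Lemma iter_tauV_series i al D r :
  iter i tauV (mcoeff r (seriesR al D)) =
  mcoeff r (seriesR (fun j => iter i tauV (al j)) D).
Proof.
elim: i => [|i IH]; first by reflexivity.
by rewrite iterS IH tauV_series; reflexivity.
Qed.

Lemma val_seriesR al e D r : (forall j, al j = teichR j ^+ e) ->
  val (mcoeff r (seriesR al D)) = mcoeff r (teich_series p pi f T D e).
Proof.
move=> hal; rewrite -(mcoeff_map_mpoly (val : Rr -> Omega)) theta_series_map.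
congr (mcoeff _ _); apply: theta_series_ext => // j _.
have e1 : val (al j) = T (mcoeff j (X0_mul f)) ^+ e by rewrite hal rmorphXn.
exact: e1.
Qed.

Local Notation Fr := (FcoefR p K pi f T).

(** The coefficient in Omega is the image of one computed in R, so [insubd] returns that element and
    never its default. *)
Lemma FcoefRE (r : 'rV[int]_(1 + n)) : Fr r =
  if [forall i, 0 <= r 0 i] then mcoeff (to_mnm r) (seriesR teichR (absz (r 0 ord0)))
  else 0.
Proof.
apply: val_inj; rewrite /FcoefR /Fcoef; case: ifP => _; last first.
  by rewrite insubdK // rpred0.
have vE : val (mcoeff (to_mnm r) (seriesR teichR (absz (r 0 ord0)))) =
    mcoeff (to_mnm r) (theta_series J (theta p pi) (fun j => T (mcoeff j (X0_mul f))) (absz (r 0 ord0))).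
  rewrite (@val_seriesR _ 1) //.
set X := mcoeff _ _; have -> : X = val (mcoeff (to_mnm r) (seriesR teichR (absz (r 0 ord0)))).
  exact: esym vE.
by rewrite valKd.
Qed.

Lemma Fcoef_diff D (u v : 'rV[int]_(1 + n)) :
  (forall i, 0 <= u 0 i) -> (forall i, 0 <= v 0 i) ->
  (to_mnm u ord0 * p <= D)%N ->
  Fr (u *+ p - v) =
  if lem (to_mnm v) (mnm_muln (to_mnm u) p)
  then mcoeff (mnm_sub (mnm_muln (to_mnm u) p) (to_mnm v)) (seriesR teichR D) else 0.
Proof.
move=> u0 v0 hD; rewrite FcoefRE.
have rE i : (u *+ p - v) 0 i = (to_mnm u i * p)%N%:Z - (to_mnm v i)%:Z.
  rewrite !mxE !mnmE PoszM !gez0_abs //.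
  by rewrite mulmxnE -mulr_natr natz.
have -> : [forall i, 0 <= (u *+ p - v) 0 i] = lem (to_mnm v) (mnm_muln (to_mnm u) p).
  apply/forallP/mnm_lepP => h i; have := h i; rewrite ?rE mulmnE.
    by rewrite subr_ge0 lez_nat.
  by rewrite subr_ge0 lez_nat.
case: ifP => // hl.
have -> : to_mnm (u *+ p - v) = mnm_sub (mnm_muln (to_mnm u) p) (to_mnm v).
  apply/mnmP => i; rewrite mnmE mnmBE rE mulmnE.
  by have := mnm_lepP hl i; rewrite mulmnE => hi; rewrite subzn.
rewrite /seriesR; apply/esym.
have h0 : absz ((u *+ p - v)%R 0%R ord0) = (mnm_sub (mnm_muln (to_mnm u) p) (to_mnm v)) ord0.
  rewrite rE mnmBE mulmnE; have := mnm_lepP hl ord0; rewrite mulmnE => hi.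
  by rewrite subzn.
rewrite h0; apply: theta_series_stable => //.
- by move=> j hj; exact: msupp_X0_head hj.
- by rewrite mnmBE mulmnE; apply: leq_trans (leq_subr _ _) hD.
Qed.

Variables (W : nat) (u : 'I_W -> 'rV[int]_(1 + n)).
Hypothesis u_ge0 : forall i l, 0 <= u i 0 l.

Definition frob_mx : 'M[Rr]_W := \matrix_(i, j) tauV (Fr (u i *+ p - u j)).

Lemma frob_mx_iter i b D : (a %| b)%N -> (i < b)%N ->
  (forall k, (to_mnm (u k) ord0 * p <= D)%N) ->
  map_mx val (map_mx (iter i tauV) frob_mx) =
  cfmx p (fun k => to_mnm (u k)) (teich_series p pi f T D (p ^ (b - i.+1))).
Proof.
move=> ab ib hD; apply/matrixP => k l; rewrite !mxE (Fcoef_diff (D := D)) // /cfd.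
rewrite -iterSr; case: ifP => hl; last first.
  have -> : iter i.+1 tauV 0 = 0 by elim: i.+1 => //= m ->; exact: rmorph0.
  exact: rmorph0.
by rewrite iter_tauV_series; apply: val_seriesR => j; exact: iter_tauV_teichR.
Qed.

(** Periodicity is checked on the entries alone: tau^(-1) fixes the coefficients of theta, and
    tau^(-a) fixes Teichmuller points because their q-th power is themselves. *)
Lemma frob_mx_period i D : (forall k, (to_mnm (u k) ord0 * p <= D)%N) ->
  map_mx (iter (i + a) tauV) frob_mx = map_mx (iter i tauV) frob_mx.
Proof.
move=> hD; apply/matrixP => k l; rewrite !mxE iterD; congr (iter i tauV _).
rewrite (Fcoef_diff (D := D)) //; case: ifP => _; last first.
  have h0 : tauV 0 = 0 by exact: rmorph0.
  by rewrite h0; elim: a => //= m ->.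
have e : seriesR (fun j => iter a tauV (teichR j)) D = seriesR teichR D.
  apply: theta_series_ext => // j _.
  by rewrite (@iter_tauV_teichR a) // subnn expn0 expr1.
by rewrite -iterSr iterS iter_tauV_series e.
Qed.

Variables (N : nat) (hN : (0 < N)%N).
Local Notation I := (RpN_ideal K pp hOmega hpi hN).

Lemma pi_RpN_eq (x y : Rr) : vge N%:R (val x - val y) ->
  (\pi_({ideal_quot I}) x = \pi_({ideal_quot I}) y)%qT.
Proof.
move=> h; apply/eqP; rewrite -Quotient.idealrBE; apply/asboolP.
by apply: (Rring_dvd pp op hpi hK); rewrite rmorphB.
Qed.

(** [quot_map] goes through a chosen representative; the result does not depend on it because [tauV]
    preserves the multiples of p^N. *)
Lemma quot_map_tauV x : quot_map tauV (\pi_({ideal_quot I})%qT x) =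
  (\pi_({ideal_quot I}) (tauV x))%qT.
Proof.
rewrite /quot_map; apply/eqP; rewrite -Quotient.idealrBE -rmorphB.
have : (repr (\pi_({ideal_quot I})%qT x) - x) \in I.
  by rewrite Quotient.idealrBE reprK.
move=> /asboolP[y ->]; apply/asboolP; exists (tauV y).
by rewrite rmorphM rmorph_nat.
Qed.

Lemma iter_quot_map_tauV i x : iter i (quot_map tauV) (\pi_({ideal_quot I})%qT x) =
  (\pi_({ideal_quot I}) (iter i tauV x))%qT.
Proof. by elim: i => //= i ->; exact: quot_map_tauV. Qed.

End Dwork.

Theorem theorem5p8
  (R : realType) (p a n : nat) (pp : prime p) (ha : (0 < a)%N)
  (Omega : valuedField R) (hOmega : is_completed_alg_closure_Qp Omega p)
  (pi : Omega) (hpi : pi ^+ p.-1 = - p%:R)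
  (K : divringClosed Omega) (hK : is_unramified_ext a K)
  (F : finFieldType) (hF : #|F| = (p ^ a)%N)
  (red : {rmorphism subring_of (ring_of_integers K) -> F})
  (hred : is_residue_map red)
  (tau tauV : {rmorphism Rring K pi -> Rring K pi})
  (tauK : cancel tau tauV) (tauVK : cancel tauV tau)
  (tau_id : forall x : Rring K pi, val x \in Zp_adjoin pi -> tau x = x)
  (tau_frob : is_frobenius_lift p tau)
  (f : mpoly.mpoly n F) (f_neq0 : f != 0)
  (delta : set 'rV[R]_n) (hdelta : is_lattice_polytope delta)
  (delta1_sub : delta1 f `<=` delta) (delta_sub2 : delta `<=` delta2 f)
  (N : nat) (hN : (0 < N)%N) :
  let q := (p ^ a)%N in
  let Fr : 'rV[int]_(1 + n) -> Rring K pi :=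
    FcoefR p K pi f (teichmuller p red) in
  let I := RpN_ideal K pp hOmega hpi hN in
  let t := Num.ceil (p%:R ^+ 2 * N%:R / (p%:R - 1) ^+ 2 : R) - 1 in
  finite_set (index_set p N delta) /\
  forall (W : nat) (idx : 'I_W -> 'rV[int]_(1 + n)),
    enumerates idx (index_set p N delta) ->
    let A : 'M[{ideal_quot I}]_W :=
      \matrix_(i, j) (\pi_({ideal_quot I})
                        (tauV (Fr (idx i *+ p - idx j))))%qT in
    (forall (k : nat) (L : finFieldType) (iota : {rmorphism F -> L}),
       (0 < k)%N -> #|L| = (q ^ k)%N ->
       ((q ^ k)%:R - 1) ^+ n.+1 *
         \tr ((\prod_(i < a) map_mx (iter i (quot_map tauV)) A) ^+ k)
       = (q ^ k)%:R * (torus_count iota f)%:R - ((q ^ k)%:R - 1) ^+ n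
         :> {ideal_quot I}) /\
    (lattice_points (dilate t%:~R (Delta delta)) #= `I_W)%card.

Proof.
move=> q Fr I t; split; first exact: (index_set_finite p N delta_sub2).
move=> W idx [idx_inj idx_ran] A.
have idxS i : index_set p N delta (idx i) by rewrite -idx_ran; exists i.
have u0 i l : 0 <= idx i 0 l by have [] := idxS i.
have uK i : of_mnm (to_mnm (idx i)) = idx i by apply: to_mnmK.
split; last first.
  rewrite (index_set_dilate pp hN delta_sub2); last by rewrite (weight_boundE _ _ pp).
  rewrite -idx_ran; apply: (card_eq_trans (inj_card_eq (in2W idx_inj))).
  have -> : `I_W = range (@nat_of_ord W).
    by apply/seteqP; split => [i /= iW|_ [i _ <-] /=]; [exists (Ordinal iW)|].
  by rewrite card_eq_sym; apply: inj_card_eq => i j _ _; exact: val_inj.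
move=> k L iota k0 hL; pose b := (a * k)%N.
have b0 : (0 < b)%N by rewrite muln_gt0 ha.
have ab : (a %| b)%N by exact: dvdn_mulr.
have qE : (q ^ k = p ^ b)%N by rewrite /q -expnM.
have [op cV _] := hOmega.
rewrite qE in hL *.
have [om [[om0 omM omQ omN0] [omD omT]]] :=
  teich_embedding pp ha hOmega hK hF hred iota b0 ab hL.
pose v i := to_mnm (idx i).
have v_inj : injective v by move=> i j hij; apply: idx_inj; rewrite -(uK i) -(uK j) -/(v i) -/(v j) hij.
have v_im w : (exists i, v i = w) <-> cone_mnm delta w /\ (w ord0)%:R < weight_bound R p N.
  rewrite -(index_set_mnm p N delta_sub2); split=> [[i <-]|]; first by rewrite uK.
  rewrite -idx_ran => -[i _ hi]; exists i.
  by rewrite /v hi of_mnmK.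
(* The first summand of D makes the truncation error of theta at least N in valuation; the second
   bounds all index weights, even after multiplication by p. *)
pose B := weight_bound R p N; pose D := (Num.bound (N%:R / kappa R p) + Num.bound B * p)%N.
have kp := kappa_gt0 R pp.
have B0 : 0 <= B by apply: le_trans ler01 (ltW _); exact: weight_bound_gt1.
have BB : B <= (Num.bound B)%:R by apply: ltW; exact: archi_boundP.
have hD1 : N%:R <= D.+1%:R * kappa R p.
  rewrite -ler_pdivrMr //; apply: le_trans (ltW (archi_boundP _)) _.
    by rewrite divr_ge0 // ltW.
  by rewrite ler_nat /D leqW // leq_addr.
have hD2 : B <= D%:R.
  apply: (le_trans BB); rewrite ler_nat; apply: leq_trans (leq_addl _ _).
  by rewrite leq_pmulr // prime_gt0.
have hD3 i : (v i ord0 * p <= D)%N.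
  apply: leq_trans (leq_addl _ _); rewrite leq_mul2r; apply/orP; right.
  rewrite -(ler_nat R); apply: le_trans BB; apply: ltW.
  by have [_] := (v_im (v i)).1 (ex_intro _ i erefl).
pose A0 := frob_mx p red tauV f idx.
pose PI : {rmorphism Rring K pi -> {ideal_quot I}} := \pi_({ideal_quot I})%qT.
have AE : A = map_mx PI A0 by apply/matrixP => i j; rewrite !mxE.
pose C i := map_mx (iter i tauV) A0.
have CE i : map_mx (iter i (quot_map tauV)) A = map_mx PI (C i).
  by apply/matrixP => l m; rewrite AE !mxE; exact: iter_quot_map_tauV.
have Cper i : C (i + a)%N = C i.
  exact: (frob_mx_period pp ha hOmega hpi hK hF hred tauK tau_id tau_frob f u0 i hD3).
(* Everything is pulled back to matrices over R, where by periodicity the k-th power of the product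
   of a factors is one product of b = a k factors. *)
rewrite (eq_bigr _ (fun (i : 'I_a) _ => CE i)) -map_mx_prod -map_mx_exp.
rewrite (prodr_periodic k Cper) -/b.
set X := \prod_(i < b) C i.
have -> : ((p ^ b)%:R - 1) ^+ n.+1 * \tr (map_mx PI X) =
    PI (((p ^ b)%:R - 1) ^+ n.+1 * \tr X).
  by rewrite trace_map_mx (rmorphM PI) (rmorphXn PI) (rmorphB PI) rmorph_nat rmorph1.
have -> : (p ^ b)%:R * (torus_count iota f)%:R - ((p ^ b)%:R - 1) ^+ n =
    PI ((p ^ b)%:R * (torus_count iota f)%:R - ((p ^ b)%:R - 1) ^+ n).
  by rewrite (rmorphB PI) (rmorphM PI) (rmorphXn PI) (rmorphB PI) !rmorph_nat rmorph1.
(* The equality in R / (p^N) becomes a lower bound N on a valuation in Omega. *)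
apply: (pi_RpN_eq pp hOmega hpi hK hN).
pose VL : {rmorphism Rring K pi -> Omega} := val.
rewrite -[val (_ * _)]/(VL _) -[val (_ - _)]/(VL _).
rewrite (rmorphM VL) (rmorphB VL) (rmorphM VL) !(rmorphXn VL) !(rmorphB VL) !rmorph_nat rmorph1.
rewrite -trace_map_mx /X map_mx_prod.
have := dwork_congruence pp op cV hpi b0 hL om0 omM omQ omN0 omD omT delta1_sub delta_sub2
  (teich_int pp ha op cV hK hF hred) v_inj v_im hD1 hD2.
congr (vge _ (_ * \tr _ - _)).
rewrite /frobenius_list big_map -{1}[b]subn0 -/(index_iota 0 b) big_mkord.
apply: eq_bigr => i _.
exact: esym (frob_mx_iter pp ha hOmega hpi hK hF hred tauK tau_id tau_frob f u0 ab (ltn_ord i) hD3).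
Qed.
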